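(* Let $\mathcal H$ be a complex Hilbert space, $(\Sigma,\mathcal M,\mu)$ a measure space, $\pi\in\mathrm{SQ}(\mathbb B(\mathcal H),\mu)$, and let $\mathcal G$ be a Fréchet space continuously and densely embedded in $\mathcal H$. Let $\mathscr G(\Sigma):=\Phi[\mathcal G\widehat\otimes_p\overline{\mathcal G}]\subset\mathscr B_2(\Sigma)\subset L^2(\Sigma;\mu)$. With the algebraic and topological structure induced from $\mathcal G\widehat\otimes_p\overline{\mathcal G}$ (transported by $\Phi$) and with the scalar product $\langle\cdot,\cdot\rangle_{(\Sigma)}$, the space $\mathscr G(\Sigma)$ becomes a Fréchet–Hilbert algebra composed of trace-class symbols (that is, $\mathscr G(\Sigma)\subset\mathscr B_1(\Sigma)$), continuously and densely embedded into $\mathscr B_2(\Sigma)$. Its topological dual $\mathscr G'(\Sigma)$ contains all the operator-bounded symbols, i.e. the elements of $\mathscr B(\Sigma)$ (where $g\in\mathscr B(\Sigma)$ is identified with the functional determined by the duality $f\mapsto\langle f,g\rangle_{(\Sigma)}$). The restriction $\Phi:\mathcal G\widehat\otimes_p\overline{\mathcal G}\to\mathscr G(\Sigma)$ is an isomorphism of Fréchet–Hilbert algebras.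
   Context: Inner products are linear in the first variable and antilinear in the second. $\mathrm{SQ}(\mathbb B(\mathcal H),\mu)$ denotes the set of all almost everywhere defined, weakly measurable maps $\pi:\Sigma\to\mathbb B(\mathcal H)$ such that $\int_\Sigma\langle\pi(s)u_1,v_1\rangle\langle v_2,\pi(s)u_2\rangle\,d\mu(s)=\langle u_1,u_2\rangle\langle v_2,v_1\rangle$ for all $u_1,u_2,v_1,v_2\in\mathcal H$. $\overline{\mathcal H}$, $\overline{\mathcal G}$ are conjugate spaces, $\widehat\otimes$ is the Hilbert space tensor product, $\widehat\otimes_p$ the completed projective tensor product. $\mathbb B_1,\mathbb B_2,\mathbb B_\infty$ denote trace-class, Hilbert–Schmidt and compact operators. Symbol spaces: $\Lambda:\mathcal H\widehat\otimes\overline{\mathcal H}\to\mathbb B_2(\mathcal H)$ is the unitary operator with $\Lambda(u\otimes v)=\langle\cdot,v\rangle u$; $\Phi:\mathcal H\widehat\otimes\overline{\mathcal H}\to L^2(\Sigma;\mu)$ is the linear isometry with $\Phi(u\otimes v)=\langle\pi(\cdot)u,v\rangle$; $\mathscr B_2(\Sigma):=\mathrm{Ran}\,\Phi$; $\Pi:=\Lambda\circ\Phi^{-1}:\mathscr B_2(\Sigma)\to\mathbb B_2(\mathcal H)$ is unitary. On $\mathscr B_2(\Sigma)$, $f\star g:=\Pi^{-1}[\Pi(f)\Pi(g)]$ and $f^\star:=\Pi^{-1}[\Pi(f)^*]$. $\mathscr B_1(\Sigma):=\Pi^{-1}(\mathbb B_1(\mathcal H))$ (trace-class symbols). $\mathscr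 B_\infty(\Sigma)$ is the completion of $\mathscr B_2(\Sigma)$ in the norm $\|\Pi(f)\|_{\mathbb B(\mathcal H)}$ and $\mathscr B(\Sigma)$ (operator-bounded symbols) is its multiplier $C^*$-algebra; $\Pi$ extends to a $*$-isomorphism $\mathscr B(\Sigma)\cong\mathbb B(\mathcal H)$. $\langle f,g\rangle_{(\Sigma)}:=\mathrm{Tr}[\Pi(f)\Pi(g)^*]$ when $f,g\in\mathscr B_2(\Sigma)$ (then it equals $\int_\Sigma f\overline g\,d\mu$) or $f\in\mathscr B_1(\Sigma)$, $g\in\mathscr B(\Sigma)$. For every such $\mathcal G$, the space $\mathcal G\widehat\otimes_p\overline{\mathcal G}$ is a Fréchet space continuously and densely embedded in $\mathcal H\widehat\otimes\overline{\mathcal H}$ by the canonical map extending the inclusion $\mathcal G\otimes\overline{\mathcal G}\subset\mathcal H\otimes\overline{\mathcal H}$; by a slight abuse of notation it is treated as a dense subspace of $\mathcal H\widehat\otimes\overline{\mathcal H}$. The $*$-algebra structure on $\mathcal H\widehat\otimes\overline{\mathcal H}$ is the one making $\Lambda$ a $*$-isomorphism: $(u\otimes v)^*=v\otimes u$, $(u\otimes v)\cdot(u'\otimes v')=\langle u',v\rangle\,u\otimes v'$; that on $\mathcal G\widehat\otimes_p\overline{\mathcal G}$ is given by the same formulas for $u,v,u',v'\in\mathcal G$, extended by continuity, with the scalar product of $\mathcal H\widehat\otimes\overline{\mathcal H}$. A Hilbert algebra is a $*$-algebra $(\mathscr A,\#,{}^\#)$ with a scalar product such that $\langle g^\#,f^\#\rangle=\langle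 f,g\rangle$ and $\langle f\#g,h\rangle=\langle g,f^\#\#h\rangle$ for all $f,g,h$; each left multiplication $f\mapsto g\#f$ is continuous for the scalar product norm; and $\mathscr A\#\mathscr A$ is total in $\mathscr A$ (completeness is not required). A Fréchet $*$-algebra is a $*$-algebra with a Fréchet locally convex topology for which the involution is continuous and the product separately continuous. A Fréchet–Hilbert algebra is simultaneously a Fréchet $*$-algebra and a Hilbert algebra, the Fréchet topology being finer than the topology of the scalar product. An isomorphism of Fréchet–Hilbert algebras is a $*$-algebra isomorphism that is a homeomorphism for the Fréchet topologies and preserves scalar products.
   Formalization: The canonical map from the completed projective tensor product of G and its conjugate into the Hilbert tensor product of H and its conjugate is assumed injective; this can fail when G lacks the approximation property, and then the restriction of Φ is not an isomorphism. *)

(* Defs.v *)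
From HB Require Import structures.
From mathcomp Require Import all_boot all_order all_algebra.
From mathcomp Require Import complex.
From mathcomp Require Import all_classical all_reals all_analysis.
From mathcomp Require Import measurable_realfun.
Set Implicit Arguments.
Unset Strict Implicit.
Unset Printing Implicit Defensive.
Import Order.TTheory GRing.Theory Num.Theory.
Import numFieldNormedType.Exports.
Local Open Scope classical_set_scope.
Local Open Scope ring_scope.

HB.mixin Record isHilbert (R : realType) (H : Type)
    of CompleteNormedModule R[i] H := {
  dot : H -> H -> R[i];
  dot_linearl : forall (a : R[i]) x y z,
    dot (a *: x + y) z = a * dot x z + dot y z;
  dot_conj : forall x y, dot y x = (dot x y)^*;
  dot_norm : forall x, dot x x = `|x| ^+ 2 }.

#[short(type="hilbertType")]
HB.structure Definition Hilbert (R : realType) :=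
  {H of isHilbert R H & CompleteNormedModule R[i] H}.

(* The conjugate space: the same additive group and topology, with scalar
   multiplication (a, x) |-> a^* *: x and scalar product (x, y) |-> dot y x. *)
Definition conj_space (V : Type) : Type := V.
Definition to_conj (V : Type) : V -> conj_space V := id.

HB.instance Definition _ (V : choiceType) := Choice.on (conj_space V).
HB.instance Definition _ (V : zmodType) := GRing.Zmodule.on (conj_space V).

Section ConjLmodule.
Variables (R : realType) (V : lmodType R[i]).
Let scale (a : R[i]) (x : conj_space V) : conj_space V := (a^* *: (x : V)).
Let scaleA a b x : scale a (scale b x) = scale (a * b) x.
Proof. by rewrite /scale scalerA rmorphM. Qed.
Let scale1 : left_id 1 scale.
Proof. by move=> x; rewrite /scale rmorph1 scale1r. Qed.
Let scaleDr : right_distributive scale +%R.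
Proof. by move=> a x y; rewrite /scale scalerDr. Qed.
Let scaleDl x : {morph scale^~ x : a b / a + b}.
Proof. by move=> a b; rewrite /scale rmorphD/= scalerDl. Qed.
HB.instance Definition _ := GRing.Zmodule_isLmodule.Build R[i] (conj_space V)
  scaleA scale1 scaleDr scaleDl.
Lemma conj_scaleE (a : R[i]) (x : V) :
  a *: to_conj x = to_conj (a^* *: x).
Proof. by []. Qed.
End ConjLmodule.

HB.instance Definition _ (V : topologicalType) := Topological.on (conj_space V).
HB.instance Definition _ (V : uniformType) := Uniform.on (conj_space V).

Lemma conjC_continuous (K : numClosedFieldType) :
  continuous (fun a : K^o => a^* : K^o).
Proof.
move=> a A /nbhs_ballP[e e0 sA]; apply/nbhs_ballP; exists e => // b.
rewrite -ball_normE/= => ab; apply: sA.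
by rewrite -ball_normE/= -rmorphB norm_conjC.
Qed.

Section ConjTvs.
Variables (R : realType) (V : tvsType R[i]).
Notation W := (conj_space V).
Let conj_add_continuous : continuous (fun x : W * W => x.1 + x.2).
Proof. exact: (@add_continuous V). Qed.
Let conj_scale_continuous : continuous (fun z : R[i]^o * W => z.1 *: z.2).
Proof.
move=> z U nU.
have /= [[A B] /= [nA nB] sAB] := @scale_continuous _ V ((z.1^* : R[i]^o), z.2) U nU.
exists ((fun a : R[i]^o => a^*) @^-1` A, B) => /=.
  by split => //; exact: (conjC_continuous nA).
by move=> [a x] [/= aA xB]; exact: (sAB (a^*, x)).
Qed.
Let conj_locally_convex :
  exists2 B : set_system W, (forall b, b \in B -> convex_set b) & basis B.
Proof.
have [B Bc Bb] := @locally_convex _ V.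
exists B; last exact: Bb.
move=> b /Bc cb x y l xb yb.
suff -> : (conv l x y : V) = conv l (x : convex_lmodType V) (y : convex_lmodType V).
  exact: cb.
rewrite -[LHS]/((l%:num)^* *: (x : V) + (1 - l%:num)^* *: (y : V)).
rewrite -[RHS]/((l%:num) *: (x : V) + (1 - l%:num) *: (y : V)).
by congr (_ *: _ + _ *: _); apply/conj_Creal/ger0_real; rewrite // subr_ge0.
Qed.
HB.instance Definition _ := PreTopologicalNmodule_isTopologicalNmodule.Build
  W conj_add_continuous.
HB.instance Definition _ := TopologicalNmodule_isTopologicalLmodule.Build
  R[i] W conj_scale_continuous.
HB.instance Definition _ := Uniform_isTvs.Build R[i] W conj_locally_convex.
End ConjTvs.

HB.instance Definition _ (K : numDomainType) (V : pseudoMetricNormedZmodType K) :=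
  PseudoMetricNormedZmod.on (conj_space V).

Section ConjNormed.
Variables (R : realType) (V : normedModType R[i]).
Let conj_normrZ (a : R[i]) (x : conj_space V) : `|a *: x| = `|a| * `|x|.
Proof. by rewrite -[LHS]/(`|a^* *: (x : V)|) normrZ norm_conjC. Qed.
HB.instance Definition _ :=
  PseudoMetricNormedZmod_Tvs_isNormedModule.Build R[i] (conj_space V) conj_normrZ.
End ConjNormed.

HB.instance Definition _ (V : completeType) := Complete.on (conj_space V).
HB.instance Definition _ (R : realType) (V : completeNormedModType R[i]) :=
  Complete.on (conj_space V).

Section ConjHilbert.
Variables (R : realType) (H : hilbertType R).
Let cdot (x y : conj_space H) : R[i] := dot (y : H) (x : H).
Let cdot_linearl (a : R[i]) x y z :
  cdot (a *: x + y) z = a * cdot x z + cdot y z.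
Proof.
rewrite /cdot dot_conj -[X in dot X _]/(a^* *: (x : H) + (y : H)) dot_linearl.
by rewrite rmorphD rmorphM/= conjCK -!dot_conj.
Qed.
Let cdot_conj x y : cdot y x = (cdot x y)^*.
Proof. exact: dot_conj. Qed.
Let cdot_norm x : cdot x x = `|x| ^+ 2.
Proof. exact: dot_norm. Qed.
HB.instance Definition _ :=
  isHilbert.Build R (conj_space H) cdot_linearl cdot_conj cdot_norm.
Lemma conj_dotE (x y : H) : dot (to_conj x) (to_conj y) = dot y x.
Proof. by []. Qed.
End ConjHilbert.

Section BoundedOperators.
Variables (R : realType) (H : hilbertType R).

Record bop := Bop { bop_fun :> {linear H -> H}; bop_continuous : continuous bop_fun }.

HB.instance Definition _ := gen_eqMixin bop.
HB.instance Definition _ := gen_choiceMixin bop.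

Fact bop0_continuous : continuous (\0 : {linear H -> H}).
Proof. by move=> x; exact: cvg_cst. Qed.
Definition bop0 : bop := Bop bop0_continuous.

Fact bop_comp_continuous (A B : bop) : continuous (A \o B : {linear H -> H}).
Proof.
by move=> x; apply: continuous_comp; exact: bop_continuous.
Qed.
Definition bop_comp (A B : bop) : bop := Bop (@bop_comp_continuous A B).

Definition is_adjoint (A B : bop) := forall x y, dot (A x) y = dot x (B y).
(* By the Riesz theorem the adjoint exists; it is unique. *)
Definition adjoint (A : bop) : bop := xget bop0 [set B | is_adjoint A B].

Definition positive_op (A : bop) := forall x, 0 <= dot (A x) x.

Definition opnorm (A : bop) : R :=
  sup [set complex.Re `|A x| | x in [set x : H | `|x| <= 1]].

Definition onb (E : set H) :=
  [/\ forall e, E e -> dot e e = 1,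
      forall e f, E e -> E f -> e <> f -> dot e f = 0 &
      forall x, (forall e, E e -> dot x e = 0) -> x = 0].

(* Unconditional convergence of a complex family: convergence of the finite
   partial sums along inclusion. *)
Definition has_sum (I : choiceType) (D : set I) (a : I -> R[i]) (t : R[i]) :=
  forall e : R[i], 0 < e -> exists2 A, fsets D A &
    forall B, fsets D B -> A `<=` B -> `|\sum_(i \in B) a i - t| < e.

(* Meaningful when the diagonal sums converge to the same value in all
   orthonormal bases, in particular when A is trace class. *)
Definition trace (A : bop) : R[i] :=
  xget 0 [set t | forall E, onb E -> has_sum E (fun e => dot (A e) e) t].

Definition hilbert_schmidt (A : bop) := exists2 E, onb E &
  (\esum_(e in E) (complex.Re (`|A e| ^+ 2))%:E < +oo)%E.

(* S is the absolute value |A|, the positive square root of A^* A. *)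
Definition trace_class (A : bop) := exists S : bop,
  [/\ positive_op S, bop_comp S S = bop_comp (adjoint A) A &
      exists2 E, onb E & (\esum_(e in E) (complex.Re (dot (S e) e))%:E < +oo)%E].

End BoundedOperators.

Section Spaces.
Variable R : realType.
Notation C := R[i].

(* A tvsType carries a uniformity that is only required to induce its topology,
   so completeness is expressed through neighbourhoods of 0. *)
Definition tvs_cauchy (E : tvsType C) (F : set_system E) :=
  forall U, nbhs (0 : E) U ->
    exists2 A, F A & forall x y, A x -> A y -> U (x - y).

Definition tvs_complete (E : tvsType C) :=
  forall F : set_system E, ProperFilter F -> tvs_cauchy F ->
    exists x : E, F --> x.

Definition frechet_space (E : tvsType C) :=
  [/\ hausdorff_space E,
      exists V : nat -> set E, (forall n, nbhs (0 : E) (V n)) /\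
        forall U, nbhs (0 : E) U -> exists n, V n `<=` U &
      tvs_complete E].

Definition bilinear_map (E F V : lmodType C) (b : E -> F -> V) :=
  (forall y a x x', b (a *: x + x') y = a *: b x y + b x' y) /\
  (forall x a y y', b x (a *: y + y') = a *: b x y + b x y').

Section HilbertTensor.
Variables H K T : hilbertType R.
Definition is_hilbert_tensor (t : H -> K -> T) :=
  [/\ bilinear_map t,
      forall x x' y y', dot (t x y) (t x' y') = dot x x' * dot y y' &
      closure [set z | exists s : seq (H * K),
        z = \sum_(xy <- s) t xy.1 xy.2] = setT].
End HilbertTensor.

Definition continuous_seminorm (E : tvsType C) (p : E -> R) :=
  [/\ forall x y, p (x + y) <= p x + p y,
      forall (a : C) x, p (a *: x) = complex.Re `|a| * p x &
      continuous p].

Section ProjectiveTensor.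
Variables E F P : tvsType C.
Variable t : E -> F -> P.

Definition tensor_sum (s : seq (E * F)) : P := \sum_(xy <- s) t xy.1 xy.2.

Definition projective_seminorm (p : E -> R) (q : F -> R) (z : P) : R :=
  inf [set \sum_(xy <- s) p xy.1 * q xy.2 | s in [set s | tensor_sum s = z]].

(* P is a completed projective tensor product of E and F: the span of the t x y
   is the algebraic tensor product (second clause: no relation holds in P that
   does not hold for every bilinear map), it is dense in the complete Hausdorff
   space P, and the topology it inherits from P is the projective one. *)
Definition is_projective_tensor :=
  [/\ bilinear_map t,
      (forall s, tensor_sum s = 0 -> forall (V : lmodType C) (b : E -> F -> V),
         bilinear_map b -> \sum_(xy <- s) b xy.1 xy.2 = 0),
      closure (range tensor_sum) = setT,
      hausdorff_space P /\ tvs_complete P &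
      forall U : set P,
        within (range tensor_sum) (nbhs (0 : P)) U <->
        exists (p : E -> R) (q : F -> R) (e : R),
          [/\ continuous_seminorm p, continuous_seminorm q, 0 < e &
              range tensor_sum `&` [set z | projective_seminorm p q z < e]
                `<=` U]].
End ProjectiveTensor.

Section Algebras.
Variable E : lmodType C.
Variables (mul : E -> E -> E) (star : E -> E) (ip : E -> E -> C).

Definition star_algebra :=
  [/\ bilinear_map mul,
      associative mul,
      forall (a : C) x y, star (a *: x + y) = a^* *: star x + star y,
      involutive star &
      forall x y, star (mul x y) = mul (star y) (star x)].

Definition scalar_product :=
  [/\ forall (a : C) x y z, ip (a *: x + y) z = a * ip x z + ip y z,
      forall x y, ip y x = (ip x y)^*,
      forall x, 0 <= ip x x &
      forall x, ip x x = 0 -> x = 0].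

(* Neighbourhoods for the norm sqrt (ip x x); as e : C, 0 < e forces e real. *)
Definition ip_nbhs (x : E) (U : set E) :=
  exists2 e : C, 0 < e & forall y, ip (y - x) (y - x) < e ^+ 2 -> U y.

Definition hilbert_algebra :=
  [/\ star_algebra, scalar_product,
      (forall f g, ip (star g) (star f) = ip f g) /\
      (forall f g h, ip (mul f g) h = ip g (mul (star f) h)),
      (forall g f U, ip_nbhs (mul g f) U -> ip_nbhs f (mul g @^-1` U)) &
      forall f U, ip_nbhs f U -> exists s : seq (E * E),
        U (\sum_(gh <- s) mul gh.1 gh.2)].
End Algebras.

Section FrechetHilbert.
Variables (E : tvsType C).
Variables (mul : E -> E -> E) (star : E -> E) (ip : E -> E -> C).

Definition frechet_star_algebra :=
  [/\ frechet_space E, star_algebra mul star, continuous star,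
      forall x, continuous (mul x) & forall y, continuous (mul^~ y)].

Definition frechet_hilbert_algebra :=
  [/\ frechet_star_algebra, hilbert_algebra mul star ip &
      forall x U, ip_nbhs ip x U -> nbhs x U].
End FrechetHilbert.

Definition frechet_hilbert_iso (E F : tvsType C)
    (mulE : E -> E -> E) (starE : E -> E) (ipE : E -> E -> C)
    (mulF : F -> F -> F) (starF : F -> F) (ipF : F -> F -> C) (f : E -> F) :=
  [/\ linear f /\ (forall x y, f (mulE x y) = mulF (f x) (f y)),
      forall x, f (starE x) = starF (f x),
      forall x y, ipF (f x) (f y) = ipE x y,
      continuous f &
      exists g : F -> E, [/\ cancel f g, cancel g f & continuous g]].

End Spaces.

Section ComplexFunctions.
Context d (S : measurableType d) (R : realType) (mu : {measure set S -> \bar R}).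

Definition cmeasurable_fun (D : set S) (f : S -> R[i]) :=
  measurable_fun D (@complex.Re R \o f) /\ measurable_fun D (@complex.Im R \o f).

Definition cintegrable (D : set S) (f : S -> R[i]) :=
  mu.-integrable D (EFin \o @complex.Re R \o f) /\
  mu.-integrable D (EFin \o @complex.Im R \o f).

Definition cintegral (D : set S) (f : S -> R[i]) : R[i] :=
  Complex (\int[mu]_(x in D) complex.Re (f x)) (\int[mu]_(x in D) complex.Im (f x)).

Definition cabs (f : S -> R[i]) : S -> R := fun x => complex.Re `|f x|.

Definition L2norm (f : S -> R[i]) : \bar R := 'N[mu]_2%:E[EFin \o cabs f]%E.

Definition sq_integrable (f : S -> R[i]) :=
  cmeasurable_fun setT f /\ (L2norm f < +oo)%E.

End ComplexFunctions.

Section L2lemmas.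
Context d (S : measurableType d) (R : realType) (mu : {measure set S -> \bar R}).
Implicit Types f g : S -> R[i].

Lemma ReD (x y : R[i]) : complex.Re (x + y) = complex.Re x + complex.Re y.
Proof. by case: x y => [a b] [c e]. Qed.
Lemma ImD (x y : R[i]) : complex.Im (x + y) = complex.Im x + complex.Im y.
Proof. by case: x y => [a b] [c e]. Qed.
Lemma cabs_ge0 f x : 0 <= cabs f x.
Proof. by rewrite /cabs normc_def/= sqrtr_ge0. Qed.
Lemma cabsE f x : (cabs f x)%:C%C = `|f x|.
Proof. by rewrite /cabs RRe_real// normr_real. Qed.

Lemma measurable_cabs f : cmeasurable_fun setT f -> measurable_fun setT (cabs f).
Proof.
move=> [mr mi].
rewrite (_ : cabs f = fun x => Num.sqrt ((@complex.Re R \o f) x ^+ 2 + (@complex.Im R \o f) x ^+ 2)); last first.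
  by apply/funext => x; rewrite /cabs normc_def.
apply: (@measurableT_comp _ _ _ _ _ _ (@Num.sqrt R)); first by apply: continuous_measurable_fun; exact: sqrt_continuous.
by apply: measurable_funD; exact: measurable_funX.
Qed.

Lemma cmeasurable_lin (a : R[i]) f g : cmeasurable_fun setT f ->
  cmeasurable_fun setT g -> cmeasurable_fun setT (a *: f + g).
Proof.
move=> [mrf mif] [mrg mig]; case: a => a b; split.
- rewrite (_ : _ \o _ = (fun x => (a * (@complex.Re R \o f) x - b * (@complex.Im R \o f) x) + (@complex.Re R \o g) x)); last first.
    by apply/funext => x; rewrite /= -[(_ + g) x]/((a +i* b)%C * f x + g x) ReD; case: (f x).
  apply: measurable_funD => //; apply: measurable_funB; apply: measurable_funM => //.
- rewrite (_ : _ \o _ = (fun x => (a * (@complex.Im R \o f) x + b * (@complex.Re R \o f) x) + (@complex.Im R \o g) x)); last first.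
    by apply/funext => x; rewrite /= -[(_ + g) x]/((a +i* b)%C * f x + g x) ImD; case: (f x).
  apply: measurable_funD => //; apply: measurable_funD; apply: measurable_funM => //.
Qed.

Lemma L2norm_ge0 f : (0 <= L2norm mu f)%E.
Proof. exact: Lnorm_ge0. Qed.

Lemma L2normE f : (L2norm mu f = (\int[mu]_x (cabs f x ^+ 2)%:E) `^ 2^-1)%E.
Proof.
rewrite /L2norm unlock /Lnorm; congr (_ `^ _)%E; apply: eq_integral => x _ /=.
by rewrite ger0_norm ?cabs_ge0// powR_mulrn// cabs_ge0.
Qed.

Lemma L2norm_eq f g : {ae mu, forall x, f x = g x} ->
  cmeasurable_fun setT f -> cmeasurable_fun setT g -> L2norm mu f = L2norm mu g.
Proof.
move=> fg mf mg; rewrite !L2normE; congr (_ `^ _)%E; apply: ge0_ae_eq_integral => //=.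
- by apply/measurable_EFinP; apply: measurable_funX; exact: measurable_cabs.
- by apply/measurable_EFinP; apply: measurable_funX; exact: measurable_cabs.
- by move=> x _; rewrite lee_fin sqr_ge0.
- by move=> x _; rewrite lee_fin sqr_ge0.
- by apply: filterS fg => x E _; rewrite /cabs E.
Qed.

Lemma L2norm_le f (g : S -> R) : cmeasurable_fun setT f -> measurable_fun setT g ->
  (forall x, cabs f x <= g x) -> (L2norm mu f <= 'N[mu]_2%:E[EFin \o g])%E.
Proof.
move=> mf mg fg; rewrite L2normE unlock /Lnorm.
apply: gt0_ler_poweR.
- by [].
- by rewrite in_itv/= leey andbT; apply: integral_ge0 => x _; rewrite lee_fin sqr_ge0.
- by rewrite in_itv/= leey andbT; apply: integral_ge0 => x _; rewrite lee_fin powR_ge0.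
have g0 x : 0 <= g x by rewrite (le_trans _ (fg x))// cabs_ge0.
under [leRHS]eq_integral => x _ do
  rewrite /= ger0_norm// powR_mulrn//.
apply: ge0_le_integral => //=.
- by move=> x _; rewrite lee_fin sqr_ge0.
- by apply/measurable_EFinP; apply: measurable_funX; exact: measurable_cabs.
- by apply/measurable_EFinP; apply: measurable_funX.
- by move=> x _; rewrite lee_fin lerXn2r// nnegrE ?cabs_ge0.
Qed.

Lemma L2norm_triangle f g : cmeasurable_fun setT f -> cmeasurable_fun setT g ->
  (L2norm mu (f + g)%R <= L2norm mu f + L2norm mu g)%E.
Proof.
move=> mf mg.
apply: le_trans (@minkowski_EFin _ _ _ mu _ _ 2 (measurable_cabs mf) (measurable_cabs mg) _); last by rewrite ler1n.
apply: L2norm_le.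
- by have := cmeasurable_lin 1 mf mg; rewrite scale1r.
- by apply: measurable_funD; exact: measurable_cabs.
- move=> x; rewrite -lecR/= rmorphD/= !cabsE; exact: ler_normD.
Qed.

Lemma L2normZ (a : R[i]) f : cmeasurable_fun setT f ->
  (L2norm mu (a *: f)%R = (complex.Re `|a|)%:E * L2norm mu f)%E.
Proof.
move=> mf; rewrite !L2normE.
have a0 : 0 <= complex.Re `|a| by rewrite normc_def/= sqrtr_ge0.
have E x : cabs (a *: f) x = complex.Re `|a| * cabs f x.
  rewrite /cabs -[(a *: f) x]/(a * f x) normrM !normc_def/=.
  by rewrite mulr0 subr0.
under eq_integral => x _ do rewrite E exprMn EFinM.
rewrite ge0_integralZl//=.
- rewrite poweRM//; last 2 first.
  + by rewrite lee_fin sqr_ge0.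
  + by apply: integral_ge0 => x _; rewrite lee_fin sqr_ge0.
  by rewrite poweR_EFin -powR_mulrn// -powRrM mulfV// powRr1.
- by apply/measurable_EFinP; apply: measurable_funX; exact: measurable_cabs.
- by move=> x _; rewrite lee_fin sqr_ge0.
- by rewrite lee_fin sqr_ge0.
Qed.

Lemma L2norm_eq0 f : cmeasurable_fun setT f -> L2norm mu f = 0%E ->
  {ae mu, forall x, f x = 0}.
Proof.
move=> mf /Lnorm_eq0_eq0 H.
have /H : measurable_fun setT (EFin \o cabs f).
  by apply/measurable_EFinP; exact: measurable_cabs.
have e2 : (0 < 2%:E :> \bar R)%E by rewrite lte_fin.
move=> /(_ e2).
apply: filterS => x /(_ I)/= [E].
by apply/eqP; rewrite -normr_eq0 -cabsE E.
Qed.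

Lemma sq_integrable_lin (a : R[i]) f g : sq_integrable mu f ->
  sq_integrable mu g -> sq_integrable mu (a *: f + g).
Proof.
move=> [mf lf] [mg lg]; split; first exact: cmeasurable_lin.
have maf : cmeasurable_fun setT (a *: f).
  have := cmeasurable_lin a mf (_ : cmeasurable_fun setT 0).
  by rewrite addr0; apply; split; exact: measurable_cst.
apply: le_lt_trans (L2norm_triangle maf mg) _.
rewrite lte_add_pinfty// L2normZ// lte_mul_pinfty// ?lee_fin//.
by rewrite normc_def/= sqrtr_ge0.
Qed.

Lemma sq_integrable0 : sq_integrable mu 0.
Proof.
have m0 : cmeasurable_fun setT (0 : S -> R[i]) by split; exact: measurable_cst.
split=> //.
by have := L2normZ 0 m0; rewrite scale0r normr0 mul0e => ->.
Qed.
End L2lemmas.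

(* L^2(S; mu): square integrable complex functions modulo equality almost
   everywhere. *)
Section L2space.
Context d (S : measurableType d) (R : realType) (mu : {measure set S -> \bar R}).
Local Open Scope quotient_scope.

Record sqfun := SqFun { sqfun_fun :> S -> R[i]; sqfunP : sq_integrable mu sqfun_fun }.
HB.instance Definition _ := gen_eqMixin sqfun.
HB.instance Definition _ := gen_choiceMixin sqfun.

Definition ae_eqc (f g : sqfun) : bool := `[< {ae mu, forall x, f x = g x} >].

Let ae_eqc_refl : reflexive ae_eqc.
Proof. by move=> f; apply/asboolP; exact: aeW. Qed.
Let ae_eqc_sym : symmetric ae_eqc.
Proof.
by move=> f g; apply/idP/idP => /asboolP h; apply/asboolP; apply: filterS h => x ->.
Qed.
Let ae_eqc_trans : transitive ae_eqc.
Proof.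
move=> f g h /asboolP gf /asboolP fh; apply/asboolP.
by apply: filterS2 gf fh => x -> ->.
Qed.
Canonical ae_eqc_canonical := EquivRel ae_eqc ae_eqc_refl ae_eqc_sym ae_eqc_trans.

Definition L2 : Type := {eq_quot ae_eqc}.
HB.instance Definition _ := Choice.on L2.
HB.instance Definition _ := EqQuotient.on L2.

Definition L2_class (f : sqfun) : L2 := \pi_L2 f.
Definition L2_fun (f : L2) : sqfun := repr f.
Coercion L2_fun : L2 >-> sqfun.

Lemma L2P (f g : L2) : {ae mu, forall x, f x = g x} -> f = g.
Proof.
move=> fg; rewrite -[f]reprK -[g]reprK; apply/eqP; rewrite eqmodE; exact/asboolP.
Qed.

Lemma L2_classE (f : sqfun) : {ae mu, forall x, L2_class f x = f x}.
Proof.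
have : L2_class f = \pi_L2 f by [].
by rewrite -[LHS]reprK => /eqP; rewrite eqmodE => /asboolP.
Qed.

Definition sqfun_lin (a : R[i]) (f g : sqfun) : sqfun :=
  SqFun (sq_integrable_lin a (sqfunP f) (sqfunP g)).

Let add (f g : L2) : L2 := L2_class (sqfun_lin 1 f g).
Let zero : L2 := L2_class (SqFun (sq_integrable0 mu)).
Let scale (a : R[i]) (f : L2) : L2 := L2_class (sqfun_lin a f (L2_fun zero)).
Let opp (f : L2) : L2 := scale (-1) f.

Let zeroE : {ae mu, forall x, zero x = 0}.
Proof. exact: L2_classE. Qed.
Let addE f g : {ae mu, forall x, add f g x = f x + g x}.
Proof.
apply: filterS (L2_classE (sqfun_lin 1 f g)) => x ->.
by rewrite -[LHS]/(1 * f x + g x) mul1r.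
Qed.
Let scaleE a f : {ae mu, forall x, scale a f x = a * f x}.
Proof.
apply: filterS2 zeroE (L2_classE (sqfun_lin a f zero)) => x z0 ->.
by rewrite -[LHS]/(a * f x + zero x) z0 addr0.
Qed.
Let oppE f : {ae mu, forall x, opp f x = - f x}.
Proof. by apply: filterS (scaleE (-1) f) => x ->; rewrite mulN1r. Qed.

Let addA : associative add.
Proof.
move=> f g h; apply: L2P.
apply: filterS2 (filterI (addE f (add g h)) (addE g h))
  (filterI (addE (add f g) h) (addE f g)) => x [-> ->] [-> ->].
by rewrite addrA.
Qed.
Let addC : commutative add.
Proof.
move=> f g; apply: L2P; apply: filterS2 (addE f g) (addE g f) => x -> ->.
by rewrite addrC.
Qed.
Let add0 : left_id zero add.
Proof.
by move=> f; apply: L2P; apply: filterS2 (addE zero f) zeroE => x -> ->; rewrite add0r.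
Qed.
Let addN : left_inverse zero opp add.
Proof.
move=> f; apply: L2P; apply: filterS2 (filterI (addE (opp f) f) (oppE f)) zeroE.
by move=> x [-> ->] ->; rewrite addNr.
Qed.
HB.instance Definition _ := GRing.isZmodule.Build L2 addA addC add0 addN.

Let scaleA a b f : scale a (scale b f) = scale (a * b) f.
Proof.
apply: L2P; apply: filterS2 (filterI (scaleE a (scale b f)) (scaleE b f))
  (scaleE (a * b) f) => x [-> ->] ->.
by rewrite mulrA.
Qed.
Let scale1 : left_id 1 scale.
Proof. by move=> f; apply: L2P; apply: filterS (scaleE 1 f) => x ->; rewrite mul1r. Qed.
Let scaleDr : right_distributive scale +%R.
Proof.
move=> a f g; apply: L2P.
apply: filterS2 (filterI (scaleE a (add f g)) (addE f g))
 (filterI (addE (scale a f) (scale a g)) (filterI (scaleE a f) (scaleE a g))).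
by move=> x [-> ->] [-> [-> ->]]; rewrite mulrDr.
Qed.
Let scaleDl f : {morph scale^~ f : a b / a + b}.
Proof.
move=> a b; apply: L2P.
apply: filterS2 (scaleE (a + b) f)
 (filterI (addE (scale a f) (scale b f)) (filterI (scaleE a f) (scaleE b f))).
by move=> x -> [-> [-> ->]]; rewrite mulrDl.
Qed.
HB.instance Definition _ := GRing.Zmodule_isLmodule.Build R[i] L2
  scaleA scale1 scaleDr scaleDl.

Lemma L2_addE (f g : L2) : {ae mu, forall x, (f + g : L2) x = f x + g x}.
Proof. exact: addE. Qed.
Lemma L2_scaleE (a : R[i]) (f : L2) : {ae mu, forall x, (a *: f : L2) x = a * f x}.
Proof. exact: scaleE. Qed.
Lemma L2_0E : {ae mu, forall x, (0 : L2) x = 0}.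
Proof. exact: zeroE. Qed.

Let norm (f : L2) : R[i] := ((fine (L2norm mu f))%:C)%C.

Let cmeasL2 (f : L2) : cmeasurable_fun setT f.
Proof. by case: (sqfunP f). Qed.
Let fin (f : L2) : L2norm mu f \is a fin_num.
Proof. by rewrite ge0_fin_numE ?L2norm_ge0//; case: (sqfunP f). Qed.

Let normD (f g : L2) : norm (f + g) <= norm f + norm g.
Proof.
rewrite /norm -rmorphD/= lecR -lee_fin EFinD !fineK//.
have m : cmeasurable_fun setT ((f : S -> R[i]) + (g : S -> R[i])).
  by have := cmeasurable_lin 1 (cmeasL2 f) (cmeasL2 g); rewrite scale1r.
rewrite (L2norm_eq (L2_addE f g) (cmeasL2 _) m).
by apply: L2norm_triangle; exact: cmeasL2.
Qed.
Let normZ (a : R[i]) (f : L2) : norm (a *: f) = `|a| * norm f.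
Proof.
have m : cmeasurable_fun setT (a *: (f : S -> R[i])).
  have := cmeasurable_lin a (cmeasL2 f) (_ : cmeasurable_fun setT 0).
  by rewrite addr0; apply; split; exact: measurable_cst.
rewrite /norm (L2norm_eq (L2_scaleE a f) (cmeasL2 _) m).
rewrite L2normZ; last exact: cmeasL2.
rewrite fineM//= ?fin//  rmorphM/=; congr (_ * _).
Qed.
Let norm_eq0 (f : L2) : norm f = 0 -> f = 0.
Proof.
move=> -[] f0; have {}f0 : L2norm mu f = 0%E by rewrite -[LHS]fineK ?f0.
apply: L2P; apply: filterS2 L2_0E (L2norm_eq0 (cmeasL2 f) f0) => x -> -> //.
Qed.
HB.instance Definition _ := @Lmodule_isNormed.Build R[i] L2 norm normD normZ norm_eq0.

Lemma L2_normE (f : L2) : `|f| = ((fine (L2norm mu f))%:C)%C.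
Proof. by []. Qed.
End L2space.

(* For an injective linear f : U -> V, the subspace f(U) of V, with the topology
   (and below the product and involution) of U transported by f. *)
Record inj_linear (R : realType) (U V : lmodType R[i]) :=
  InjLinear { inj_fun :> {linear U -> V}; inj_linearP : injective inj_fun }.

Section ImageLmodule.
Variables (R : realType) (U V : lmodType R[i]) (f : inj_linear U V).

Definition im_pred : {pred V} := [pred y | y \in range f].

Fact im_submod_closed : submod_closed im_pred.
Proof.
split; first by apply/mem_set; exists 0; rewrite ?linear0.
move=> a y z /set_mem[u _ <-] /set_mem[v _ <-]; apply/mem_set.
by exists (a *: u + v); rewrite ?linearP.
Qed.
HB.instance Definition _ := GRing.isSubmodClosed.Build R[i] V im_pred im_submod_closed.

Definition im_space : Type := {y : V | y \in im_pred}.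
HB.instance Definition _ := SubChoice.on im_space.
HB.instance Definition _ := [SubChoice_isSubLmodule of im_space by <:].

Definition im_val (y : im_space) : V := val y.

Fact im_subproof (u : U) : f u \in im_pred.
Proof. by apply/mem_set; exists u. Qed.
Definition im_elt (u : U) : im_space := exist _ (f u) (im_subproof u).

Fact im_inv_subproof (y : im_space) : exists u, f u = im_val y.
Proof. by have /set_mem[u _ E] := valP y; exists u. Qed.
Definition im_inv (y : im_space) : U := projT1 (cid (im_inv_subproof y)).

Lemma im_val_elt u : im_val (im_elt u) = f u. Proof. by []. Qed.
Lemma im_invE y : f (im_inv y) = im_val y.
Proof. exact: projT2 (cid (im_inv_subproof y)). Qed.
Lemma im_eltK : cancel im_elt im_inv.
Proof. by move=> u; apply: (@inj_linearP _ _ _ f); rewrite im_invE. Qed.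
Lemma im_invK : cancel im_inv im_elt.
Proof. by move=> y; apply: val_inj; exact: im_invE. Qed.

Lemma im_elt_linear : linear im_elt.
Proof. by move=> a u v; apply: val_inj; rewrite linearP/= linearP. Qed.
Lemma im_inv_linear : linear im_inv.
Proof.
move=> a y z; apply: (can_inj im_eltK).
by rewrite im_elt_linear !im_invK.
Qed.
Lemma im_val_linear : linear im_val.
Proof. exact: linearP. Qed.
HB.instance Definition _ := GRing.isLinear.Build R[i] U im_space _ im_elt im_elt_linear.
HB.instance Definition _ := GRing.isLinear.Build R[i] im_space U _ im_inv im_inv_linear.
HB.instance Definition _ := GRing.isLinear.Build R[i] im_space V _ im_val im_val_linear.

Definition im_mul (mul : U -> U -> U) (y z : im_space) : im_space :=
  im_elt (mul (im_inv y) (im_inv z)).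
Definition im_star (star : U -> U) (y : im_space) : im_space :=
  im_elt (star (im_inv y)).
End ImageLmodule.

Section ImageTvs.
Variables (R : realType) (U : tvsType R[i]) (V : lmodType R[i]) (f : inj_linear U V).
Notation W := (im_space f).
HB.instance Definition _ := Uniform.copy W (initial_topology (@im_inv _ _ _ f)).

Lemma im_inv_continuous : continuous (@im_inv _ _ _ f : W -> U).
Proof. exact: initial_continuous. Qed.

Lemma im_nbhsP (x : W) (A : set W) :
  nbhs x A <-> exists2 B, nbhs (im_inv x) B & @im_inv _ _ _ f @^-1` B `<=` A.
Proof.
split=> [|[B nB BA]]; last first.
  by apply: filterS BA _; exact: im_inv_continuous.
case=> [C [[B oB <-] BC CA]]; exists B => //.
by apply: open_nbhs_nbhs; split.
Qed.

Lemma im_elt_continuous : continuous (@im_elt _ _ _ f : U -> W).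
Proof.
move=> u A /im_nbhsP[B]; rewrite im_eltK => nB BA.
by apply: filterS nB => v Bv; apply: BA; rewrite /= im_eltK.
Qed.

Let im_add_continuous : continuous (fun x : W * W => x.1 + x.2).
Proof.
move=> [x y] A /im_nbhsP[B]; rewrite linearD/= => nB BA.
have /= [[C D] /= [nC nD] sCD] := @add_continuous U (im_inv x, im_inv y) B nB.
exists (@im_inv _ _ _ f @^-1` C, @im_inv _ _ _ f @^-1` D).
  by split; exact: im_inv_continuous.
move=> [x' y'] [/= Cx Dy]; apply: BA; rewrite /= linearD.
exact: (sCD (im_inv x', im_inv y')).
Qed.
Let im_scale_continuous : continuous (fun z : R[i]^o * W => z.1 *: z.2).
Proof.
move=> [a x] A /im_nbhsP[B]; rewrite linearZ/= => nB BA.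
have /= [[C D] /= [nC nD] sCD] := @scale_continuous _ U ((a : R[i]^o), im_inv x) B nB.
exists (C, @im_inv _ _ _ f @^-1` D).
  by split => //; exact: im_inv_continuous.
move=> [b y] [/= Cb Dy]; apply: BA; rewrite /= linearZ.
exact: (sCD (b, im_inv y)).
Qed.
Let im_locally_convex :
  exists2 B : set_system W, (forall b, b \in B -> convex_set b) & basis B.
Proof.
have [B Bc [Bo Bb]] := @locally_convex _ U.
exists [set @im_inv _ _ _ f @^-1` b | b in B].
  move=> _ /set_mem[b /mem_set/Bc cb <-] x y l /set_mem xb /set_mem yb.
  apply/mem_set => /=.
  suff -> : im_inv (conv l x y : W) =
      conv l (im_inv x : convex_lmodType U) (im_inv y : convex_lmodType U).
    by apply/set_mem/cb; exact/mem_set.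
  rewrite -[LHS]/(im_inv (l%:num *: (x : W) + (1 - l%:num) *: (y : W))).
  by rewrite linearD/= !linearZ.
split.
  by move=> _ [b Bb' <-]; exists b => //; exact: Bo.
move=> x A /im_nbhsP[C nC CA].
have [b [Bb' bx] bC] := Bb _ _ nC.
exists (@im_inv _ _ _ f @^-1` b); first by split => //; exists b.
by move=> y /bC; exact: CA.
Qed.
HB.instance Definition _ := PreTopologicalNmodule_isTopologicalNmodule.Build
  W im_add_continuous.
HB.instance Definition _ := TopologicalNmodule_isTopologicalLmodule.Build
  R[i] W im_scale_continuous.
HB.instance Definition _ := Uniform_isTvs.Build R[i] W im_locally_convex.
End ImageTvs.

Section SquareIntegrable.
Context d (S : measurableType d) (R : realType) (mu : {measure set S -> \bar R}).
Variables (H : hilbertType R) (D : set S) (pi_ : S -> bop H).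

(* An almost everywhere defined map is given by a conull measurable domain D and
   values that are irrelevant off D; a conull domain always contains a
   measurable one. *)
Definition SQ :=
  [/\ measurable D, mu (~` D) = 0%E,
      forall u v, cmeasurable_fun D (fun s => dot (pi_ s u) v) &
      forall u1 u2 v1 v2,
        let F := fun s => dot (pi_ s u1) v1 * dot v2 (pi_ s u2) in
        cintegrable mu D F /\ cintegral mu D F = dot u1 u2 * dot v2 v1].

Variables (T : hilbertType R) (t : H -> conj_space H -> T).

Definition is_Phi (Phi : T -> L2 mu) :=
  (forall z, `|Phi z| = `|z|) /\
  forall u v, {ae mu, forall s, D s -> Phi (t u (to_conj v)) s = dot (pi_ s u) v}.

Definition is_Lambda (Lam : T -> bop H) :=
  [/\ forall u v w, Lam (t u (to_conj v)) w = dot w v *: u,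
      forall a z z' w, Lam (a *: z + z') w = a *: Lam z w + Lam z' w,
      range Lam = [set A | hilbert_schmidt A] &
      forall z z', trace (bop_comp (Lam z) (adjoint (Lam z'))) = dot z z'].

Lemma Phi_injective (Phi : {linear T -> L2 mu}) : is_Phi Phi -> injective Phi.
Proof.
move=> [iso _] x y E; apply/eqP; rewrite -subr_eq0 -normr_eq0 -iso.
by rewrite linearB/= E subrr normr0.
Qed.

Definition Phi_inj (Phi : {linear T -> L2 mu}) (hPhi : is_Phi Phi) :=
  InjLinear (Phi_injective hPhi).

End SquareIntegrable.

Section Symbols.
Variables (R : realType) (H T : hilbertType R) (V : normedModType R[i]).
Variables (Phi : inj_linear T V) (Lam : T -> bop H).

(* Phi : H (x) conj H -> L^2 and Lam : H (x) conj H -> B_2(H);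
   symB2 = Ran Phi, symPi = Lam o Phi^-1, symB1 the trace-class symbols. *)
Definition symB2 := im_space Phi.
Definition symPi (f : symB2) : bop H := Lam (im_inv f).
Definition symPi_inv (A : bop H) : symB2 := xget 0 [set f | symPi f = A].
Definition sym_mul (f g : symB2) : symB2 := symPi_inv (bop_comp (symPi f) (symPi g)).
Definition sym_star (f : symB2) : symB2 := symPi_inv (adjoint (symPi f)).
Definition symB1 : set symB2 := [set f | trace_class (symPi f)].
(* <f, g>_(Sigma) = op_dot (Pi f) (Pi g). *)
Definition op_dot (A B : bop H) : R[i] := trace (bop_comp A (adjoint B)).

Variables (P : tvsType R[i]) (iota : {linear P -> T}) (iota_inj : injective iota).
(* The canonical map iota from the completed projective tensor product to the
   Hilbert tensor product need not be injective without the approximation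
   property; injectivity is what allows treating P as a subspace of T. *)
Definition symG_inj : inj_linear P V :=
  @InjLinear _ _ _ (Phi \o iota) (inj_comp (@inj_linearP _ _ _ Phi) iota_inj).
Definition symG := im_space symG_inj.
Definition symG_incl (f : symG) : symB2 := im_elt Phi (iota (im_inv f)).
Lemma symG_inclE f : im_val (symG_incl f) = im_val f.
Proof. by rewrite im_val_elt -[RHS]im_invE. Qed.
End Symbols.

Section Multipliers.
Variables (R : realType) (X : normedModType R[i]).
Variables (mul : X -> X -> X) (star : X -> X).

Definition normed_star_algebra :=
  [/\ star_algebra mul star, continuous (fun z : X * X => mul z.1 z.2) &
      continuous star].

(* Multipliers as double centralizers. *)
Record multiplier := Multiplier {
  mL : X -> X;
  mR : X -> X;
  mL_linear : linear mL;
  mR_linear : linear mR;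
  mL_continuous : continuous mL;
  mR_continuous : continuous mR;
  mL_mul : forall a b, mL (mul a b) = mul (mL a) b;
  mR_mul : forall a b, mR (mul a b) = mul a (mR b);
  mRL : forall a b, mul (mR a) b = mul a (mL b) }.

Hypothesis hX : normed_star_algebra.
Let mulDl y a x x' : mul (a *: x + x') y = a *: mul x y + mul x' y.
Proof. by case: hX => -[[h _] _ _ _ _] _ _; exact: h. Qed.
Let mulDr x a y y' : mul x (a *: y + y') = a *: mul x y + mul x y'.
Proof. by case: hX => -[[_ h] _ _ _ _] _ _; exact: h. Qed.
Let mulA x y z : mul x (mul y z) = mul (mul x y) z.
Proof. by case: hX => -[_ h _ _ _] _ _; exact: h. Qed.
Let starD (a : R[i]) x y : star (a *: x + y) = a^* *: star x + star y.
Proof. by case: hX => -[_ _ h _ _] _ _; exact: h. Qed.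
Let starK x : star (star x) = x.
Proof. by case: hX => -[_ _ _ h _] _ _; exact: h. Qed.
Let starM x y : star (mul x y) = mul (star y) (star x).
Proof. by case: hX => -[_ _ _ _ h] _ _; exact: h. Qed.
Let cmul : continuous (fun z : X * X => mul z.1 z.2).
Proof. by case: hX. Qed.
Let cstar : continuous star.
Proof. by case: hX. Qed.

Program Definition mult_of (x : X) : multiplier :=
  @Multiplier (mul x) (mul^~ x) _ _ _ _ _ _ _.
Next Obligation. by move=> x a y z; exact: mulDr. Qed.
Next Obligation. by move=> x a y z; exact: mulDl. Qed.
Next Obligation.
move=> x y; apply: (@continuous_comp _ _ _ (fun y => (x, y)) (fun z : X * X => mul z.1 z.2)).
  by apply: cvg_pair; [exact: cvg_cst|exact: cvg_id].
exact: cmul.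
Qed.
Next Obligation.
move=> x y; apply: (@continuous_comp _ _ _ (fun y => (y, x)) (fun z : X * X => mul z.1 z.2)).
  by apply: cvg_pair; [exact: cvg_id|exact: cvg_cst].
exact: cmul.
Qed.
Next Obligation. by move=> x a b; exact: mulA. Qed.
Next Obligation. by move=> x a b /=; rewrite mulA. Qed.
Next Obligation. by move=> x a b /=; rewrite mulA. Qed.

Let cvg_lin (a : R[i]) (f g : X -> X) : continuous f -> continuous g ->
  continuous (fun x => a *: f x + g x).
Proof. by move=> cf cg x; apply: cvgD; [apply: cvgZr; exact: cf|exact: cg]. Qed.
Let lin_lin (a : R[i]) (f g : X -> X) : linear f -> linear g ->
  linear (fun x => a *: f x + g x).
Proof.
move=> lf lg b x y; rewrite lf lg !scalerDr !scalerA [a * b]mulrC.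
by rewrite -!addrA; congr (_ + _); rewrite addrCA.
Qed.

Program Definition mult_lin (a : R[i]) (m n : multiplier) : multiplier :=
  @Multiplier (fun x => a *: mL m x + mL n x) (fun x => a *: mR m x + mR n x)
    _ _ _ _ _ _ _.
Next Obligation. by move=> a m n; apply: lin_lin; exact: mL_linear. Qed.
Next Obligation. by move=> a m n; apply: lin_lin; exact: mR_linear. Qed.
Next Obligation. by move=> a m n; apply: cvg_lin; exact: mL_continuous. Qed.
Next Obligation. by move=> a m n; apply: cvg_lin; exact: mR_continuous. Qed.
Next Obligation. by move=> a m n x y /=; rewrite !mL_mul mulDl. Qed.
Next Obligation. by move=> a m n x y /=; rewrite !mR_mul mulDr. Qed.
Next Obligation. by move=> a m n x y /=; rewrite mulDl mulDr !mRL. Qed.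

Program Definition mult_mul (m n : multiplier) : multiplier :=
  @Multiplier (mL m \o mL n) (mR n \o mR m) _ _ _ _ _ _ _.
Next Obligation. by move=> m n a x y /=; rewrite !mL_linear. Qed.
Next Obligation. by move=> m n a x y /=; rewrite !mR_linear. Qed.
Next Obligation. by move=> m n x; apply: continuous_comp; exact: mL_continuous. Qed.
Next Obligation. by move=> m n x; apply: continuous_comp; exact: mR_continuous. Qed.
Next Obligation. by move=> m n x y /=; rewrite !mL_mul. Qed.
Next Obligation. by move=> m n x y /=; rewrite !mR_mul. Qed.
Next Obligation. by move=> m n x y /=; rewrite !mRL. Qed.

Program Definition mult_star (m : multiplier) : multiplier :=
  @Multiplier (star \o mR m \o star) (star \o mL m \o star) _ _ _ _ _ _ _.
Next Obligation. by move=> m a x y /=; rewrite starD mR_linear starD conjCK. Qed.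
Next Obligation. by move=> m a x y /=; rewrite starD mL_linear starD conjCK. Qed.
Next Obligation.
move=> m x; apply: continuous_comp; first exact: cstar.
by apply: continuous_comp; [exact: mR_continuous|exact: cstar].
Qed.
Next Obligation.
move=> m x; apply: continuous_comp; first exact: cstar.
by apply: continuous_comp; [exact: mL_continuous|exact: cstar].
Qed.
Next Obligation. by move=> m x y /=; rewrite starM mR_mul starM starK. Qed.
Next Obligation. by move=> m x y /=; rewrite starM mL_mul starM starK. Qed.
Next Obligation.
by move=> m x y /=; rewrite -{1}[y]starK -starM -mRL starM starK.
Qed.
End Multipliers.

(* X is the completion of the *-algebra A for the norm nrm. *)
Definition is_star_completion (R : realType) (A : lmodType R[i])
    (mulA : A -> A -> A) (starA : A -> A) (nrm : A -> R)
    (X : completeNormedModType R[i]) (inX : {linear A -> X})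
    (mulX : X -> X -> X) (starX : X -> X) :=
  [/\ forall a, `|inX a| = ((nrm a)%:C)%C,
      closure (range inX) = setT,
      forall a b, inX (mulA a b) = mulX (inX a) (inX b) &
      forall a, inX (starA a) = starX (inX a)].

(* Pib is the *-isomorphism from the multiplier algebra onto B(H) that extends
   Pi. *)
Definition is_Pi_extension (R : realType) (H : hilbertType R) (A : lmodType R[i])
    (Pi : A -> bop H) (X : completeNormedModType R[i]) (inX : A -> X)
    (mulX : X -> X -> X) (starX : X -> X)
    (hX : normed_star_algebra mulX starX) (Pib : multiplier mulX -> bop H) :=
  [/\ bijective Pib,
      forall a m n x, Pib (mult_lin hX a m n) x = a *: Pib m x + Pib n x,
      forall m n, Pib (mult_mul m n) = bop_comp (Pib m) (Pib n),
      forall m, Pib (mult_star hX m) = adjoint (Pib m) &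
      forall f, Pib (mult_of hX (inX f)) = Pi f].

Definition topological_dual (R : realType) (E : tvsType R[i]) (l : E -> R[i]^o) :=
  linear l /\ continuous l.

(* Main.v *)
(** Every z in the completed projective tensor product P acts on H as the operator
Lam (iota z). Left multiplication by z sends u' (x) v' to (z u') (x) v', and for fixed
u', v' the map z |-> (z u') (x) v' is bounded on u (x) v by the projective seminorms; so
product and involution of P arise by two applications of the universal property of the
completed tensor product. The injectivity of z |-> Lam (iota z) and the density of
elementary tensors then give the identities of a Hilbert algebra. Since
dot (Lam z x) y = dot z (y (x) x), all estimates on Lam follow from Cauchy-Schwarz.

The trace class property: let S = |A| for A = Lam (iota z), and let W be the contraction
with W A = S from the polar decomposition. For a rank-one tensor u (x) v the partial
traces of W A are at most |u| |v| by Bessel and Cauchy-Schwarz, so on P they are bounded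
by the projective norm of z, whatever the finite part of the basis. The same bound lets
the trace of A B, for B bounded, pass to the limit from elementary tensors, where it is
<B u, v>; this is continuous in z and determines B by density of G in H. *)

From HB Require Import structures.
Require Import Defs.
From mathcomp Require Import all_boot all_order all_algebra.
From mathcomp Require Import complex.
From mathcomp Require Import all_classical all_reals all_analysis.
From mathcomp Require Import ring lra.
Set Implicit Arguments.
Unset Strict Implicit.
Unset Printing Implicit Defensive.
Import Order.TTheory GRing.Theory Num.Theory.
Import numFieldNormedType.Exports.
Local Open Scope classical_set_scope.
Local Open Scope ring_scope.

(** * Hilbert spaces *)

(** The completed tensor product is given by axioms only, so its elements come without a series
    representation. Two devices replace it. Identities are closed conditions, checked on elementary
    tensors. Estimates go through [proj_norm], the supremum of the continuous seminorms bounded by p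
    u q v on elementary tensors; for the norms of H it controls the boundedness of left
    multiplications, the trace-class property and the trace at once. A tensor z acts on H, and z u'
    is not at hand as an element of G that could be tensored with v'. Hence right multiplication by
    the rank-one operator <., v'> x comes before the product: it changes only the second factor and
    stays inside P. Since [trace] is the value common to all orthonormal bases, a candidate value is
    first produced without any basis, and convergence to it is then shown in each of them. Square
    roots come from an iteration rather than from spectral calculus, and representing vectors from
    minimization on subspaces that need not be closed, so that ranges and algebraic spans can be
    used directly. *)

Section RealNorm.
Variables (R : realType) (V : normedModType R[i]).
Implicit Types (x y : V) (a : R[i]).

(** Norms over [R[i]] are complex numbers; the real part lives in [R], where the order is total and
    suprema exist. *)
Definition rnorm x : R := complex.Re `|x|.

Lemma normE x : `|x| = ((rnorm x)%:C)%C.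
Proof. by rewrite /rnorm RRe_real// normr_real. Qed.

Lemma rnorm_ge0 x : 0 <= rnorm x.
Proof. by rewrite -ler0c -normE. Qed.

Lemma rnorm0 : rnorm 0 = 0.
Proof. by rewrite /rnorm normr0. Qed.

Lemma rnorm0_eq0 x : rnorm x = 0 -> x = 0.
Proof. by move=> x0; apply/eqP; rewrite -normr_eq0 normE x0. Qed.

Lemma rnormN x : rnorm (- x) = rnorm x.
Proof. by rewrite /rnorm normrN. Qed.

Lemma rnormB x y : rnorm (x - y) = rnorm (y - x).
Proof. by rewrite /rnorm distrC. Qed.

Lemma rnormD x y : rnorm (x + y) <= rnorm x + rnorm y.
Proof. by rewrite -lecR rmorphD/= -!normE ler_normD. Qed.

Lemma rnormZ a x : rnorm (a *: x) = complex.Re `|a| * rnorm x.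
Proof.
apply: complexI; by rewrite rmorphM/= -!normE normrZ.
Qed.

Lemma nbhs_rnormP x (U : set V) :
  nbhs x U <-> exists2 e : R, 0 < e & forall y, rnorm (y - x) < e -> U y.
Proof.
split=> [/nbhs_normP[e /= e0 eU]|[e e0 eU]].
  have /complex_realP[k ke] := gtr0_real e0; rewrite {}ke in e0 eU.
  exists k; first by rewrite -ltcR.
  by move=> y yk; apply: eU => /=; rewrite normE rnormB ltcR.
apply/nbhs_normP; exists (e%:C)%C => /=; first by rewrite ltcR.
by move=> y /=; rewrite normE ltcR rnormB => /eU.
Qed.

Lemma rnorm_continuous : continuous rnorm.
Proof.
move=> x; apply/cvgrPdist_lt => e e0; apply/nbhs_rnormP; exists e => // y ye.
apply: le_lt_trans ye; rewrite ler_norml lerBrDl lerBlDl.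
have := rnormD (x - y) y; have := rnormD (y - x) x; rewrite !subrK rnormB.
lra.
Qed.

Lemma rnorm_cvgP (T : Type) (F : set_system T) (FF : Filter F) (f : T -> V) x :
  f @ F --> x <-> forall e : R, 0 < e -> \forall t \near F, rnorm (f t - x) < e.
Proof.
split=> [fx e e0|fx U /nbhs_rnormP[e e0 eU]].
  by apply: (fx [set y | rnorm (y - x) < e]); apply/nbhs_rnormP; exists e.
by have := fx e e0; apply: filterS => t /eU.
Qed.
End RealNorm.

Section HilbertBasics.
Variables (R : realType) (H : hilbertType R).
Implicit Types (x y z : H) (a : R[i]).

Lemma dotDl x y z : dot (x + y) z = dot x z + dot y z.
Proof. by have := dot_linearl 1 x y z; rewrite scale1r mul1r. Qed.

Lemma dot0l z : dot 0 z = 0.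
Proof. by have /eqP := dotDl 0 0 z; rewrite addr0 -subr_eq subrr => /eqP. Qed.

Lemma dotZl a x z : dot (a *: x) z = a * dot x z.
Proof. by have := dot_linearl a x 0 z; rewrite addr0 dot0l addr0. Qed.

Lemma dotDr x y z : dot z (x + y) = dot z x + dot z y.
Proof. by rewrite dot_conj dotDl rmorphD/= -!dot_conj. Qed.

Lemma dotZr a x z : dot z (a *: x) = a^* * dot z x.
Proof. by rewrite dot_conj dotZl rmorphM/= -!dot_conj. Qed.

Lemma dot0r z : dot z 0 = 0.
Proof. by rewrite dot_conj dot0l rmorph0. Qed.

Lemma dotNl x z : dot (- x) z = - dot x z.
Proof. by rewrite -scaleN1r dotZl mulN1r. Qed.

Lemma dotNr x z : dot z (- x) = - dot z x.
Proof. by rewrite dot_conj dotNl rmorphN/= -dot_conj. Qed.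

Lemma dotBl x y z : dot (x - y) z = dot x z - dot y z.
Proof. by rewrite dotDl dotNl. Qed.

Lemma dotBr x y z : dot z (x - y) = dot z x - dot z y.
Proof. by rewrite dotDr dotNr. Qed.

Lemma dot_suml (I : Type) (s : seq I) (f : I -> H) z :
  dot (\sum_(i <- s) f i) z = \sum_(i <- s) dot (f i) z.
Proof. by elim/big_ind2 : _ => [|x a y b <- <-|//]; rewrite ?dot0l ?dotDl. Qed.

Lemma dot_sumr (I : Type) (s : seq I) (f : I -> H) z :
  dot z (\sum_(i <- s) f i) = \sum_(i <- s) dot z (f i).
Proof. by elim/big_ind2 : _ => [|x a y b <- <-|//]; rewrite ?dot0r ?dotDr. Qed.

Lemma dotxx x : dot x x = ((rnorm x ^+ 2)%:C)%C.
Proof. by rewrite dot_norm normE rmorphXn. Qed.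

Lemma rnorm_sqr x : rnorm x ^+ 2 = complex.Re (dot x x).
Proof. by rewrite dotxx. Qed.

Lemma Re_conj a : complex.Re a^* = complex.Re a.
Proof. by case: a. Qed.

Lemma rnormD_sqr x y :
  rnorm (x + y) ^+ 2 = rnorm x ^+ 2 + rnorm y ^+ 2 + 2 * complex.Re (dot x y).
Proof.
rewrite !rnorm_sqr dotDl !dotDr [dot y x]dot_conj !ReD Re_conj; lra.
Qed.

Lemma rnormB_sqr x y :
  rnorm (x - y) ^+ 2 = rnorm x ^+ 2 + rnorm y ^+ 2 - 2 * complex.Re (dot x y).
Proof.
rewrite rnormD_sqr rnormN dotNr.
by case: (dot x y) => u v /=; rewrite mulrN.
Qed.

Lemma normc_sqr a : complex.Re `|a| ^+ 2 = complex.Re a ^+ 2 + complex.Im a ^+ 2.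
Proof. by rewrite normc_def/= sqr_sqrtr// addr_ge0// sqr_ge0. Qed.

Lemma dot_CS x y : complex.Re `|dot x y| <= rnorm x * rnorm y.
Proof.
have [y0|y0] := eqVneq (rnorm y) 0.
  by rewrite (rnorm0_eq0 y0) dot0r normr0 rnorm0 mulr0.
have yp : 0 < rnorm y ^+ 2 by rewrite exprn_even_gt0.
(* The subtracted vector is the orthogonal projection of x onto the line of y. *)
have := sqr_ge0 (rnorm (x - (dot x y * ((rnorm y ^- 2)%:C)%C) *: y)).
rewrite rnormB_sqr rnormZ exprMn normc_sqr dotZr => h.
rewrite -(@ler_pXn2r _ 2)// ?nnegrE ?mulr_ge0 ?rnorm_ge0 ?(rnorm_ge0 (_ : R[i]^o))//.
rewrite exprMn normc_sqr -ler_pdivrMr//.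
case: (dot x y) h => u v /= h; rewrite -subr_ge0; apply: le_trans h _.
by rewrite le_eqVlt; apply/orP; left; apply/eqP; field; rewrite ?expf_neq0.
Qed.

Lemma abs_Re_le a : `|complex.Re a| <= complex.Re `|a|.
Proof. by rewrite normc_def/= -sqrtr_sqr ler_wsqrtr// lerDl sqr_ge0. Qed.

Lemma Re_dot_CS x y : complex.Re (dot x y) <= rnorm x * rnorm y.
Proof. by apply: le_trans (dot_CS x y); apply: le_trans (ler_norm _) (abs_Re_le _). Qed.

Lemma dotl_continuous y : continuous (dot^~ y : H -> R[i]^o).
Proof.
move=> x; apply/rnorm_cvgP => e e0.
have y0 : 0 < rnorm y + 1 by rewrite ltr_wpDl// rnorm_ge0.
apply/nbhs_rnormP; exists (e / (rnorm y + 1)); first by rewrite divr_gt0.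
move=> z; rewrite ltr_pdivlMr// => ze; rewrite -dotBl; apply: le_lt_trans (dot_CS _ _) _.
by apply: le_lt_trans ze; rewrite ler_wpM2l ?rnorm_ge0// lerDl.
Qed.

Lemma dotr_continuous y : continuous (dot y : H -> R[i]^o).
Proof.
move=> x; apply: (@cvg_trans _ ((fun z => (dot z y)^* : R[i]^o) @ nbhs x)).
  by apply: near_eq_cvg; near=> z; rewrite -dot_conj.
rewrite dot_conj; apply: (@continuous_comp _ _ _ (dot^~ y : H -> R[i]^o)).
  exact: dotl_continuous.
exact: conjC_continuous.
Unshelve. all: by end_near. Qed.

Lemma dotI x y : (forall z, dot z x = dot z y) -> x = y.
Proof.
move=> xy; apply/eqP; rewrite -subr_eq0 -normr_eq0 -sqrf_eq0 -dot_norm.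
by rewrite dotBr xy subrr.
Qed.

Lemma dotIl x y : (forall z, dot x z = dot y z) -> x = y.
Proof. by move=> xy; apply: dotI => z; rewrite dot_conj xy -dot_conj. Qed.
End HilbertBasics.

Lemma continuous_eq_closed (T V : topologicalType) (f g : T -> V) :
  hausdorff_space V -> continuous f -> continuous g -> closed [set x | f x = g x].
Proof.
move=> hV cf cg x clx; apply: hV => A B nA nB.
have nfA : nbhs x (f @^-1` A) by exact: cf.
have ngB : nbhs x (g @^-1` B) by exact: cg.
have [y [/= fg [Ay By]]] := clx _ (filterI nfA ngB).
by exists (f y); split => //; rewrite fg.
Qed.

Lemma continuous_fun_comp (T U V : topologicalType) (f : T -> U) (g : U -> V) :
  continuous f -> continuous g -> continuous (fun x => g (f x)).
Proof. by move=> cf cg x; apply: continuous_comp; [exact: cf|exact: cg]. Qed.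

Lemma scale_continuous_fun (R : realType) (V : normedModType R[i]) (a : R[i]) :
  continuous (fun x : V => a *: x).
Proof. by move=> x; apply: cvgZr; exact: cvg_id. Qed.

Lemma closed_dense (T : topologicalType) (A B : set T) :
  closure A = setT -> closed B -> A `<=` B -> forall x, B x.
Proof.
by move=> dA cB AB x; apply: cB; apply: (closure_subset AB); rewrite dA.
Qed.

Definition positively_homogeneous (R : realType) (E : lmodType R[i]) (p : E -> R) :=
  forall (t : R) x, 0 < t -> p ((t%:C)%C *: x) = t * p x.

(** Rescale x by p x + e and let e tend to 0; the slack e covers the case p x = 0. This turns
    inclusions of neighbourhoods into inequalities, and only positive scalars are involved, so q may
    be a seminorm composed with a linear map. *)
Lemma homogeneous_le (R : realType) (E : lmodType R[i]) (p q : E -> R) :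
  positively_homogeneous p -> positively_homogeneous q -> (forall x, 0 <= p x) ->
  (forall x, p x < 1 -> q x <= 1) -> forall x, q x <= p x.
Proof.
move=> hp hq p0 pq x; apply/ler_addgt0Pr => e e0.
have t0 : 0 < p x + e by rewrite ltr_wpDl.
have ti0 : 0 < (p x + e)^-1 by rewrite invr_gt0.
have /pq : p (((p x + e)^-1%:C)%C *: x) < 1.
  by rewrite hp// mulrC ltr_pdivrMr// mul1r ltrDl.
by rewrite hq// mulrC ler_pdivrMr// mul1r.
Qed.

Lemma rnorm_homogeneous (R : realType) (V : normedModType R[i]) :
  positively_homogeneous (@rnorm R V).
Proof. by move=> t x t0; rewrite rnormZ normc_def/= expr0n/= addr0 sqrtr_sqr gtr0_norm. Qed.

Lemma continuous_linear_rnorm (R : realType) (V W : normedModType R[i])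
    (f : {linear V -> W}) : continuous f ->
  exists2 c : R, 0 <= c & forall x, rnorm (f x) <= c * rnorm x.
Proof.
move=> /(_ 0) cf; have n1 : nbhs (f 0) [set y | rnorm y < 1].
  by apply/nbhs_rnormP; exists 1 => // y; rewrite linear0 subr0.
have /nbhs_rnormP[e e0 he] : nbhs (0 : V) (f @^-1` [set y | rnorm y < 1]) by exact: cf.
exists e^-1; first by rewrite invr_ge0 ltW.
apply: homogeneous_le.
- by move=> t x t0; rewrite rnorm_homogeneous// mulrCA.
- by move=> t x t0; rewrite linearZ/= rnorm_homogeneous.
- by move=> x; rewrite mulr_ge0 ?rnorm_ge0// invr_ge0 ltW.
- by move=> x; rewrite mulrC ltr_pdivrMr// mul1r => xe; apply/ltW/he; rewrite subr0.
Qed.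

Lemma rnorm_linear_continuous (R : realType) (V W : normedModType R[i])
    (f : {linear V -> W}) (c : R) : (forall x, rnorm (f x) <= c * rnorm x) -> continuous f.
Proof.
move=> fc x; apply/rnorm_cvgP => e e0; apply/nbhs_rnormP.
have c0 : 0 < `|c| + 1 by rewrite ltr_wpDl.
exists (e / (`|c| + 1)); first by rewrite divr_gt0.
move=> y; rewrite ltr_pdivlMr// => ye; rewrite -linearB; apply: le_lt_trans (fc _) _.
apply: le_lt_trans ye; rewrite mulrC ler_wpM2l ?rnorm_ge0//.
by apply: le_trans (ler_norm _) _; rewrite lerDl.
Qed.

Lemma rnorm_complete (R : realType) (V : completeNormedModType R[i])
    (F : set_system V) (FF : ProperFilter F) :
  (forall e : R, 0 < e -> exists x, F [set y | rnorm (y - x) < e]) -> cvg F.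
Proof.
move=> hF; apply: cauchy_cvg; apply: cauchy_exP => e e0.
have /complex_realP[k ke] := gtr0_real e0; rewrite {}ke in e0 *.
have [|x Fx] := hF k; first by rewrite -ltcR.
by exists x; apply: filterS Fx => y /=; rewrite -ball_normE/= normE ltcR rnormB.
Qed.

Lemma natSinv_lt (R : realType) (e : R) : 0 < e ->
  exists N, forall n, (N <= n)%N -> n.+1%:R^-1 < e.
Proof.
by move=> e0; have [N _ hN] := near_infty_natSinv_lt (PosNum e0); exists N => n /hN.
Qed.

(** * Riesz representation by minimization *)

Section Riesz.
Variables (R : realType) (H : hilbertType R).
Variables (M : set H) (phi : H -> R[i]) (c : R).
Hypothesis M0 : M 0.
Hypothesis ML : forall a x y, M x -> M y -> M (a *: x + y).
Hypothesis phiL : forall a x y, M x -> M y -> phi (a *: x + y) = a * phi x + phi y.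
Hypothesis c0 : 0 <= c.
Hypothesis phic : forall x, M x -> complex.Re `|phi x| <= c * rnorm x.

(** If w represents [phi], then J x = |x - w|^2 - |w|^2, so a minimizer of [J] is the vector
    sought. *)
Let J (x : H) : R := rnorm x ^+ 2 - 2 * complex.Re (phi x).

Let J_lb x : M x -> - c ^+ 2 <= J x.
Proof.
move=> Mx; have : complex.Re (phi x) <= c * rnorm x.
  by apply: le_trans (phic Mx); apply: le_trans (ler_norm _) (abs_Re_le _).
rewrite /J => h; have := sqr_ge0 (rnorm x - c); rewrite sqrrB; nra.
Qed.

Let MZ a x : M x -> M (a *: x).
Proof. by move=> Mx; rewrite -[_ *: _]addr0; exact: ML. Qed.

Let phiZ a x : M x -> phi (a *: x) = a * phi x.
Proof.
move=> Mx; have p0 : phi 0 = 0.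
  by have := phiL (-1) M0 M0; rewrite scaler0 addr0 mulN1r addNr.
by rewrite -[_ *: _]addr0 phiL// p0 addr0.
Qed.

Let ReM (s : R) (a : R[i]) : complex.Re ((s%:C)%C * a) = s * complex.Re a.
Proof. by case: a => u v /=; rewrite mul0r subr0. Qed.

Let J_shift s x y : M x -> M y -> J (x + ((s%:C)%C *: y)) =
  J x + s ^+ 2 * rnorm y ^+ 2 + 2 * s * complex.Re (dot x y - phi y).
Proof.
move=> Mx My; rewrite /J rnormD_sqr rnormZ exprMn normc_sqr/= dotZr.
have -> : phi (x + (s%:C)%C *: y) = (s%:C)%C * phi y + phi x by rewrite addrC phiL.
rewrite !ReD ReM.
case: (dot x y) (phi y) (phi x) => [u v] [u' v'] [u'' v''] /=; ring.
Qed.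

(** The parallelogram law, in which the linear terms of [J] cancel. As [J] is at least its infimum
    at the midpoint, near minimizers are close to each other. *)
Let midpoint x y : M x -> M y ->
  rnorm (x - y) ^+ 2 = 2 * J x + 2 * J y - 4 * J ((2^-1)%:C%C *: (x + y)).
Proof.
move=> Mx My; rewrite /J phiZ; last by rewrite -[x]scale1r; exact: ML.
have -> : phi (x + y) = phi x + phi y by rewrite -{1}[x]scale1r phiL// mul1r.
rewrite rnormB_sqr rnormZ exprMn normc_sqr rnormD_sqr ReM ReD/= expr0n/=.
by field.
Qed.

Let d := inf (J @` M).

Let J_has_inf : has_inf (J @` M).
Proof.
split; first by exists (J 0), 0.
by exists (- c ^+ 2) => _ [x Mx <-]; exact: J_lb.
Qed.

Let J_ge x : M x -> d <= J x.
Proof. by move=> Mx; apply: ge_inf; [case: J_has_inf|exists x]. Qed.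

(* w is the limit of a minimizing sequence of |x|^2 - 2 Re (phi x) on M, so M need
   not be closed. *)
Lemma riesz_submodule : exists w, [/\ closure M w,
  forall x, M x -> phi x = dot x w & rnorm w <= c].
Proof.
have /choice[m hm] : forall n : nat, exists x, M x /\ J x < d + n.+1%:R^-1.
  move=> n; have invn_gt0 : 0 < n.+1%:R^-1 :> R by rewrite invr_gt0.
  have [_ [x Mx <-] xd] := @inf_adherent _ _ n.+1%:R^-1 invn_gt0 J_has_inf.
  by exists x.
have mM n : M (m n) by case: (hm n).
have mJ n : J (m n) < d + n.+1%:R^-1 by case: (hm n).
have /cvg_ex[w mw] : cvg (m @ \oo).
  apply: rnorm_complete => e e0.
  (* Both values of [J] exceed d by less than 1/(N+1), so [midpoint] bounds the squared distance by
     4/(N+1). *)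
  have [N /= hN] : exists N, 4 / N.+1%:R < e ^+ 2.
    have [|N /(_ N (leqnn _)) hN] := @natSinv_lt R (e ^+ 2 / 4); first by rewrite divr_gt0// exprn_gt0.
    by exists N; move: hN; rewrite ltr_pdivlMr// mulrC.
  exists (m N); exists N => // n /= Nn.
  rewrite -(@ltr_pXn2r _ 2)// ?nnegrE ?rnorm_ge0 ?(ltW e0)//.
  apply: le_lt_trans hN; rewrite midpoint//.
  have := J_ge (MZ (2^-1)%:C%C (ML 1 (mM n) (mM N))); rewrite scale1r.
  have := mJ n; have := mJ N.
  have : (n.+1%:R^-1 : R) <= N.+1%:R^-1 by rewrite lef_pV2 ?posrE// ler_nat.
  set a := n.+1%:R^-1; set b := N.+1%:R^-1.
  lra.
have clw : closure M w.
  move=> B nB; have [N _ hN] := mw _ nB.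
  by exists (m N); split => //; exact: (hN N (leqnn _)).
(* The first-order condition. As w may lie outside [M], minimality is used at m n + s x and passed
   to the limit: s^2 A + 2 s B is nonnegative for every real s, which forces B = 0. *)
have Re_eq x : M x -> complex.Re (dot w x - phi x) = 0.
  move=> Mx; set B := complex.Re _; set A := rnorm x ^+ 2.
  have A0 : 0 <= A by rewrite sqr_ge0.
  have g s : 0 <= s ^+ 2 * A + 2 * s * B.
    apply/ler_addgt0Pl => e e0.
    pose K := 2 * `|s| * rnorm x + 1.
    have K0 : 0 < K by rewrite ltr_wpDl// !mulr_ge0 ?rnorm_ge0.
    have [|N _ hN] := (rnorm_cvgP _ _ _).1 mw (e / 2 / K) _; first by rewrite !divr_gt0.
    have [|N' hN'] := @natSinv_lt R (e / 2); first by rewrite divr_gt0.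
    pose n := maxn N N'; have := hN n (leq_maxl _ _); have /= := hN' n (leq_maxr _ _).
    move=> h1; rewrite ltr_pdivlMr// => h2.
    have := J_ge (ML (s%:C)%C Mx (mM n)); rewrite addrC J_shift// -/A.
    have := mJ n.
    have : `|complex.Re (dot (m n) x - phi x) - B| <= rnorm (m n - w) * rnorm x.
      have -> : complex.Re (dot (m n) x - phi x) - B = complex.Re (dot (m n - w) x).
        by rewrite /B dotBl; case: (dot w x) (phi x) (dot (m n) x) => [a b] [a' b'] [a'' b''] /=; ring.
      by apply: le_trans (abs_Re_le _) (dot_CS _ _).
    set B' := complex.Re (dot (m n) x - phi x) => h3 h4 h5.
    have h6 : `|2 * s * (B' - B)| <= e / 2.
      rewrite !normrM ger0_norm//; apply: le_trans (_ : 2 * `|s| * (rnorm (m n - w) * rnorm x) <= _).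
        by rewrite ler_wpM2l// mulr_ge0.
      apply/ltW; apply: le_lt_trans h2; rewrite /K mulrDr mulr1.
      by apply: le_trans (_ : rnorm (m n - w) * (2 * `|s| * rnorm x) <= _); [rewrite le_eqVlt; apply/orP; left; apply/eqP; ring|rewrite lerDl rnorm_ge0].
    have h7 : J (m n) < d + e / 2 by apply: lt_trans h4 _; rewrite ltrD2l.
    have h8 := le_trans (ler_norm _) h6; move: h5 h7 h8; set t := s ^+ 2 * A; lra.
  (* The minimizing s would be -B / A; A + 1 avoids the case A = 0 and still gives a negative value
     unless B = 0. *)
  have := g (- B / (A + 1)).
  have A1 : A + 1 != 0 by rewrite gt_eqF// ltr_wpDl.
  have -> : (- B / (A + 1)) ^+ 2 * A + 2 * (- B / (A + 1)) * B = - (B ^+ 2 * ((A + 2) / (A + 1) ^+ 2)) by field.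
  rewrite oppr_ge0 pmulr_lle0; last by rewrite divr_gt0 ?exprn_gt0 ?ltr_wpDl.
  by move=> B2; apply/eqP; rewrite -sqrf_eq0 eq_le B2 sqr_ge0.
have phiw x : M x -> phi x = dot x w.
  move=> Mx; have h1 := Re_eq _ Mx; have h2 := Re_eq _ (MZ 'i%C Mx).
  move: h1 h2; rewrite dotZr phiZ// [dot x w]dot_conj.
  by case: (dot w x) (phi x) => [a b] [a' b'] /= h1 h2; congr Complex; lra.
exists w; split => //.
(* For x in [M] near w, |x - w|^2 - |w|^2 = J x is at least -c^2. *)
rewrite -(@ler_pXn2r _ 2)// ?nnegrE ?rnorm_ge0//; apply/ler_addgt0Pl => e e0.
have [|x [Mx xw]] := clw [set x | rnorm (x - w) < Num.min e 1].
  by apply/nbhs_rnormP; exists (Num.min e 1) => //; rewrite lt_min e0 /=.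
have := J_lb Mx; rewrite /J phiw//; have := rnormB_sqr x w; move: xw.
rewrite /= lt_min => /andP[xe x1].
have : rnorm (x - w) ^+ 2 <= rnorm (x - w) by have := rnorm_ge0 (x - w); nra.
lra.
Qed.
End Riesz.

(** * Adjoints, orthonormal bases and traces *)

Section Operators.
Variables (R : realType) (H : hilbertType R).
Implicit Types (A B : bop H).

Lemma bop_ext A B : (forall x, A x = B x) -> A = B.
Proof.
case: A B => [f cf] [g cg] /= fg.
have {}fg : f = g.
  move/funext: fg => {cf cg}; case: f => f [[a] [b]]; case: g => g [[c] [e]] /= fg.
  by case: _ / fg in c e *; rewrite (Prop_irrelevance a c) (Prop_irrelevance b e).
by case: _ / fg in cg *; congr Bop; exact: Prop_irrelevance.
Qed.

Lemma bop_of_bounded (f : H -> H) (c : R) : linear f ->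
  (forall x, rnorm (f x) <= c * rnorm x) -> exists A, forall x, A x = f x.
Proof.
move=> lf fc; pose L : {linear H -> H} := HB.pack f (GRing.isLinear.Build R[i] H H *:%R f lf).
by exists (Bop (@rnorm_linear_continuous _ _ _ L c fc)).
Qed.

Lemma bop_bounded A : exists2 c : R, 0 <= c & forall x, rnorm (A x) <= c * rnorm x.
Proof. exact/continuous_linear_rnorm/bop_continuous. Qed.

Lemma adjoint_exists A : exists B, is_adjoint A B.
Proof.
have [c c0 Ac] := bop_bounded A.
have /choice[f hf] : forall y, exists w, forall x, dot (A x) y = dot x w.
  move=> y; have [|||||w [_ hw _]] := @riesz_submodule _ _ setT (fun x => dot (A x) y) (c * rnorm y) _ _ _ _ _.
  - by [].
  - by [].
  - by move=> a u v _ _; rewrite linearP/= dot_linearl.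
  - by rewrite mulr_ge0 ?rnorm_ge0.
  - by move=> x _; rewrite mulrAC; apply: le_trans (dot_CS _ _) _; rewrite ler_wpM2r ?rnorm_ge0.
  - by exists w => x; exact: hw.
have lf : linear f.
  by move=> a u v; apply: dotI => z; rewrite -hf !dotDr !dotZr -!hf.
have [x|B hB] := @bop_of_bounded f c lf; last by exists B => x y; rewrite hB hf.
(* |f x|^2 = <A (f x), x> is at most c |f x| |x|; then divide by |f x|. *)
have [f0|f0] := eqVneq (rnorm (f x)) 0; first by rewrite f0 mulr_ge0 ?rnorm_ge0.
have fp : 0 < rnorm (f x) by rewrite lt_neqAle eq_sym f0 rnorm_ge0.
rewrite -(ler_pM2r fp) -expr2 rnorm_sqr -hf; apply: le_trans (Re_dot_CS _ _) _.
by rewrite mulrAC ler_wpM2r ?rnorm_ge0.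
Qed.

Lemma adjointP A : is_adjoint A (adjoint A).
Proof. by have := @xgetPex _ (bop0 H) _ (adjoint_exists A); apply. Qed.

Lemma adjointE A (f : H -> H) : (forall x y, dot (A x) y = dot x (f y)) ->
  forall y, adjoint A y = f y.
Proof. by move=> hf y; apply: dotI => z; rewrite -hf adjointP. Qed.

Lemma adjointPr A x y : dot x (A y) = dot (adjoint A x) y.
Proof. by rewrite dot_conj adjointP -dot_conj. Qed.

End Operators.

Lemma fsets_seq (I : choiceType) (B : set I) : finite_set B ->
  exists s : seq I, [/\ uniq s, forall x, B x <-> x \in s &
    forall (V : nmodType) (a : I -> V), \sum_(i \in B) a i = \sum_(i <- s) a i].
Proof.
move=> fB; exists (finmap.enum_fset (fset_set B)); split; first exact: finmap.fset_uniq.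
  by move=> x; rewrite in_fset_set// in_setE.
by move=> V a; rewrite fsbig_finite.
Qed.

(** * Finite orthogonal projections, Parseval's identity and the value of a trace *)

Section OrthonormalFamilies.
Variables (R : realType) (H : hilbertType R).
Implicit Types (s t : seq H) (x y w : H).

Definition orthonormal_seq s :=
  uniq s /\ forall e f, e \in s -> f \in s -> dot e f = (e == f)%:R.

Definition oproj s x : H := \sum_(e <- s) dot x e *: e.

Lemma oproj_linear s : linear (oproj s).
Proof.
move=> a x y; rewrite /oproj scaler_sumr -big_split/=; apply: eq_bigr => e _.
by rewrite dot_linearl scalerDl scalerA.
Qed.

HB.instance Definition _ s := GRing.isLinear.Build R[i] H H *:%R (oproj s) (oproj_linear s).

Lemma dot_oproj s x y : dot (oproj s x) y = \sum_(e <- s) dot x e * dot e y.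
Proof. by rewrite dot_suml; apply: eq_bigr => e _; rewrite dotZl. Qed.

Lemma oproj_id s e : orthonormal_seq s -> e \in s -> oproj s e = e.
Proof.
move=> [us os] es; rewrite /oproj (bigD1_seq e)//= os// eqxx scale1r.
rewrite big_seq_cond big1 ?addr0// => f /andP[fs fe].
by rewrite os// eq_sym (negbTE fe) scale0r.
Qed.

Lemma oproj_sub s t x : orthonormal_seq t -> {subset s <= t} ->
  oproj t (oproj s x) = oproj s x.
Proof.
move=> ot st; rewrite {2 3}/oproj linear_sum; apply: eq_big_seq => e es.
by rewrite linearZ/= oproj_id// st.
Qed.

Lemma oproj_norm_sqr s x : orthonormal_seq s ->
  rnorm (x - oproj s x) ^+ 2 + rnorm (oproj s x) ^+ 2 = rnorm x ^+ 2.
Proof.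
move=> os; rewrite -[in RHS](subrK (oproj s x) x) [RHS]rnormD_sqr.
suff -> : dot (x - oproj s x) (oproj s x) = 0 by rewrite mulr0 addr0.
rewrite dot_sumr big_seq big1// => e es; rewrite dotZr dotBl.
rewrite [dot (oproj s x) e](_ : _ = dot x e) ?subrr ?mulr0//.
rewrite dot_oproj (bigD1_seq e)//= ?(proj1 os)// (proj2 os e e es es) eqxx mulr1.
rewrite big_seq_cond big1 ?addr0// => f /andP[fs fe].
by rewrite (proj2 os f e fs es) (negbTE fe) mulr0.
Qed.

Lemma oproj_le s x : orthonormal_seq s -> rnorm (oproj s x) <= rnorm x.
Proof.
move=> os; rewrite -(@ler_pXn2r _ 2)// ?nnegrE ?rnorm_ge0//.
by rewrite -(oproj_norm_sqr x os) lerDr sqr_ge0.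
Qed.

Lemma oprojC_le s x : orthonormal_seq s -> rnorm (x - oproj s x) <= rnorm x.
Proof.
move=> os; rewrite -(@ler_pXn2r _ 2)// ?nnegrE ?rnorm_ge0//.
by rewrite -(oproj_norm_sqr x os) lerDl sqr_ge0.
Qed.

Lemma onb_orthonormal_seq (E : set H) s : onb E -> uniq s ->
  (forall e, e \in s -> E e) -> orthonormal_seq s.
Proof.
move=> [E1 E2 _] us sE; split => // e f /sE Ee /sE Ef.
by case: eqVneq => [<-|/eqP ef]; [exact: E1|exact: E2].
Qed.

(** The algebraic span [M] of [E] is dense: the Riesz vector w of <., x> on [M] lies in its closure,
    and x - w is orthogonal to [E], hence 0. If y in [M] is close to x and fixed by the projection
    on t, the error for x is the complementary projection of x - y, which is no longer than x -
    y. *)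
Lemma onb_approx (E : set H) x (e : R) : onb E -> 0 < e ->
  exists s, [/\ uniq s, forall e, e \in s -> E e &
    forall t, uniq t -> (forall e, e \in t -> E e) -> {subset s <= t} ->
      rnorm (x - oproj t x) < e].
Proof.
move=> onbE e0; have oE := onb_orthonormal_seq onbE.
(* Membership in the span is expressed as being fixed by a finite projection, which persists when
   the list grows. *)
pose M : set H := [set y | exists s, [/\ uniq s, forall e, e \in s -> E e & oproj s y = y]].
have Msub s t y : {subset s <= t} -> uniq t -> (forall e, e \in t -> E e) ->
    oproj s y = y -> oproj t y = y.
  by move=> st ut tE sy; rewrite -sy oproj_sub//; exact: oE.
have [|||||w [clw hw _]] := @riesz_submodule _ _ M (dot^~ x) (rnorm x) _ _ _ _ _.
- by exists [::]; split => //; rewrite linear0.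
- move=> a y z [s [us sE sy]] [t [ut tE tz]].
  have uE f : f \in undup (s ++ t) -> E f.
    by rewrite mem_undup mem_cat => /orP[/sE|/tE].
  have us' : uniq (undup (s ++ t)) by exact: undup_uniq.
  exists (undup (s ++ t)); split; [exact: us'|exact: uE|].
  rewrite oproj_linear; congr (_ *: _ + _).
    by apply: Msub us' uE sy => f fs; rewrite mem_undup mem_cat fs.
  by apply: Msub us' uE tz => f ft; rewrite mem_undup mem_cat ft orbT.
- by move=> a y z _ _; rewrite dot_linearl.
- exact: rnorm_ge0.
- by move=> y _; rewrite mulrC; exact: dot_CS.
have xw : x = w.
  apply/eqP; rewrite -subr_eq0; apply/eqP; case: onbE => E1 E2; apply => f Ef.
  rewrite dot_conj dotBr -hw ?subrr ?rmorph0//.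
  exists [:: f]; split => //; first by move=> g; rewrite inE => /eqP->.
  by rewrite /oproj big_seq1 E1// scale1r.
rewrite -{}xw {hw} in clw.
have [|y [[s [us sE sy]] /= yx]] := clw [set y | rnorm (y - x) < e].
  by apply/nbhs_rnormP; exists e.
exists s; split => // t ut tE st.
have ty := @Msub s t y st ut tE sy.
apply: le_lt_trans yx; rewrite [leRHS]rnormB.
have -> : x - oproj t x = (x - y) - oproj t (x - y).
  by rewrite linearB/= ty opprB addrA subrK.
exact/oprojC_le/oE.
Qed.

(** Parseval's identity: a partial sum over t is [dot (oproj t x) y], so Cauchy-Schwarz and
    [onb_approx] bound the error. *)
Lemma has_sum_onb (E : set H) x y : onb E ->
  has_sum E (fun e => dot e y * dot x e) (dot x y).
Proof.
move=> onbE e e0; have /complex_realP[k ke] := gtr0_real e0; rewrite {}ke ltcR in e0 *.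
have y0 : 0 < rnorm y + 1 by rewrite ltr_wpDl ?rnorm_ge0.
have [|s [us sE hs]] := @onb_approx E x (k / (rnorm y + 1)) onbE; first by rewrite divr_gt0.
exists [set` s]; first by split; [exact: finite_seq|move=> f /=; exact: sE].
move=> B [finB BE] sB; have [t [ut tB ->]] := fsets_seq finB.
under eq_bigr => f _ do rewrite mulrC.
rewrite -dot_oproj -dotBl -[`|_|]RRe_real ?normr_real// ltcR.
apply: le_lt_trans (dot_CS _ _) _; rewrite rnormB.
have := hs t ut (fun f ft => BE f ((tB f).2 ft)) (fun f fs => (tB f).1 (sB f fs)).
rewrite ltr_pdivlMr//; apply: le_lt_trans.
by rewrite ler_wpM2l ?rnorm_ge0// lerDl.
Qed.

Lemma has_sum_unique (I : choiceType) (D : set I) (a : I -> R[i]) (u v : R[i]) :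
  has_sum D a u -> has_sum D a v -> u = v.
Proof.
move=> hu hv; apply/eqP; rewrite -subr_eq0; apply/eqP/normr0_eq0/le_anti.
rewrite normr_ge0 andbT; apply/ler_addgt0Pl => e e0; rewrite addr0.
have e2 : 0 < e / 2 by rewrite divr_gt0.
have [A [fA AD] hA] := hu _ e2; have [B [fB BD] hB] := hv _ e2.
have fAB : fsets D (A `|` B) by split; [rewrite finite_setU|rewrite subUset].
have h1 := hA _ fAB (@subsetUl _ A B); have h2 := hB _ fAB (@subsetUr _ A B).
rewrite distrC in h1; rewrite [e]splitr.
rewrite -(subrKA (\sum_(i \in A `|` B) a i)).
by apply: le_trans (ler_normD _ _) _; rewrite lerD// ltW.
Qed.

(** The given basis makes the value unique: with no basis at all, every number would satisfy the
    condition defining [trace]. *)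
Lemma trace_unique (A : bop H) (E : set H) (u : R[i]) : onb E ->
  (forall E, onb E -> has_sum E (fun e => dot (A e) e) u) -> trace A = u.
Proof.
move=> onbE hu; rewrite /trace.
have := @xgetPex _ 0 [set t | forall E, onb E -> has_sum E (fun e => dot (A e) e) t] (ex_intro _ u hu).
by move=> /(_ E onbE) /has_sum_unique; apply; exact: hu.
Qed.
End OrthonormalFamilies.

(** * Absolute values and trace-class operators *)

Lemma conjC_real (R : realType) (k : R) : ((k%:C)%C)^* = (k%:C)%C :> R[i].
Proof. by apply: conj_Creal; rewrite complex_real. Qed.

Section SquareRoot.
Variables (R : realType) (H : hilbertType R) (A : bop H).
Hypothesis A1 : forall x, rnorm (A x) <= rnorm x.

(** The self-adjoint contraction 1 - A* A, so that the root wanted is sqrt (1 - X). *)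
Let X (x : H) : H := x - adjoint A (A x).

Let adjA1 x : rnorm (adjoint A x) <= rnorm x.
Proof.
have [f0|f0] := eqVneq (rnorm (adjoint A x)) 0; first by rewrite f0 rnorm_ge0.
have fp : 0 < rnorm (adjoint A x) by rewrite lt_neqAle eq_sym f0 rnorm_ge0.
rewrite -(ler_pM2r fp) -expr2 rnorm_sqr -adjointP; apply: le_trans (Re_dot_CS _ _) _.
by rewrite mulrC ler_wpM2l ?rnorm_ge0.
Qed.

Let X1 x : rnorm (X x) <= rnorm x.
Proof.
rewrite -(@ler_pXn2r _ 2)// ?nnegrE ?rnorm_ge0// /X rnormB_sqr -adjointP -rnorm_sqr.
have : rnorm (adjoint A (A x)) ^+ 2 <= rnorm (A x) ^+ 2 by rewrite ler_pXn2r// nnegrE rnorm_ge0.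
have := sqr_ge0 (rnorm (A x)); lra.
Qed.

Let XL : linear X.
Proof. by move=> a x y; rewrite /X (linearP A) (linearP (adjoint A)) scalerBr opprD addrACA. Qed.

Let Xself x y : dot (X x) y = dot x (X y).
Proof. by rewrite /X dotBl dotBr -adjointP adjointPr. Qed.

(* The iteration Y := (X + Y^2) / 2 converges to 1 - sqrt (1 - X); it is dominated
   in norm by the scalar iteration for X = 1. *)
Let Y (n : nat) : H -> H := iter n (fun Z x => (2^-1 : R[i]) *: (X x + Z (Z x))) (fun=> 0).
Let y (n : nat) : R := iter n (fun z => 2^-1 * (1 + z ^+ 2)) 0.

Let YS n x : Y n.+1 x = (2^-1 : R[i]) *: (X x + Y n (Y n x)).
Proof. by []. Qed.

Let yS n : y n.+1 = 2^-1 * (1 + y n ^+ 2).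
Proof. by []. Qed.

Let YL n : linear (Y n).
Proof.
elim: n => [|n IH] a u v; first by rewrite /Y/= scaler0 addr0.
rewrite !YS XL !IH scalerA mulrC -scalerA -scalerDr; congr (_ *: _).
by rewrite [in RHS]scalerDr [LHS]addrACA.
Qed.

Let YB n u v : Y n (u - v) = Y n u - Y n v.
Proof. by rewrite addrC -scaleN1r YL scaleN1r addrC. Qed.

(** [Y n] is a polynomial in [X], so it commutes with whatever linear map commutes with [X]; in
    particular the iterates commute among themselves. *)
Let Ycomm (Z : H -> H) : linear Z -> (forall x, Z (X x) = X (Z x)) ->
  forall n x, Z (Y n x) = Y n (Z x).
Proof.
move=> ZL ZX; have Z0 : Z 0 = 0.
  by have := ZL (-1) 0 0; rewrite scaler0 addr0 scaleN1r addNr.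
have ZS a u : Z (a *: u) = a *: Z u by rewrite -[a *: u]addr0 ZL Z0 addr0.
have ZD u v : Z (u + v) = Z u + Z v by rewrite -{1}[u]scale1r ZL scale1r.
elim=> [|n IH] x; first by rewrite /Y/= Z0.
by rewrite !YS ZS ZD ZX !IH.
Qed.

Let YY m n x : Y m (Y n x) = Y n (Y m x).
Proof. by apply: Ycomm; [exact: YL|move=> u; rewrite (Ycomm XL)]. Qed.

Let Yself n u v : dot (Y n u) v = dot u (Y n v).
Proof.
elim: n u v => [|n IH] u v; first by rewrite dot0l dot0r.
rewrite !YS dotZl dotZr dotDl dotDr Xself !IH; congr (_ * _).
by rewrite conj_Creal// realV realn.
Qed.

Let y_ge0 n : 0 <= y n.
Proof. by elim: n => // n IH; rewrite yS mulr_ge0// addr_ge0// exprn_ge0. Qed.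

Let y_le1 n : y n <= 1.
Proof. by elim: n => [|n IH]; rewrite ?ler01// yS; have := y_ge0 n; nra. Qed.

Let y_mono n : y n <= y n.+1.
Proof. by rewrite yS; have := sqr_ge0 (1 - y n); nra. Qed.

Let half_norm : complex.Re `|2^-1 : R[i]| = 2^-1.
Proof.
rewrite ger0_norm ?invr_ge0 ?ler0n//.
by have -> : (2^-1 : R[i]) = ((2^-1)%:C)%C by rewrite fmorphV/= rmorph_nat.
Qed.

Let Y_le n x : rnorm (Y n x) <= y n * rnorm x.
Proof.
elim: n x => [|n IH] x; first by rewrite mul0r rnorm0.
rewrite YS yS rnormZ half_norm -mulrA ler_wpM2l ?invr_ge0//.
apply: le_trans (rnormD _ _) _; rewrite mulrDl mul1r lerD//.
by apply: le_trans (IH _) _; rewrite expr2 -mulrA ler_wpM2l.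
Qed.

(** As the iterates commute, the difference of squares Y'^2 - Y^2 is Y' (Y' - Y) + Y (Y' - Y). The
    scalar iteration satisfies the same recursion, so its increments dominate by induction. *)
Let Y_step n x : rnorm (Y n.+1 x - Y n x) <= (y n.+1 - y n) * rnorm x.
Proof.
elim: n x => [|n IH] x.
  by rewrite subr0 [y 0]/(0:R) subr0; exact: Y_le.
rewrite [Y n.+2 x]YS [in X in _ - X]YS -scalerBr opprD addrACA subrr add0r.
have -> : Y n.+1 (Y n.+1 x) - Y n (Y n x) = Y n.+1 (Y n.+1 x - Y n x) + Y n (Y n.+1 x - Y n x).
  by rewrite !YB [Y n (Y n.+1 x)]YY addrA subrK.
have -> : y n.+2 - y n.+1 = 2^-1 * (y n.+1 * (y n.+1 - y n) + y n * (y n.+1 - y n)).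
  by rewrite [y n.+2]yS; have := yS n; lra.
rewrite rnormZ half_norm -mulrA ler_wpM2l ?invr_ge0//.
apply: le_trans (rnormD _ _) _; rewrite mulrDl; apply: lerD.
  by apply: le_trans (Y_le _ _) _; rewrite -mulrA ler_wpM2l.
by apply: le_trans (Y_le _ _) _; rewrite -mulrA ler_wpM2l.
Qed.

Let Y_cauchy m n x : (m <= n)%N -> rnorm (Y n x - Y m x) <= (y n - y m) * rnorm x.
Proof.
move=> /subnK <-; elim: (n - m)%N => [|k IH].
  by rewrite add0n !subrr rnorm0 mul0r.
rewrite addSn -(subrKA (Y (k + m) x)) -(subrKA (y (k + m))) mulrDl.
by apply: le_trans (rnormD _ _) _; apply: lerD.
Qed.

Let Y_cvg x : cvg ((fun n => Y n x) @ \oo).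
Proof.
apply: rnorm_complete => e e0.
have x0 : 0 < rnorm x + 1 by rewrite ltr_wpDl ?rnorm_ge0.
have hs : has_sup (range y).
  by split; [exists (y 0), 0|exists 1 => _ [n _ <-]].
(* The scalar sequence increases and is bounded by 1; from N on it stays within this distance of its
   supremum, and [Y_cauchy] transfers this to the operators. *)
have [_ [N _ <-] hN] := sup_adherent (divr_gt0 e0 x0) hs.
exists (Y N x); exists N => // n /= Nn; apply: le_lt_trans (Y_cauchy _ Nn) _.
have yn : y n <= sup (range y) by apply: ub_le_sup; [case: hs|exists n].
apply: le_lt_trans (_ : (y n - y N) * (rnorm x + 1) < _).
  rewrite ler_wpM2l ?lerDl// subr_ge0.
  by elim: n Nn {yn} => [|n IH]; rewrite leq_eqVlt => /predU1P[->//|] // /IH /le_trans; apply.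
by rewrite -ltr_pdivlMr//; lra.
Qed.

Let L x : H := lim ((fun n => Y n x) @ \oo).

Let YtoL x : (fun n => Y n x) @ \oo --> L x.
Proof. exact: Y_cvg. Qed.

Let L_unique x z : (fun n => Y n x) @ \oo --> z -> L x = z.
Proof. by move=> h; apply: cvg_lim => //; exact: norm_hausdorff. Qed.

Let LL : linear L.
Proof.
move=> a u v; apply: L_unique.
rewrite (_ : (fun n => _) = (fun n => a *: Y n u + Y n v)); last by apply/funext => n; rewrite YL.
by apply: cvgD => //; apply: cvgZr.
Qed.

Let Lself u v : dot (L u) v = dot u (L v).
Proof.
have h1 : (fun n => dot (Y n u) v : R[i]^o) @ \oo --> (dot (L u) v : R[i]^o).
  by apply: (continuous_cvg _ (@dotl_continuous R H v (L u))).
have h2 : (fun n => dot u (Y n v) : R[i]^o) @ \oo --> (dot u (L v) : R[i]^o).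
  by apply: (continuous_cvg _ (@dotr_continuous R H u (L v))).
apply: (@cvg_unique _ (@norm_hausdorff _ R[i]^o) _ _ _ _ h1).
by rewrite (_ : (fun n => _) = (fun n => dot u (Y n v))) //; apply/funext => n; rewrite Yself.
Qed.

Let L_approx x (e : R) : 0 < e -> exists N, forall n, (N <= n)%N -> rnorm (Y n x - L x) < e.
Proof. by move=> e0; have [N _ hN] := (rnorm_cvgP _ _ _).1 (@YtoL x) e e0; exists N => n /hN. Qed.

Let L1 x : rnorm (L x) <= rnorm x.
Proof.
apply/ler_addgt0Pr => e e0; have [N hN] := L_approx x e0; have {hN} := hN N (leqnn _).
have := Y_le N x; have := y_le1 N; have := rnormD (Y N x) (L x - Y N x).
rewrite addrC subrK rnormB => h1 h2 h3 h4.
have : y N * rnorm x <= rnorm x by rewrite ler_piMl ?rnorm_ge0.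
lra.
Qed.

Let L_fix x : L x = (2^-1 : R[i]) *: (X x + L (L x)).
Proof.
apply: L_unique; rewrite -(cvg_shiftS (fun n => Y n x)).
rewrite (_ : (fun n => _) = (fun n => (2^-1 : R[i]) *: (X x + Y n (Y n x)))); last by apply/funext.
apply: cvgZr; apply: cvgD; first exact: cvg_cst.
apply/rnorm_cvgP => e e0; have e2 : 0 < e / 2 by rewrite divr_gt0.
have [N hN] := L_approx x e2; have [M hM] := L_approx (L x) e2.
exists (maxn N M) => // n /=; rewrite geq_max => /andP[/hN h1 /hM h2].
(* Both the argument and the operator vary with n; inserting Y n (L x) separates them, and [Y n] is
   a contraction. *)
rewrite -(subrKA (Y n (L x))) [e]splitr -YB; apply: le_lt_trans (rnormD _ _) _; apply: ltrD => //.
apply: le_lt_trans h1; apply: le_trans (Y_le _ _) _.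
by rewrite ler_piMl ?rnorm_ge0.
Qed.

(** S = 1 - L. It is positive because [L] is a self-adjoint contraction, and the fixed point
    equation 2 L = X + L^2 gives S^2 = 1 - X = A* A. *)
Lemma sqrt_contraction : exists S : bop H, [/\ positive_op S,
  forall x y, dot (S x) y = dot x (S y) &
  forall x, S (S x) = adjoint A (A x)].
Proof.
have SL : linear (fun x => x - L x).
  by move=> a u v; rewrite LL scalerBr opprD addrACA.
have [x|S SE] := @bop_of_bounded _ _ (fun x => x - L x) 2 SL.
  apply: le_trans (rnormD _ _) _; rewrite rnormN mulrDl mul1r lerD//.
have Sself u v : dot (S u) v = dot u (S v) by rewrite !SE dotBl dotBr Lself.
exists S; split => // x.
  have hr : dot (S x) x \is Num.real.
    by apply/CrealP; rewrite -dot_conj Sself.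
  rewrite -[dot _ _]RRe_real// ler0c SE dotBl dotxx.
  have := Re_dot_CS (L x) x; have : rnorm (L x) * rnorm x <= rnorm x ^+ 2.
    by rewrite expr2 ler_wpM2r ?rnorm_ge0.
  by case: (dot (L x) x) => a b /=; lra.
rewrite !SE; have LB u v : L (u - v) = L u - L v by rewrite addrC -scaleN1r LL scaleN1r addrC.
have h : L x + L x = X x + L (L x).
  have /(congr1 (fun v => 2%:R *: v)) := L_fix x.
  by rewrite scalerA mulfV ?pnatr_eq0// scale1r scaler_nat mulr2n.
have hLL : L (L x) = L x + L x - X x by rewrite h addrAC subrr add0r.
rewrite LB hLL; have -> : L x - (L x + L x - X x) = X x - L x.
  by rewrite opprB addrC opprD addrA subrK.
by rewrite opprB addrA subrK /X opprB addrC subrK.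
Qed.
End SquareRoot.

(** Divide A by k, take the root for the resulting contraction and multiply it by k. The summand 1
    in k keeps k invertible when the bound c is 0. *)
Lemma sqrt_exists (R : realType) (H : hilbertType R) (A : bop H) :
  exists S : bop H, [/\ positive_op S, forall x y, dot (S x) y = dot x (S y) &
    bop_comp S S = bop_comp (adjoint A) A].
Proof.
have [c c0 Ac] := bop_bounded A; pose k := c + 1.
have k0 : 0 < k by rewrite ltr_wpDl.
pose f x := ((k^-1)%:C)%C *: A x.
have fl : linear f by move=> a u v; rewrite /f linearP/= scalerDr !scalerA mulrC.
have [x|B BE] := @bop_of_bounded _ _ f 1 fl.
  rewrite rnorm_homogeneous ?invr_gt0// mul1r mulrC ler_pdivrMr//.
  by apply: le_trans (Ac x) _; rewrite mulrC ler_wpM2l ?rnorm_ge0// lerDl.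
have [x|S [S0 Sself SS]] := @sqrt_contraction _ _ B.
  rewrite BE rnorm_homogeneous ?invr_gt0// mulrC ler_pdivrMr//.
  by apply: le_trans (Ac x) _; rewrite mulrC ler_wpM2l ?rnorm_ge0// lerDl.
have adjB x : adjoint B x = ((k^-1)%:C)%C *: adjoint A x.
  rewrite (@adjointE _ _ B (fun x => ((k^-1)%:C)%C *: adjoint A x))// => u v.
  by rewrite BE dotZl adjointP dotZr conjC_real.
have gl : linear (fun x => (k%:C)%C *: S x).
  by move=> a u v; rewrite linearP/= scalerDr !scalerA mulrC.
have [s s0 Ss] := bop_bounded S.
have [x|T TE] := @bop_of_bounded _ _ _ (k * s) gl.
  by rewrite rnorm_homogeneous// -mulrA ler_wpM2l// ltW.
exists T; split.
- by move=> x; rewrite TE dotZl mulr_ge0 ?S0// ler0c ltW.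
- by move=> x y; rewrite !TE dotZl dotZr Sself conjC_real.
- apply: bop_ext => x /=; rewrite !TE linearZ/= SS BE adjB /f [adjoint A _]linearZ/= !scalerA.
  rewrite -!rmorphM/= (_ : k * k * k^-1 * k^-1 = 1) ?scale1r//.
  by field; rewrite gt_eqF.
Qed.

(** * Polar decomposition *)

Section PolarDecomposition.
Variables (R : realType) (H : hilbertType R) (A S : bop H).
Hypothesis S_self : forall x y, dot (S x) y = dot x (S y).
Hypothesis S_sqr : bop_comp S S = bop_comp (adjoint A) A.

Let dotSA x y : dot (S x) (S y) = dot (A x) (A y).
Proof.
by rewrite S_self (_ : S (S y) = bop_comp S S y)// S_sqr/= adjointP.
Qed.

Let rnormSA x : rnorm (S x) = rnorm (A x).
Proof. by apply/eqP; rewrite -(@eqrXn2 _ 2) ?rnorm_ge0// !rnorm_sqr dotSA. Qed.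

Let M : set H := range S.

Let pre (m : H) : H := xget 0 [set x | S x = m].

(** By [rnormSA], [A] vanishes on the kernel of [S], so A (pre m) does not depend on the preimage
    chosen: S x |-> A x is well defined on the range of [S]. *)
Let preE x : A (pre (S x)) = A x.
Proof.
have : S (pre (S x)) = S x by rewrite /pre; apply: (@xgetPex _ 0 [set y | S y = S x]); exists x.
move=> e; apply/eqP; rewrite -subr_eq0 -linearB; apply/eqP/rnorm0_eq0.
by rewrite -rnormSA linearB/= e subrr rnorm0.
Qed.

Let M_closure_orth w : (forall x, dot (S x) w = 0) -> forall m, closure M m -> dot m w = 0.
Proof.
move=> hw m clm; have cl : closed [set m : H | dot m w = (0 : R[i]^o)].
  apply: (@continuous_eq_closed H R[i]^o (dot^~ w) (cst 0)).
  - exact: norm_hausdorff.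
  - exact: dotl_continuous.
  - by move=> ?; exact: cvg_cst.
by apply: cl; apply: closure_subset clm => _ [x _ <-]; exact: hw.
Qed.

(* W is the adjoint of the partial isometry of the polar decomposition A = U S. *)
Lemma polar_contraction : exists W : bop H,
  (forall x, rnorm (W x) <= rnorm x) /\ forall x, W (A x) = S x.
Proof.
have /choice[f hf] : forall y, exists w, [/\ closure M w,
    forall x, dot (A x) y = dot (S x) w & rnorm w <= rnorm y].
  move=> y; have [|||||w [clw hw wy]] := @riesz_submodule _ _ M (fun m => dot (A (pre m)) y) (rnorm y) _ _ _ _ _.
  - by exists 0 => //; rewrite linear0.
  - by move=> a _ _ [u _ <-] [v _ <-]; exists (a *: u + v) => //; rewrite linearP.
  - by move=> a _ _ [u _ <-] [v _ <-]; rewrite -linearP !preE linearP dot_linearl.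
  - exact: rnorm_ge0.
  - by move=> _ [u _ <-]; rewrite preE rnormSA mulrC; exact: dot_CS.
  - exists w; split => // x; rewrite -hw ?preE//; by exists x.
have clf y : closure M (f y) by case: (hf y).
have fE x y : dot (A x) y = dot (S x) (f y) by case: (hf y).
have f1 y : rnorm (f y) <= 1 * rnorm y by rewrite mul1r; case: (hf y).
have fl : linear f.
  (* All values of f lie in the closure of the range of [S], and the difference w is orthogonal to
     that range, hence to each of its own terms and so to itself. *)
  move=> a u v; apply/eqP; rewrite -subr_eq0; apply/eqP; set w := _ - _.
  have ow x : dot (S x) w = 0.
    by rewrite /w dotBr dotDr dotZr -!fE dotDr dotZr subrr.
  apply: rnorm0_eq0; apply/eqP; rewrite -sqrf_eq0 rnorm_sqr {1}/w.
  by rewrite dotBl dotDl dotZl !(M_closure_orth ow)// mulr0 addr0 subr0.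
have [W WE] := bop_of_bounded fl f1.
exists W; split=> x; rewrite WE; first by rewrite -[leRHS]mul1r.
apply/eqP; rewrite -subr_eq0; apply/eqP; set w := _ - _.
have ow y : dot (S y) w = 0 by rewrite /w dotBr -fE dotSA subrr.
apply: rnorm0_eq0; apply/eqP; rewrite -sqrf_eq0 rnorm_sqr {1}/w.
by rewrite dotBl (M_closure_orth ow)// ow subr0.
Qed.
End PolarDecomposition.

(** Quantifying over all contractions spares the user the absolute value: for the W with W A = |A|,
    the sums in the hypothesis are the partial sums of the diagonal of |A|. *)
Lemma trace_class_criterion (R : realType) (H : hilbertType R) (A : bop H)
    (E : set H) (K : R) : onb E ->
  (forall (W : bop H) (s : seq H), (forall x, rnorm (W x) <= rnorm x) -> uniq s ->
     (forall e, e \in s -> E e) ->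
     complex.Re (\sum_(e <- s) dot (W (A e)) e) <= K) ->
  trace_class A.
Proof.
move=> onbE hK; have [S [S0 S_self SS]] := sqrt_exists A.
have [W [W1 WA]] := polar_contraction S_self SS.
exists S; split => //; exists E => //.
apply: (@le_lt_trans _ _ K%:E); last by rewrite ltry.
apply: ge_ereal_sup => _ [B [fB BE] <-].
have [s [us sB ->]] := fsets_seq fB.
rewrite sumEFin lee_fin.
rewrite (_ : \sum_(e <- s) _ = complex.Re (\sum_(e <- s) dot (W (A e)) e)).
  by apply: hK => // e /sB /BE.
elim: s {us sB} => [|e s IH]; first by rewrite !big_nil.
by rewrite !big_cons ReD IH WA.
Qed.

(** * Seminorms on locally convex spaces *)

Section ComplexModulus.
Variable R : realType.
Implicit Types (a b : R[i]) (t : R).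

Lemma Re_norm_ge0 a : 0 <= complex.Re `|a|.
Proof. exact: (rnorm_ge0 (a : R[i]^o)). Qed.

Lemma Re_normM a b : complex.Re `|a * b| = complex.Re `|a| * complex.Re `|b|.
Proof. exact: (rnormZ a (b : R[i]^o)). Qed.

Lemma Re_norm_real t : complex.Re `|(t%:C)%C : R[i]| = `|t|.
Proof. by rewrite normc_def/= expr0n/= addr0 sqrtr_sqr. Qed.

Lemma Re_norm_gt0 a : a != 0 -> 0 < complex.Re `|a|.
Proof.
move=> a0; rewrite lt_neqAle eq_sym Re_norm_ge0 andbT.
by apply: contra a0 => /eqP/(@rnorm0_eq0 R R[i]^o)/eqP.
Qed.

Lemma Re_normV a : complex.Re `|a^-1| = (complex.Re `|a|)^-1.
Proof.
have [->|a0] := eqVneq a 0; first by rewrite invr0 normr0/= invr0.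
apply: (mulfI (lt0r_neq0 (Re_norm_gt0 a0))).
by rewrite -Re_normM !mulfV ?normr1// lt0r_neq0// Re_norm_gt0.
Qed.
End ComplexModulus.

Section Seminorms.
Variables (R : realType) (E : tvsType R[i]).
Implicit Types (p q r : E -> R) (x y z : E) (U : set E).

Section Properties.
Variable p : E -> R.
Hypothesis cp : continuous_seminorm p.

Lemma seminormD x y : p (x + y) <= p x + p y. Proof. by case: cp. Qed.

Lemma seminormZ a x : p (a *: x) = complex.Re `|a| * p x. Proof. by case: cp. Qed.

Lemma seminorm_cont : continuous p. Proof. by case: cp. Qed.

Lemma seminorm0 : p 0 = 0.
Proof. by rewrite -(scale0r 0) seminormZ normr0 mul0r. Qed.

Lemma seminormN x : p (- x) = p x.
Proof. by rewrite -scaleN1r seminormZ normrN1 mul1r. Qed.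

Lemma seminorm_ge0 x : 0 <= p x.
Proof. by have := seminormD x (- x); rewrite subrr seminorm0 seminormN; lra. Qed.

Lemma seminormBC x y : p (x - y) = p (y - x).
Proof. by rewrite -seminormN opprB. Qed.

Lemma seminorm_tri z x y : p (x - y) <= p (x - z) + p (z - y).
Proof. by have := seminormD (x - z) (z - y); rewrite addrA subrK. Qed.

Lemma seminorm_homogeneous : positively_homogeneous p.
Proof. by move=> t x t0; rewrite seminormZ Re_norm_real gtr0_norm. Qed.

Lemma seminorm_sum (I : Type) (s : seq I) (f : I -> E) :
  p (\sum_(i <- s) f i) <= \sum_(i <- s) p (f i).
Proof.
elim/big_ind2 : _ => [|x a y b xa yb|//]; first by rewrite seminorm0.
by apply: le_trans (seminormD _ _) _; rewrite lerD.
Qed.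
End Properties.

Lemma shift_continuous x : continuous (fun y : E => y - x).
Proof.
move=> y; apply: (@continuous_comp _ _ _ (fun y : E => (y, - x)) (fun z : E * E => z.1 + z.2)).
  by apply: cvg_pair; [exact: cvg_id|exact: cvg_cst].
exact: add_continuous.
Qed.

Lemma nbhs_shift x U : nbhs 0 U -> nbhs x [set y | U (y - x)].
Proof. by move=> nU; apply: (@shift_continuous x x U); rewrite subrr. Qed.

Lemma seminorm_nbhs p x (e : R) : continuous_seminorm p -> 0 < e ->
  nbhs x [set y | p (y - x) < e].
Proof.
move=> cp e0; apply: (@nbhs_shift x [set y | p y < e]).
have /cvgrPdist_lt/(_ e e0) := seminorm_cont cp (x := 0).
by apply: filterS => y; rewrite seminorm0// sub0r normrN; apply: le_lt_trans; exact: ler_norm.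
Qed.

(** On the neighbourhood x + (e/2) U of x, p (y - x) is at most e/2. *)
Lemma seminorm_continuous p U : nbhs 0 U -> (forall x, U x -> p x <= 1) ->
  (forall x y, p (x + y) <= p x + p y) ->
  (forall a x, p (a *: x) = complex.Re `|a| * p x) -> continuous_seminorm p.
Proof.
move=> nU pU pD pZ; split => // x; apply/cvgrPdist_lt => e e0.
have p0 : p 0 = 0 by rewrite -(scale0r 0) pZ normr0 mul0r.
have pN z : p (- z) = p z by rewrite -scaleN1r pZ normrN1 mul1r.
have e2 : 0 < e / 2 by rewrite divr_gt0.
have e20 : ((e / 2)%:C)%C != 0 :> R[i] by rewrite gt_eqF// ltcR.
have := nbhs_shift x (nbhs0Z e20 nU); apply: filterS => y [u Uu yx].
have pyx : p (y - x) < e.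
  rewrite -yx pZ Re_norm_real gtr0_norm//.
  by have := pU u Uu; nra.
have := pD (y - x) x; have := pD (x - y) y; rewrite !subrK -opprB pN.
by rewrite ltr_norml => h1 h2; apply/andP; split; lra.
Qed.

Lemma absorbing U x : nbhs 0 U ->
  exists2 t : R, 0 < t & forall a : R[i], complex.Re `|a| <= t -> U (a *: x).
Proof.
move=> nU; have := @scale_continuous _ E (0, x) U; rewrite /= scale0r => /(_ nU).
move=> [[A B] /= [/nbhs_rnormP[e e0 eA] nB] AB].
exists (e / 2); first by rewrite divr_gt0.
move=> a ae; apply: (AB (a, x)); split; last exact: nbhs_singleton.
apply: eA; rewrite subr0; apply: le_lt_trans ae _.
by rewrite ltr_pdivrMr// mulr_natr mulr2n ltrDl.
Qed.

(** * Minkowski functional of a convex neighbourhood *)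

Section Gauge.
Variable B : set E.
Hypothesis Bcvx : forall x y (s : R), 0 <= s -> s <= 1 -> B x -> B y ->
  B ((s%:C)%C *: x + ((1 - s)%:C)%C *: y).
Hypothesis Bnbhs : nbhs 0 B.

(** The balanced core of [B]. Local convexity provides sets that are merely convex; balancedness is
    what makes the gauge homogeneous under complex scalars. *)
Let D : set E := [set x | forall a, complex.Re `|a| <= 1 -> B (a *: x)].

Definition gauge x : R := inf [set t | 0 < t /\ D (((t^-1)%:C)%C *: x)].

Let Dcvx x y (s : R) : 0 <= s -> s <= 1 -> D x -> D y ->
  D ((s%:C)%C *: x + ((1 - s)%:C)%C *: y).
Proof.
move=> s0 s1 Dx Dy a a1; rewrite scalerDr !scalerA ![a * _]mulrC -!scalerA.
by apply: Bcvx => //; [exact: Dx|exact: Dy].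
Qed.

Let Dbal a x : complex.Re `|a| <= 1 -> D x -> D (a *: x).
Proof.
move=> a1 Dx b b1; rewrite scalerA; apply: Dx.
by rewrite Re_normM mulr_ile1 ?Re_norm_ge0.
Qed.

Let Dnbhs : nbhs 0 D.
Proof.
(* Scaling W by numbers of modulus below e stays in [B], so (e/2) W lies in [D]. *)
have := @scale_continuous _ E (0, 0) B; rewrite /= scale0r => /(_ Bnbhs).
move=> [[A W] /= [/nbhs_rnormP[e e0 eA] nW] AW].
have e2 : 0 < e / 2 by rewrite divr_gt0.
have e20 : ((e / 2)%:C)%C != 0 :> R[i] by rewrite gt_eqF// ltcR.
apply: filterS (nbhs0Z e20 nW) => _ [w Ww <-] a a1.
rewrite scalerA; apply: (AW (_, w)); split => //=; apply: eA.
rewrite subr0 /rnorm Re_normM Re_norm_real [`|e / 2|]gtr0_norm//.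
by move: (Re_norm_ge0 a) a1; nra.
Qed.

Let S x := [set t | 0 < t /\ D (((t^-1)%:C)%C *: x)].

Let S_inf x : has_inf (S x).
Proof.
split; last by exists 0 => t [/ltW].
have [t t0 tD] := absorbing x Dnbhs; exists t^-1; split; first by rewrite invr_gt0.
by apply: tD; rewrite invrK Re_norm_real gtr0_norm.
Qed.

Let gauge_le x t : 0 < t -> D (((t^-1)%:C)%C *: x) -> gauge x <= t.
Proof. by move=> t0 Dt; apply: ge_inf; [case: (S_inf x)|split]. Qed.

Let gauge_lt x e : gauge x < e -> exists2 t, t < e & 0 < t /\ D (((t^-1)%:C)%C *: x).
Proof.
move=> xe; have e0 : 0 < e - gauge x by rewrite subr_gt0.
have [t St te] := inf_adherent e0 (S_inf x).
by exists t => //; move: te; rewrite addrC subrK.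
Qed.

Let gaugeD x y : gauge (x + y) <= gauge x + gauge y.
Proof.
apply/ler_addgt0Pr => e e0; have e2 : 0 < e / 2 by rewrite divr_gt0.
have [|s se [s0 Ds]] := @gauge_lt x (gauge x + e / 2); first by rewrite ltrDl.
have [|t te [t0 Dt]] := @gauge_lt y (gauge y + e / 2); first by rewrite ltrDl.
apply: (@le_trans _ _ (s + t)); last by move: se te; lra.
have st0 : 0 < s + t by rewrite addr_gt0.
apply: gauge_le => //.
(* (x + y)/(s + t) is the convex combination of x/s and y/t with weights s/(s + t) and t/(s + t). *)
have -> : (((s + t)^-1)%:C)%C *: (x + y) = ((s / (s + t))%:C)%C *: (((s^-1)%:C)%C *: x) +
   ((1 - s / (s + t))%:C)%C *: (((t^-1)%:C)%C *: y).
  rewrite !scalerA -!rmorphM/= scalerDr; congr (_%:C%C *: _ + _%:C%C *: _); field.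
    by rewrite !gt_eqF.
  by rewrite !gt_eqF.
by apply: Dcvx => //; [rewrite divr_ge0// ltW|rewrite ler_pdivrMr// mul1r lerDl ltW].
Qed.

Let gauge_ge0 x : 0 <= gauge x.
Proof. by apply: lb_le_inf => [|t [/ltW]]; case: (S_inf x). Qed.

Let gaugeZ_le a x : gauge (a *: x) <= complex.Re `|a| * gauge x.
Proof.
have [->|a0] := eqVneq a 0.
  rewrite scale0r normr0 mul0r; apply/ler_addgt0Pr => e e0; rewrite add0r.
  by apply: gauge_le => //; rewrite scaler0; exact: nbhs_singleton Dnbhs.
have ap := Re_norm_gt0 a0.
rewrite -ler_pdivrMl//; apply/ler_addgt0Pr => e e0.
have [|t te [t0 Dt]] := @gauge_lt x (gauge x + e); first by rewrite ltrDl.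
apply: le_trans (ltW te); rewrite ler_pdivrMl//; apply: gauge_le; first by rewrite mulr_gt0.
have -> : (((complex.Re `|a| * t)^-1)%:C)%C *: (a *: x) =
    ((((complex.Re `|a|)^-1)%:C)%C * a) *: (((t^-1)%:C)%C *: x).
  by rewrite !scalerA invfM rmorphM/= -!mulrA; congr (_ * _ *: _); rewrite mulrC.
apply: Dbal => //; rewrite Re_normM Re_norm_real gtr0_norm ?invr_gt0//.
by rewrite mulVf// gt_eqF.
Qed.

Let gaugeZ a x : gauge (a *: x) = complex.Re `|a| * gauge x.
Proof.
apply/eqP; rewrite eq_le gaugeZ_le andTb.
have [->|a0] := eqVneq a 0; first by rewrite normr0 mul0r gauge_ge0.
have ap := Re_norm_gt0 a0.
have := gaugeZ_le a^-1 (a *: x); rewrite scalerA mulVf// scale1r => h.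
rewrite -ler_pdivlMl//; apply: le_trans h _.
by rewrite Re_normV.
Qed.

Lemma gauge_seminorm : continuous_seminorm gauge.
Proof.
apply: (@seminorm_continuous gauge D) => // x Dx.
by apply: gauge_le => //; rewrite invr1 scale1r.
Qed.

Lemma gauge_lt1 x : gauge x < 1 -> B x.
Proof.
move=> /gauge_lt[t t1 [t0 /(_ ((t%:C)%C))]].
rewrite Re_norm_real gtr0_norm// scalerA -rmorphM/= mulfV ?gt_eqF// scale1r.
by apply; exact: ltW.
Qed.
End Gauge.

(** A convex neighbourhood contains the open unit ball of its gauge. From here on, topological
    statements about locally convex spaces become inequalities between continuous seminorms. *)
Lemma nbhs_seminormP x U :
  nbhs x U <-> exists p, continuous_seminorm p /\ forall y, p (y - x) < 1 -> U y.
Proof.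
split=> [nU|[p [cp pU]]]; last by apply: filterS pU _; exact: seminorm_nbhs.
have nU0 : nbhs (0 : E) [set y | U (x + y)].
  have : nbhs (0 + x) U by rewrite add0r.
  move=> /(@add_continuous E (0, x))[[A B] /= [nA nB] AB].
  by apply: filterS nA => y Ay; rewrite /= addrC; apply: (AB (y, x)); split => //; exact: nbhs_singleton.
have [BB Bc [Bo Bb]] := @locally_convex _ E.
have [b [Bb' b0] bU] := Bb _ _ nU0.
have bcvx y z (s : R) : 0 <= s -> s <= 1 -> b y -> b z ->
    b ((s%:C)%C *: y + ((1 - s)%:C)%C *: z).
  move=> s0 s1 by_ bz.
  have s0' : 0 <= (s%:C)%C :> R[i] by rewrite ler0c.
  have s1' : (s%:C)%C <= 1 :> R[i] by rewrite -(rmorph1 (real_complex R)) lecR.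
  have := Bc b (mem_set Bb') y z (Itv01 s0' s1') (mem_set by_) (mem_set bz).
  move=> /set_mem; rewrite rmorphB/= rmorph1; exact.
have nb : nbhs 0 b by apply: open_nbhs_nbhs; split => //; exact: Bo.
exists (gauge b); split; first exact: gauge_seminorm.
by move=> y /(gauge_lt1 nb)/bU; rewrite /= addrC subrK.
Qed.

Lemma hausdorff_seminorm x : hausdorff_space E ->
  (forall p, continuous_seminorm p -> p x = 0) -> x = 0.
Proof.
move=> hE hp; apply: hE => A B nA nB; exists x; split; first exact: nbhs_singleton.
move/nbhs_seminormP : nB => [p [cp pB]]; apply: pB.
by rewrite subr0 hp.
Qed.

Lemma seminorm_scale p (k : R) : 0 <= k -> continuous_seminorm p ->
  continuous_seminorm (fun x => k * p x).
Proof.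
move=> k0 cp; split.
- by move=> x y; rewrite -mulrDr ler_wpM2l// seminormD.
- by move=> a x; rewrite seminormZ// mulrCA.
- by move=> x; apply: cvgMr; exact: (seminorm_cont cp).
Qed.

Lemma seminorm_cst0 : continuous_seminorm (cst 0 : E -> R).
Proof. by split => [x y|a x|x]; [rewrite addr0|rewrite mulr0|exact: cvg_cst]. Qed.
End Seminorms.

Lemma seminorm_comp (R : realType) (E F : tvsType R[i]) (f : E -> F) (p : F -> R) :
  linear f -> continuous f -> continuous_seminorm p -> continuous_seminorm (p \o f).
Proof.
move=> fl cf cp; have f0 : f 0 = 0.
  by have := fl (-1) 0 0; rewrite scaler0 addr0 scaleN1r addNr.
split => [x y|a x|x] /=.
- by rewrite -{1}[x]scale1r fl scale1r seminormD.
- by rewrite -[a *: x]addr0 fl f0 addr0 seminormZ.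
- by apply: continuous_comp; [exact: cf|exact: (seminorm_cont cp)].
Qed.

Lemma rnorm_seminorm (R : realType) (V : normedModType R[i]) :
  continuous_seminorm (@rnorm R V).
Proof.
by split; [exact: rnormD|exact: rnormZ|exact: rnorm_continuous].
Qed.

Lemma seminorm_conj (R : realType) (E : tvsType R[i]) (p : E -> R) :
  continuous_seminorm p -> continuous_seminorm (p : conj_space E -> R).
Proof.
move=> cp; split => [x y|a x|].
- exact: (seminormD cp).
- by rewrite -[LHS]/(p (a^* *: (x : E))) seminormZ// norm_conjC.
- exact: (seminorm_cont cp).
Qed.

Lemma linear_continuous_seminorm (R : realType) (E F : tvsType R[i]) (f : E -> F) :
  linear f -> (forall q, continuous_seminorm q ->
    exists2 p, continuous_seminorm p & forall x, q (f x) <= p x) -> continuous f.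
Proof.
move=> fl hf x U /nbhs_seminormP[q [cq qU]]; have [p cp qp] := hf q cq.
apply/nbhs_seminormP; exists p; split => // y yx; apply: qU.
have -> : f y - f x = f (y - x) by rewrite addrC -scaleN1r -fl scaleN1r addrC.
exact: le_lt_trans yx.
Qed.

(** * Completed projective tensor products *)

Section ProjectiveTensorTheory.
Variables (R : realType) (E F P : tvsType R[i]) (t : E -> F -> P).
Hypothesis hP : is_projective_tensor t.
Implicit Types (p : E -> R) (q : F -> R) (r : P -> R).

Let tl y a x x' : t (a *: x + x') y = a *: t x y + t x' y.
Proof. by case: hP => -[h _] _ _ _ _; exact: h. Qed.
Lemma proj_tensorZl a x y : t (a *: x) y = a *: t x y.
Proof.
have t0 : t 0 y = 0.
  by have := tl y (-1) 0 0; rewrite scaler0 addr0 scaleN1r addNr.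
by rewrite -[a *: x]addr0 tl t0 addr0.
Qed.

Let ts := tensor_sum t.

Let range_lin a z z' : range ts z -> range ts z' -> range ts (a *: z + z').
Proof.
move=> [s _ <-] [s' _ <-]; exists ([seq (a *: xy.1, xy.2) | xy <- s] ++ s') => //.
rewrite /ts /tensor_sum big_cat big_map scaler_sumr; congr (_ + _).
by apply: eq_bigr => xy _; rewrite proj_tensorZl.
Qed.

Let range0 : range ts 0.
Proof. by exists [::] => //; rewrite /ts /tensor_sum big_nil. Qed.

Let range_t x y : range ts (t x y).
Proof. by exists [:: (x, y)] => //; rewrite /ts /tensor_sum big_seq1. Qed.

Let dense : closure (range ts) = setT.
Proof. by case: hP. Qed.

(** Additivity suffices: the dense subspace consists of plain sums of elementary tensors, scalars
    being absorbed in a factor. *)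
Lemma proj_tensor_ind (Q : set P) : closed Q -> Q 0 ->
  (forall z z', Q z -> Q z' -> Q (z + z')) -> (forall x y, Q (t x y)) -> forall z, Q z.
Proof.
move=> cQ Q0 QD Qt; apply: (closed_dense dense cQ) => _ [s _ <-].
by rewrite /ts /tensor_sum; elim/big_ind : _.
Qed.

(** Stated with additivity instead of linearity so as to cover antilinear maps such as the
    involution. *)
Lemma proj_tensor_eq (V : topologicalType) (f g : P -> V) : hausdorff_space V ->
  continuous f -> continuous g -> f 0 = g 0 ->
  (forall z z', f z = g z -> f z' = g z' -> f (z + z') = g (z + z')) ->
  (forall x y, f (t x y) = g (t x y)) -> forall z, f z = g z.
Proof.
move=> hV cf cg f0 fD ft; apply: proj_tensor_ind => //.
exact: continuous_eq_closed.
Qed.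

Lemma proj_tensor_approx z r (e : R) : continuous_seminorm r -> 0 < e ->
  exists z', range ts z' /\ r (z - z') < e.
Proof.
move=> cr e0; have : closure (range ts) z by rewrite dense.
move=> /(_ _ (seminorm_nbhs z cr e0))[z' [rz' zz']]; exists z'; split => //.
by rewrite seminormBC.
Qed.

(** The one-term representation shows that the projective seminorm of x (x) y is at most p x q y.
    Homogeneity in x alone turns the inclusion of balls into an inequality; the radius e is absorbed
    in p. *)
Lemma proj_tensor_factor r : continuous_seminorm r -> exists p q,
  [/\ continuous_seminorm p, continuous_seminorm q & forall x y, r (t x y) <= p x * q y].
Proof.
move=> cr; have [_ _ _ _ hT] := hP.
have n1 : nbhs 0 [set z | r z < 1].
  by have := seminorm_nbhs 0 cr ltr01; apply: filterS => z; rewrite /= subr0.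
have /hT[p [q [e [cp cq e0 pq]]]] : within (range (tensor_sum t)) (nbhs (0 : P)) [set z | r z < 1].
  by apply: filterS n1.
exists (fun x => e^-1 * p x), q; split => //.
  by apply: seminorm_scale => //; rewrite invr_ge0 ltW.
move=> x y; move: x; have e0' : 0 <= e^-1 by rewrite invr_ge0 ltW.
apply: homogeneous_le.
- by move=> s x s0; rewrite (seminorm_homogeneous cp)// !mulrA [_ * s]mulrC.
- by move=> s x s0; rewrite proj_tensorZl (seminorm_homogeneous cr).
- by move=> x; rewrite !mulr_ge0// (seminorm_ge0 cp, seminorm_ge0 cq).
- move=> x; rewrite -mulrA mulrC ltr_pdivrMr// mul1r => xy; apply/ltW/pq; split=> /=; first exact: range_t.
  apply: le_lt_trans xy; rewrite /projective_seminorm; apply: ge_inf.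
    exists 0 => _ [s _ <-]; rewrite big_seq; apply: sumr_ge0 => i _.
    by rewrite mulr_ge0// (seminorm_ge0 cp, seminorm_ge0 cq).
  by exists [:: (x, y)]; rewrite /= /tensor_sum big_seq1.
Qed.

(** * The projective norm on the completion *)

Section ProjNorm.
Variables (p : E -> R) (q : F -> R).
Hypotheses (cp : continuous_seminorm p) (cq : continuous_seminorm q).

Definition dominated : set (P -> R) :=
  [set r | continuous_seminorm r /\ forall x y, r (t x y) <= p x * q y].

(** A single neighbourhood serves all dominated seminorms; this makes their supremum both finite and
    continuous. *)
Let dominated_nbhs : exists2 U, nbhs (0 : P) U &
  forall r, dominated r -> forall z, U z -> r z <= 1.
Proof.
have [_ _ _ _ hT] := hP.
have : within (range ts) (nbhs (0 : P)) [set z | projective_seminorm t p q z < 1].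
  by apply/hT; exists p, q, 1; split => // z [].
move=> nh; have [U [oU U0] hU] : exists2 U, open_nbhs (0 : P) U &
    forall z, U z -> range ts z -> projective_seminorm t p q z < 1.
  by move: nh; rewrite /within/= nbhsE => -[U oU hU]; exists U.
exists U; first exact: open_nbhs_nbhs.
(* If r z > 1, then r > 1 on an open part of U, which contains an algebraic tensor; there r is at
   most the projective seminorm, which is below 1. *)
move=> r [cr rpq] z Uz; rewrite leNgt; apply/negP => z1.
have no : nbhs z (U `&` [set w | 1 < r w]).
  apply: filterI; first by apply: open_nbhs_nbhs.
  by apply: (@cvgr_gt _ _ _ _ _ _ (seminorm_cont cr (x := z))).
have : closure (range ts) z by rewrite dense.
move=> /(_ _ no)[w [rw [Uw]]] /=; apply/negP; rewrite -leNgt.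
have := hU _ Uw rw; rewrite /= => /ltW; apply: le_trans.
case: rw => s _ sw; apply: lb_le_inf; first by exists (\sum_(xy <- s) p xy.1 * q xy.2), s.
move=> _ [s' /= <- <-]; rewrite /tensor_sum; apply: le_trans (seminorm_sum cr _ _) _.
by apply: ler_sum.
Qed.

(* On the algebraic tensor product this is the projective seminorm of p and q; as a
   supremum over continuous seminorms it makes sense on the whole completion without
   representing its elements by absolutely convergent series. *)
Definition proj_norm (z : P) : R := sup [set r z | r in dominated].

Let has_sup_dom z : has_sup [set r z | r in dominated].
Proof.
split.
  exists 0, (cst 0) => //; split; first exact: seminorm_cst0.
  by move=> x y; rewrite mulr_ge0// (seminorm_ge0 cp, seminorm_ge0 cq).
have [U nU Ur] := dominated_nbhs; have [s s0 sU] := absorbing z nU.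
exists s^-1 => _ [r rd <-]; have : U (((s)%:C)%C *: z) by apply: sU; rewrite Re_norm_real gtr0_norm.
move=> /(Ur _ rd); case: rd => cr _; rewrite (seminorm_homogeneous cr)//.
by rewrite mulrC -ler_pdivlMr// mul1r.
Qed.

Let proj_norm_ge r z : dominated r -> r z <= proj_norm z.
Proof. by move=> dr; apply: ub_le_sup; [case: (has_sup_dom z)|exists r]. Qed.

Lemma proj_norm_seminorm : continuous_seminorm proj_norm.
Proof.
have [U nU Ur] := dominated_nbhs.
have ub z c : (forall r, dominated r -> r z <= c) -> proj_norm z <= c.
  by move=> h; apply: ge_sup; [case: (has_sup_dom z)|move=> _ [r dr <-]; exact: h].
have hZ a z : proj_norm (a *: z) <= complex.Re `|a| * proj_norm z.
  apply: ub => r dr; rewrite (seminormZ dr.1) ler_wpM2l ?Re_norm_ge0//.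
  exact: proj_norm_ge.
apply: (@seminorm_continuous _ _ _ U) => //.
- by move=> z Uz; apply: ub => r dr; exact: Ur.
- move=> z z'; apply: ub => r dr; apply: le_trans (seminormD dr.1 _ _) _.
  by apply: lerD; exact: proj_norm_ge.
- move=> a z; apply/eqP; rewrite eq_le hZ andTb.
  have [->|a0] := eqVneq a 0.
    rewrite normr0 mul0r scale0r; have [[_ [r dr _]] _] := has_sup_dom 0.
    by apply: le_trans (proj_norm_ge 0 dr); exact: (seminorm_ge0 dr.1).
  have := hZ a^-1 (a *: z); rewrite scalerA mulVf// scale1r Re_normV.
  by rewrite ler_pdivlMl// Re_norm_gt0.
Qed.

(** Divide r by k + e to get a dominated seminorm and let e tend to 0; k itself may be 0. *)
Lemma proj_norm_max r (k : R) : 0 <= k -> continuous_seminorm r ->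
  (forall x y, r (t x y) <= k * (p x * q y)) -> forall z, r z <= k * proj_norm z.
Proof.
move=> k0 cr rk z.
have h e : 0 < e -> r z <= (k + e) * proj_norm z.
  move=> e0; have ke : 0 < k + e by rewrite ltr_wpDl.
  rewrite -ler_pdivrMl//; apply: (proj_norm_ge (r := fun z => (k + e)^-1 * r z)).
  split; first by apply: seminorm_scale => //; rewrite invr_ge0 ltW.
  move=> x y; rewrite ler_pdivrMl//; apply: le_trans (rk x y) _.
  apply: ler_wpM2r; last by rewrite lerDl ltW.
  by rewrite mulr_ge0// (seminorm_ge0 cp, seminorm_ge0 cq).
apply/ler_addgt0Pr => e e0.
have n0 : 0 < proj_norm z + 1 by rewrite ltr_wpDl// (seminorm_ge0 proj_norm_seminorm).
apply: le_trans (h (e / (proj_norm z + 1)) _) _; first by rewrite divr_gt0.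
rewrite mulrDl lerD2l mulrAC ler_pdivrMr// ler_wpM2l ?lerDl// ltW//.
Qed.
End ProjNorm.

(** * Universal property of the completed tensor product *)

Section Extension.
Variables (V : tvsType R[i]) (hV : hausdorff_space V) (cV : tvs_complete V).
Variables (b : E -> F -> V) (bb : bilinear_map b).
Hypothesis bpq : forall r : V -> R, continuous_seminorm r -> exists p q,
  [/\ continuous_seminorm p, continuous_seminorm q & forall x y, r (b x y) <= p x * q y].

Let bs (s : seq (E * F)) : V := \sum_(xy <- s) b xy.1 xy.2.

Let bZl a x y : b (a *: x) y = a *: b x y.
Proof.
have b0 : b 0 y = 0.
  by have := bb.1 y (-1) 0 0; rewrite scaler0 addr0 scaleN1r addNr.
by rewrite -[a *: x]addr0 bb.1 b0 addr0.
Qed.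

Let scale_seq (a : R[i]) (s : seq (E * F)) := [seq (a *: xy.1, xy.2) | xy <- s].

Let ts_scale a s s' : ts (scale_seq a s ++ s') = a *: ts s + ts s'.
Proof.
rewrite /ts /tensor_sum big_cat big_map scaler_sumr; congr (_ + _).
by apply: eq_bigr => xy _; rewrite proj_tensorZl.
Qed.

Let bs_scale a s s' : bs (scale_seq a s ++ s') = a *: bs s + bs s'.
Proof.
rewrite /bs big_cat big_map scaler_sumr; congr (_ + _).
by apply: eq_bigr => xy _; rewrite bZl.
Qed.

Let bs_wd s s' : ts s = ts s' -> bs s = bs s'.
Proof.
move=> ss'; have [_ hw _ _ _] := hP.
have : ts (scale_seq (-1) s ++ s') = 0 by rewrite ts_scale ss' scaleN1r addNr.
move=> /hw/(_ V b bb); rewrite -/(bs _) bs_scale scaleN1r.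
by move/eqP; rewrite addrC subr_eq0 => /eqP.
Qed.

(** The map on the algebraic tensor product, computed from any representing list; elsewhere the
    default list gives 0. *)
Let L0 (z : P) : V := bs (xget [::] [set s | ts s = z]).

Let L0_ts s : L0 (ts s) = bs s.
Proof.
by apply: bs_wd; exact: (@xgetPex _ [::] [set s' | ts s' = ts s] (ex_intro _ s erefl)).
Qed.

Let L0_lin a z z' : range ts z -> range ts z' -> L0 (a *: z + z') = a *: L0 z + L0 z'.
Proof. by move=> [s _ <-] [s' _ <-]; rewrite -ts_scale !L0_ts bs_scale. Qed.

Let L00 : L0 0 = 0.
Proof.
have -> : (0 : P) = ts [::] by rewrite /ts /tensor_sum big_nil.
by rewrite L0_ts /bs big_nil.
Qed.

(** The projective topology is induced by that of P, so some seminorm rho of P controls the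
    projective seminorm. The bound by the sum of p q holds for every list representing z, hence for
    the infimum. *)
Let L0_bound (r : V -> R) : continuous_seminorm r -> exists2 rho : P -> R, continuous_seminorm rho &
  forall z, range ts z -> r (L0 z) <= rho z.
Proof.
move=> cr; have [p [q [cp cq rpq]]] := bpq cr; have [_ _ _ _ hT] := hP.
have : within (range ts) (nbhs (0 : P)) [set z | projective_seminorm t p q z < 1].
  by apply/hT; exists p, q, 1; split => // z [].
move=> /nbhs_seminormP[rho [crho hrho]]; exists rho => // z rz.
apply/ler_addgt0Pr => e e0.
have c0 : 0 < rho z + e by rewrite ltr_wpDl// (seminorm_ge0 crho).
pose c := rho z + e; have ci : 0 < c^-1 by rewrite invr_gt0.
have rcz : range ts (((c^-1)%:C)%C *: z) by rewrite -[_ *: _]addr0; exact: range_lin.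
have : projective_seminorm t p q (((c^-1)%:C)%C *: z) < 1.
  apply: hrho => //; rewrite subr0 (seminorm_homogeneous crho)//.
  by rewrite ltr_pdivrMl// mulr1 /c ltrDl.
have -> : r (L0 z) = c * r (L0 (((c^-1)%:C)%C *: z)).
  rewrite -(seminorm_homogeneous cr)//; congr (r _).
  rewrite -[_ *: z in RHS]addr0 L0_lin// L00 addr0 scalerA -rmorphM/= mulfV ?gt_eqF// scale1r//.
move=> h; rewrite -[leRHS]mulr1 ler_wpM2l ?(ltW c0)//; apply: le_trans (ltW h).
case: rcz => s _ sz; apply: lb_le_inf; first by exists (\sum_(xy <- s) p xy.1 * q xy.2), s.
move=> _ [s' /= <- <-]; rewrite -/(ts s') L0_ts; apply: le_trans (seminorm_sum cr _ _) _.
by apply: ler_sum.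
Qed.

Let L0B z z' : range ts z -> range ts z' -> L0 (z - z') = L0 z - L0 z'.
Proof. by move=> rz rz'; rewrite addrC -scaleN1r L0_lin// scaleN1r addrC. Qed.

Let rangeB z z' : range ts z -> range ts z' -> range ts (z - z').
Proof. by move=> rz rz'; rewrite addrC -scaleN1r; exact: range_lin. Qed.

(** v is the limit of [L0] along the neighbourhoods of x traced on the algebraic tensors.
    Approximating x and v by the same z is what later ties the chosen limits together. *)
Let limit x : exists v : V, forall (r : V -> R) (rho : P -> R) (e : R), continuous_seminorm r ->
  continuous_seminorm rho -> 0 < e ->
  exists z, [/\ range ts z, rho (x - z) < e & r (v - L0 z) < e].
Proof.
pose N := within (range ts) (nbhs x).
have NP : ProperFilter N.
  apply: Build_ProperFilter_ex.
  move=> A /= nA; have : closure (range ts) x by rewrite dense.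
  by move=> /(_ _ nA)[z [rz Az]]; exists z; exact: Az.
have N_near rho e : continuous_seminorm rho -> 0 < e ->
    N [set z | range ts z /\ rho (x - z) < e].
  move=> crho e0; have := seminorm_nbhs x crho e0; apply: filterS => z /= xz rz.
  by split => //; rewrite seminormBC.
have [|v vN] := @cV (L0 @ N) (fmap_proper_filter _ NP).
  move=> U /nbhs_seminormP[r [cr rU]]; have [rho crho Lr] := L0_bound cr.
  (* Two tensors within 1/2 of x differ by less than 1. *)
  exists (L0 @` [set z | range ts z /\ rho (x - z) < 2^-1]).
    by apply: filterS (N_near rho 2^-1 crho _); [move=> z hz; exists z|rewrite invr_gt0].
  move=> _ _ [z [rz zx] <-] [z' [rz' zx'] <-]; apply: rU; rewrite subr0 -L0B//.
  apply: le_lt_trans (Lr _ (rangeB rz rz')) _.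
  apply: le_lt_trans (seminorm_tri crho x _ _) _.
  by rewrite (seminormBC crho z); lra.
exists v => r rho e cr crho e0.
have h1 : N [set z | r (L0 z - v) < e] by exact: vN (seminorm_nbhs v cr e0).
have [z [/= h2 [rz h3]]] := filter_ex (filterI h1 (N_near rho e crho e0)).
by exists z; split => //; rewrite seminormBC.
Qed.

Lemma proj_tensor_extend : exists L : {linear P -> V},
  continuous L /\ forall x y, L (t x y) = b x y.
Proof.
have /choice[L hL] := limit.
(* This estimate gives everything: linearity by approximating x and y, continuity with z = 0, and
   the value on elementary tensors with x = z. *)
have key (r : V -> R) : continuous_seminorm r -> exists2 rho : P -> R, continuous_seminorm rho &
    forall x z, range ts z -> r (L x - L0 z) <= rho (x - z).
  move=> cr; have [rho crho Lr] := L0_bound cr; exists rho => // x z rz.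
  apply/ler_addgt0Pr => e e0; have e2 : 0 < e / 2 by rewrite divr_gt0.
  have [z' [rz' h1 h2]] := hL x r rho (e / 2) cr crho e2.
  apply: le_trans (seminorm_tri cr (L0 z') _ _) _; rewrite -L0B//.
  have := Lr _ (rangeB rz' rz); have := seminorm_tri crho x z' z.
  by rewrite (seminormBC crho z' x); lra.
have Ll : linear L.
  move=> a x y; apply/eqP; rewrite -subr_eq0; apply/eqP; apply: hausdorff_seminorm => // r cr.
  have [rho crho Lrho] := key r cr.
  apply/le_anti; rewrite (seminorm_ge0 cr) andbT; apply/ler_addgt0Pr => e e0; rewrite add0r.
  (* The error |a| e/k + e/k arises twice, once for the limit at a x + y and once for the
     combination of limits; the total is e. *)
  pose k := 2 * (complex.Re `|a| + 1); have k0 : 0 < k by rewrite mulr_gt0// ltr_wpDl// Re_norm_ge0.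
  have ek : 0 < e / k by rewrite divr_gt0.
  have [z [rz xz]] := proj_tensor_approx x crho ek.
  have [w [rw yw]] := proj_tensor_approx y crho ek.
  have -> : L (a *: x + y) - (a *: L x + L y) =
     (L (a *: x + y) - L0 (a *: z + w)) - (a *: (L x - L0 z) + (L y - L0 w)).
    have -> : a *: (L x - L0 z) + (L y - L0 w) = a *: L x + L y - (a *: L0 z + L0 w).
      by rewrite scalerBr opprD addrACA.
    by rewrite L0_lin// opprB addrA subrK.
  apply: le_trans (seminormD cr _ _) _; rewrite (seminormN cr).
  have h1 := Lrho (a *: x + y) _ (range_lin a rz rw).
  have h2 := seminormD crho (a *: (x - z)) (y - w); rewrite (seminormZ crho) in h2.
  have e1 : a *: x + y - (a *: z + w) = a *: (x - z) + (y - w).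
    by rewrite scalerBr opprD addrACA.
  rewrite e1 in h1.
  have h3 := seminormD cr (a *: (L x - L0 z)) (L y - L0 w); rewrite (seminormZ cr) in h3.
  have h4 := Lrho x z rz; have h5 := Lrho y w rw.
  have h6 : complex.Re `|a| * rho (x - z) <= complex.Re `|a| * (e / k).
    by rewrite ler_wpM2l ?Re_norm_ge0// ltW.
  have h7 : complex.Re `|a| * r (L x - L0 z) <= complex.Re `|a| * (e / k).
    by rewrite ler_wpM2l ?Re_norm_ge0//; apply: le_trans h4 (ltW xz).
  have h8 : e = 2 * (complex.Re `|a| * (e / k) + e / k).
    by rewrite /k; field; rewrite gt_eqF// ltr_wpDl// Re_norm_ge0.
  rewrite h8; move: h1 h2 h3 h5 h6 h7 yw; lra.
pose LL : {linear P -> V} := HB.pack L (GRing.isLinear.Build R[i] P V *:%R L Ll).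
exists LL; split.
  apply: linear_continuous_seminorm => // r cr; have [rho crho Lrho] := key r cr.
  by exists rho => // x; have := Lrho x 0 range0; rewrite L00 !subr0.
move=> x y /=; apply/eqP; rewrite -subr_eq0; apply/eqP; apply: hausdorff_seminorm => // r cr.
have [rho crho Lrho] := key r cr; have := Lrho (t x y) _ (range_t x y).
rewrite subrr (seminorm0 crho) (_ : L0 (t x y) = b x y).
  by move=> h; apply/le_anti; rewrite h (seminorm_ge0 cr).
by have := L0_ts [:: (x, y)]; rewrite /ts /tensor_sum /bs !big_seq1.
Qed.
End Extension.
End ProjectiveTensorTheory.

(** * The Frechet-Hilbert algebra of tensors *)

Section HilbertTensorOperators.
Variables (R : realType) (H T : hilbertType R) (tT : H -> conj_space H -> T).
Variables (hT : is_hilbert_tensor tT) (Lam : T -> bop H) (hLam : is_Lambda tT Lam).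

(** [Lam 0] is Hilbert-Schmidt by the range clause, and that property carries a basis, so no appeal
    to Zorn's lemma is made. *)
Lemma onb_exists : exists E : set H, onb E.
Proof.
have [_ _ rL _] := hLam; have : range Lam (Lam 0) by exists 0.
by rewrite rL => -[E onbE _]; exists E.
Qed.

Lemma Lam_tensor u v w : Lam (tT u (to_conj v)) w = dot w v *: u.
Proof. by have [h _ _ _] := hLam; exact: h. Qed.

Lemma Lam_linear a z z' w : Lam (a *: z + z') w = a *: Lam z w + Lam z' w.
Proof. by have [_ h _ _] := hLam; exact: h. Qed.

Lemma trace_rank1 (A : bop H) (x y : H) (B : bop H) :
  (forall e, B e = dot e y *: x) -> trace (bop_comp A B) = dot (A x) y.
Proof.
move=> BE; have [E onbE] := onb_exists; apply: (trace_unique onbE) => {onbE}E onbE.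
rewrite (_ : (fun e => _) = (fun e => dot e y * dot (A x) e)); first exact: has_sum_onb.
by apply/funext => e /=; rewrite BE linearZ/= dotZl.
Qed.

(** The trace clause of [is_Lambda] for z' = y (x) x: the adjoint of [Lam z'] is the rank-one
    operator <., y> x, and [trace_rank1] evaluates the trace. *)
Lemma dot_Lam z x y : dot (Lam z x) y = dot z (tT y (to_conj x)).
Proof.
have [_ _ _ <-] := hLam; rewrite (@trace_rank1 _ x y)// => e.
rewrite (@adjointE _ _ _ (fun e => dot e y *: x))// => u v.
by rewrite Lam_tensor dotZl dotZr -dot_conj mulrC.
Qed.

Lemma rnorm_tensor u v : rnorm (tT u (to_conj v)) = rnorm u * rnorm v.
Proof.
apply/eqP; rewrite -(@eqrXn2 _ 2) ?mulr_ge0 ?rnorm_ge0// exprMn.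
have [_ h _] := hT; rewrite rnorm_sqr h [dot (to_conj v) _]dotxx dotxx.
by rewrite -rmorphM/=.
Qed.

Lemma Lam_le z x : rnorm (Lam z x) <= rnorm z * rnorm x.
Proof.
have [f0|f0] := eqVneq (rnorm (Lam z x)) 0; first by rewrite f0 mulr_ge0 ?rnorm_ge0.
have fp : 0 < rnorm (Lam z x) by rewrite lt_neqAle eq_sym f0 rnorm_ge0.
rewrite -(ler_pM2r fp) -expr2 rnorm_sqr dot_Lam; apply: le_trans (Re_dot_CS _ _) _.
by rewrite rnorm_tensor mulrA mulrAC.
Qed.

Lemma tensor_total z : (forall u v, dot z (tT u (to_conj v)) = 0) -> z = 0.
Proof.
move=> h; have [_ _ dT] := hT.
have cl : closed [set w : T | dot z w = (0 : R[i]^o)].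
  apply: (@continuous_eq_closed T R[i]^o (dot z) (cst 0)).
  - exact: norm_hausdorff.
  - exact: dotr_continuous.
  - by move=> ?; exact: cvg_cst.
apply: rnorm0_eq0; apply/eqP; rewrite -sqrf_eq0 rnorm_sqr.
suff /(closed_dense dT cl)/(_ z)/= -> : [set z | exists s : seq (H * conj_space H),
    z = \sum_(xy <- s) tT xy.1 xy.2] `<=` [set w | dot z w = 0] by [].
move=> _ [s ->] /=; rewrite dot_sumr big1// => -[u v] _; exact: h.
Qed.

Lemma Lam_inj z z' : (forall w, Lam z w = Lam z' w) -> z = z'.
Proof.
move=> h; apply/eqP; rewrite -subr_eq0; apply/eqP; apply: tensor_total => u v.
by rewrite dotBl -!dot_Lam h subrr.
Qed.
End HilbertTensorOperators.

Lemma seminorm_unconj (R : realType) (E : tvsType R[i]) (p : conj_space E -> R) :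
  continuous_seminorm p -> continuous_seminorm (p : E -> R).
Proof.
move=> cp; split => [x y|a x|].
- exact: (seminormD cp).
- rewrite -[a]conjCK -[LHS]/(p (a^* *: (to_conj x))) (seminormZ cp).
  by rewrite norm_conjC conjCK.
- exact: (seminorm_cont cp).
Qed.

Section TensorAlgebra.
Variables (R : realType) (H T : hilbertType R) (tT : H -> conj_space H -> T).
Variables (hT : is_hilbert_tensor tT) (Lam : T -> bop H) (hLam : is_Lambda tT Lam).
Variables (G : tvsType R[i]) (j : {linear G -> H}) (j_cont : continuous j).
Variables (P : tvsType R[i]) (tP : G -> conj_space G -> P).
Hypothesis hP : is_projective_tensor tP.
Variables (iota : {linear P -> T}) (iota_cont : continuous iota).
Hypothesis iota_tensor : forall u v : G,
  iota (tP u (to_conj v)) = tT (j u) (to_conj (j v)).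
Hypothesis iota_inj : injective iota.

Let hausP : hausdorff_space P. Proof. by have [_ _ _ []] := hP. Qed.
Let complP : tvs_complete P. Proof. by have [_ _ _ []] := hP. Qed.

Definition tensor_op (z : P) : bop H := Lam (iota z).

Lemma tensor_op_tensor u v w : tensor_op (tP u (to_conj v)) w = dot w (j v) *: j u.
Proof. by rewrite /tensor_op iota_tensor (Lam_tensor hLam). Qed.

Lemma tensor_op_linear a z z' w :
  tensor_op (a *: z + z') w = a *: tensor_op z w + tensor_op z' w.
Proof. by rewrite /tensor_op linearP (Lam_linear hLam). Qed.

Lemma tensor_opD z z' w : tensor_op (z + z') w = tensor_op z w + tensor_op z' w.
Proof. by rewrite -{1}[z]scale1r tensor_op_linear scale1r. Qed.

Lemma tensor_op0 w : tensor_op 0 w = 0.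
Proof.
have := tensor_op_linear (-1) 0 0 w.
by rewrite scaler0 addr0 scaleN1r addNr.
Qed.

Lemma tensor_opZ a z w : tensor_op (a *: z) w = a *: tensor_op z w.
Proof. by rewrite -[a *: z]addr0 tensor_op_linear tensor_op0 addr0. Qed.

Lemma tensor_op_continuous w : continuous (fun z => tensor_op z w).
Proof.
apply: linear_continuous_seminorm; first by move=> a z z'; exact: tensor_op_linear.
move=> q cq; have cq' : continuous (q : H -> R) by exact: (seminorm_cont cq).
pose f : T -> H := fun z => Lam z w.
have fl : linear f by move=> a z z'; exact: (Lam_linear hLam).
pose ff : {linear T -> H} := HB.pack f (GRing.isLinear.Build R[i] T H *:%R f fl).
have cf : continuous ff.
  by apply: (@rnorm_linear_continuous _ _ _ ff (rnorm w)) => z; rewrite mulrC; exact: (Lam_le hT hLam).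
have lfi : linear (fun z => ff (iota z)) by move=> a z z'; rewrite !linearP.
exists (q \o (fun z => ff (iota z))) => //.
apply: seminorm_comp => //; exact: continuous_fun_comp.
Qed.

Lemma tensor_op_inj z z' : (forall w, tensor_op z w = tensor_op z' w) -> z = z'.
Proof. by move=> h; apply: iota_inj; exact: (Lam_inj hT hLam). Qed.

Definition jnorm (u : G) : R := rnorm (j u).

Lemma jnorm_seminorm : continuous_seminorm jnorm.
Proof. by apply: (seminorm_comp (linearP j) j_cont); exact: rnorm_seminorm. Qed.

Let jnormc : continuous_seminorm (jnorm : conj_space G -> R).
Proof. exact/seminorm_conj/jnorm_seminorm. Qed.

Let bP : bilinear_map tP. Proof. by case: hP. Qed.

Let tP_conjr u a v v' : tP u (to_conj (a *: v + v')) = a^* *: tP u (to_conj v) + tP u (to_conj v').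
Proof. by rewrite -bP.2 conj_scaleE conjCK. Qed.

(* Right multiplication by the rank-one operator <., v'> x. *)
Let rank1_mul_exists (x : H) (v' : conj_space G) : exists L : {linear P -> P},
  continuous L /\ forall u v, L (tP u v) = dot x (j v) *: tP u v'.
Proof.
apply: (proj_tensor_extend hP hausP complP (b := fun u v => dot x (j v) *: tP u v')).
  split=> [v a u u'|u a v w].
    by rewrite bP.1 scalerDr !scalerA mulrC.
  rewrite -[j _]/(j (a^* *: (v : G) + (w : G))) linearP dotDr dotZr conjCK.
  by rewrite scalerDl scalerA.
move=> r cr; have [p [q [cp cq rpq]]] := proj_tensor_factor hP cr.
exists p, (fun v => (rnorm x * q v') * jnorm v); split => //.
  by apply: seminorm_scale => //; rewrite mulr_ge0 ?rnorm_ge0// (seminorm_ge0 cq).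
move=> u v; rewrite (seminormZ cr).
apply: (@le_trans _ _ ((rnorm x * jnorm v) * (p u * q v'))); last by rewrite le_eqVlt; apply/orP; left; apply/eqP; ring.
by apply: ler_pM => //; rewrite ?Re_norm_ge0 ?(seminorm_ge0 cr)//; exact: dot_CS.
Qed.

(** The last clause determines the product, as tensors are determined by their operators. The first
    application of the extension gives z |-> (z x) (x) v' for x in H; the second extends its value
    in (u', v') with z fixed. *)
Lemma proj_mul_exists (z : P) : exists L : {linear P -> P}, [/\ continuous L,
  forall u v u' v', z = tP u (to_conj v) ->
    L (tP u' (to_conj v')) = dot (j u') (j v) *: tP u (to_conj v') &
  forall y w, tensor_op (L y) w = tensor_op z (tensor_op y w)].
Proof.
have /choice[L hL] : forall xv : H * conj_space G, exists L : {linear P -> P},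
  continuous L /\ forall u v, L (tP u v) = dot xv.1 (j v) *: tP u xv.2.
  by move=> [x v']; exact: rank1_mul_exists.
have Lc xv : continuous (L xv) by case: (hL xv).
have Lt xv u v : L xv (tP u v) = dot xv.1 (j v) *: tP u xv.2 by case: (hL xv).
have Lop xv y w : tensor_op (L xv y) w = dot w (j xv.2) *: tensor_op y xv.1.
  apply: (@proj_tensor_eq _ _ _ _ _ hP H (fun y => tensor_op (L xv y) w) (fun y => dot w (j xv.2) *: tensor_op y xv.1)).
  + exact: norm_hausdorff.
  + exact: continuous_fun_comp (Lc xv) (@tensor_op_continuous w).
  + exact: continuous_fun_comp (@tensor_op_continuous xv.1) (@scale_continuous_fun _ _ _).
  + by rewrite linear0 !tensor_op0 scaler0.
  + by move=> y1 y2 e1 e2; rewrite linearD !tensor_opD e1 e2 scalerDr.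
  + move=> u v; rewrite Lt tensor_opZ (tensor_op_tensor u xv.2) (tensor_op_tensor u v).
    by rewrite !scalerA mulrC.
have [|r cr|M [cM Mt]] := proj_tensor_extend hP hausP complP (b := fun u v => L (j u, v) z).
- split=> [v a u u'|u a v v'].
    (* [L] was chosen separately for each pair, so linearity in the pair is read off the operators,
       which [Lop] computes. *)
    apply: tensor_op_inj => w; rewrite tensor_op_linear !Lop/= linearP/=.
    by rewrite linearP/= scalerDr !scalerA mulrC.
  apply: tensor_op_inj => w; rewrite tensor_op_linear !Lop/=.
  rewrite -[j _]/(j (a^* *: (v : G) + (v' : G))) linearP dotDr dotZr conjCK.
  by rewrite scalerDl scalerA.
- have [p [q [cp cq rpq]]] := proj_tensor_factor hP cr.
  (* On z = u (x) v, Cauchy-Schwarz splits <j u', j v> into a factor for u' and the factor |j v|,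
     which joins p u; hence the projective norm of p and [jnorm]. *)
  pose k := proj_norm tP p (jnorm : conj_space G -> R) z.
  have k0 : 0 <= k by apply: seminorm_ge0; exact: proj_norm_seminorm.
  exists (fun u => k * jnorm u), q; split => //.
    by apply: seminorm_scale => //; exact: jnorm_seminorm.
  move=> u' v'; rewrite -mulrA mulrC.
  apply: (proj_norm_max hP cp jnormc (r := r \o L (j u', v'))).
  + by rewrite mulr_ge0 ?rnorm_ge0// (seminorm_ge0 cq).
  + exact: (seminorm_comp (linearP (L (j u', v'))) (Lc _) cr).
  + move=> u v /=; rewrite Lt (seminormZ cr)/=.
    apply: (@le_trans _ _ ((jnorm u' * jnorm v) * (p u * q v'))); last by rewrite le_eqVlt; apply/orP; left; apply/eqP; ring.
    by apply: ler_pM => //; rewrite ?Re_norm_ge0 ?(seminorm_ge0 cr)//; exact: dot_CS.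
- exists M; split => //.
    by move=> u v u' v' zE; rewrite Mt zE; exact: Lt.
  move=> y w.
  apply: (@proj_tensor_eq _ _ _ _ _ hP H (fun y => tensor_op (M y) w) (fun y => tensor_op z (tensor_op y w))).
  + exact: norm_hausdorff.
  + exact: continuous_fun_comp cM (@tensor_op_continuous w).
  + exact: continuous_fun_comp (@tensor_op_continuous w) (@bop_continuous _ _ (tensor_op z)).
  + by rewrite linear0 !tensor_op0 linear0.
  + by move=> y1 y2 e1 e2; rewrite linearD !tensor_opD e1 e2 linearD.
  + by move=> u v; rewrite Mt Lop (tensor_op_tensor u v) linearZ.
Qed.

(** An antilinear map into P is a linear map into the conjugate space of P, so the extension
    applies; the flip of the factors exchanges p and q. *)
Lemma proj_star_exists : exists S : P -> P, [/\ continuous S,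
  forall u v, S (tP u (to_conj v)) = tP v (to_conj u),
  forall a z z', S (a *: z + z') = a^* *: S z + S z' &
  forall z w w', dot (tensor_op (S z) w) w' = dot w (tensor_op z w')].
Proof.
have [|r cr|M [cM Mt]] := @proj_tensor_extend _ _ _ _ _ hP (conj_space P) hausP complP
    (fun u v => to_conj (tP (v : G) (to_conj u))).
- split=> [v a u u'|u a v v'].
    by rewrite [LHS](tP_conjr (v : G) a u u') conj_scaleE.
  by rewrite [LHS](bP.1 (to_conj u) a^* (v : G) (v' : G)) conj_scaleE.
- have [p [q [cp cq rpq]]] := proj_tensor_factor hP (seminorm_unconj cr).
  exists (q : G -> R), (p : conj_space G -> R).
  split; [exact: seminorm_unconj|exact: seminorm_conj|].
  by move=> u v; rewrite mulrC; exact: rpq.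
- pose S : P -> P := M.
  have St u v : S (tP u (to_conj v)) = tP v (to_conj u) by exact: Mt.
  have cS : continuous S by exact: cM.
  have Sl a z z' : S (a *: z + z') = a^* *: S z + S z' by exact: (linearP M a z z').
  exists S; split => // z w w'.
  have S0 : S 0 = 0 by have := Sl (-1) 0 0; rewrite scaler0 addr0 rmorphN1 scaleN1r addNr.
  have SD x y : S (x + y) = S x + S y by have := Sl 1 x y; rewrite rmorph1 !scale1r.
  apply: (@proj_tensor_eq _ _ _ _ _ hP R[i]^o (fun z => dot (tensor_op (S z) w) w')
    (fun z => dot w (tensor_op z w'))).
  + exact: norm_hausdorff.
  + exact: continuous_fun_comp (continuous_fun_comp cS (@tensor_op_continuous w)) (@dotl_continuous _ _ _).
  + exact: continuous_fun_comp (@tensor_op_continuous w') (@dotr_continuous _ _ _).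
  + by rewrite S0 !tensor_op0 dot0l dot0r.
  + by move=> x y e1 e2; rewrite SD !tensor_opD dotDl dotDr e1 e2.
  + move=> u v; rewrite (St u v) (tensor_op_tensor u v) (tensor_op_tensor (v : G) u).
    by rewrite dotZl dotZr -dot_conj mulrC.
Qed.

Lemma tensor_op_dot z u v :
  dot (tensor_op z (j v)) (j u) = dot (iota z) (iota (tP u (to_conj v))).
Proof. by rewrite /tensor_op (dot_Lam hLam) iota_tensor. Qed.

Definition tensor_dot (x y : P) : R[i] := dot (iota x) (iota y).

Lemma tensor_dotxx z : tensor_dot z z = ((rnorm (iota z) ^+ 2)%:C)%C.
Proof. exact: dotxx. Qed.

Lemma tensor_ip_nbhsP x (U : set P) : ip_nbhs tensor_dot x U <->
  exists2 k : R, 0 < k & forall y, rnorm (iota (y - x)) < k -> U y.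
Proof.
have h (k : R) z : 0 < k -> (tensor_dot z z < (k%:C)%C ^+ 2) = (rnorm (iota z) < k).
  by move=> k0; rewrite tensor_dotxx -rmorphXn/= ltcR ltr_pXn2r// nnegrE ?rnorm_ge0// ltW.
split=> [[e e0 eU]|[k k0 kU]].
  have /complex_realP[k ke] := gtr0_real e0; rewrite {}ke ltcR in e0 eU.
  by exists k => // y; rewrite -h// => /eU.
by exists (k%:C)%C; rewrite ?ltcR// => y; rewrite h// => /kU.
Qed.

Lemma proj_frechet : frechet_space G -> frechet_space P.
Proof.
move=> [_ [V [nV bV]] _]; split => //.
have /choice[p hp] : forall n, exists p, continuous_seminorm p /\ forall y, p y < 1 -> V n y.
  move=> n; have /nbhs_seminormP[p [cp pV]] := nV n.
  by exists p; split => // y; have := pV y; rewrite subr0.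
have cp n : continuous_seminorm (p n) by case: (hp n).
have p_le (q : G -> R) : continuous_seminorm q -> exists n, forall u, q u <= p n u.
  move=> cq; have [n Vq] : exists n, V n `<=` [set u | q u < 1].
    by apply: bV; have := seminorm_nbhs 0 cq ltr01; apply: filterS => u; rewrite /= subr0.
  exists n; apply: homogeneous_le; [exact: seminorm_homogeneous|exact: seminorm_homogeneous|exact: seminorm_ge0|].
  by move=> u pu; apply/ltW/Vq; apply: (hp n).2.
(* Pairs of indices are enumerated by [pickle]; a number that codes no pair gets the whole space. *)
pose W (n : nat) : set P := if @unpickle (nat * nat)%type n is Some nm then
  [set z | proj_norm tP (p nm.1) (p nm.2 : conj_space G -> R) z < 1] else setT.
exists W; split=> [n|U nU].
  rewrite /W; case: unpickle => [[n1 n2]|]; last exact: filterT.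
  have := seminorm_nbhs 0 (proj_norm_seminorm hP (cp n1) (seminorm_conj (cp n2))) ltr01.
  by apply: filterS => u; rewrite /= subr0.
have /nbhs_seminormP[r [cr rU]] := nU.
have [q1 [q2 [cq1 cq2 rq]]] := proj_tensor_factor hP cr.
have [n1 hn1] := p_le _ cq1; have [n2 hn2] := p_le _ (seminorm_unconj cq2).
exists (pickle (n1, n2)); rewrite /W pickleK => z /= hz; apply: rU; rewrite subr0.
apply: le_lt_trans hz; rewrite -[leRHS]mul1r.
apply: (proj_norm_max hP (cp n1) (seminorm_conj (cp n2))) => // u v.
rewrite mul1r; apply: le_trans (rq u v) _; apply: ler_pM; [exact: seminorm_ge0|exact: seminorm_ge0|exact: hn1|exact: hn2].
Qed.

(** * Axioms of a Fréchet-Hilbert algebra for the product and involution *)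

Section Algebra.
Hypothesis j_inj : injective j.
Variables (mul : P -> P -> P) (star : P -> P).
Hypothesis mul_linear : forall z, linear (mul z).
Hypothesis mul_cont : forall z, continuous (mul z).
Hypothesis op_mul : forall x y w, tensor_op (mul x y) w = tensor_op x (tensor_op y w).
Hypothesis star_cont : continuous star.
Hypothesis star_linear : forall a z z', star (a *: z + z') = a^* *: star z + star z'.
Hypothesis star_tensor : forall u v, star (tP u (to_conj v)) = tP v (to_conj u).
Hypothesis op_star : forall z w w', dot (tensor_op (star z) w) w' = dot w (tensor_op z w').

Let op_star' z w w' : dot w (tensor_op (star z) w') = dot (tensor_op z w) w'.
Proof. by rewrite dot_conj op_star -dot_conj. Qed.

Lemma tensor_star_algebra : star_algebra mul star.
Proof.
split.
- split=> [y a x x'|x a y y']; last exact: mul_linear.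
  by apply: tensor_op_inj => w; rewrite tensor_op_linear !op_mul tensor_op_linear.
- by move=> x y z; apply: tensor_op_inj => w; rewrite !op_mul.
- exact: star_linear.
- by move=> x; apply: tensor_op_inj => w; apply: dotI => v; rewrite op_star' op_star.
- move=> x y; apply: tensor_op_inj => w; apply: dotI => v.
  by rewrite op_star' !op_mul !op_star'.
Qed.

Let starM x y : star (mul x y) = mul (star y) (star x).
Proof. by have [_ _ _ _ h] := tensor_star_algebra; exact: h. Qed.

Let starK x : star (star x) = x.
Proof. by have [_ _ _ h _] := tensor_star_algebra; exact: h. Qed.

(** Right multiplication is left multiplication conjugated by the continuous involution. *)
Lemma mul_cont_l y : continuous (mul^~ y).
Proof.
rewrite (_ : mul^~ y = fun x => star (mul (star y) (star x))).
  exact: continuous_fun_comp (continuous_fun_comp star_cont (@mul_cont (star y))) star_cont.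
by apply/funext => x; rewrite starM !starK.
Qed.

Let star0 : star 0 = 0.
Proof. by have := star_linear (-1) 0 0; rewrite scaler0 addr0 rmorphN1 scaleN1r addNr. Qed.

Let starD x y : star (x + y) = star x + star y.
Proof. by have := star_linear 1 x y; rewrite rmorph1 !scale1r. Qed.

Let mulD z x y : mul z (x + y) = mul z x + mul z y.
Proof. by rewrite -{1}[x]scale1r mul_linear scale1r. Qed.

Let mulB z x y : mul z (x - y) = mul z x - mul z y.
Proof. by rewrite addrC -scaleN1r mul_linear scaleN1r addrC. Qed.

Let mul0 z : mul z 0 = 0.
Proof. by have := mul_linear z (-1) 0 0; rewrite scaler0 addr0 scaleN1r addNr. Qed.

Lemma tensor_dot_star f g : tensor_dot (star g) (star f) = tensor_dot f g.
Proof.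
apply: (@proj_tensor_eq _ _ _ _ _ hP R[i]^o (fun f => tensor_dot (star g) (star f))
    (fun f => tensor_dot f g)).
- exact: norm_hausdorff.
- exact: continuous_fun_comp (continuous_fun_comp star_cont iota_cont) (@dotr_continuous _ _ _).
- exact: continuous_fun_comp iota_cont (@dotl_continuous _ _ _).
- by rewrite /tensor_dot star0 linear0 dot0l dot0r.
- by move=> x y; rewrite /tensor_dot starD !linearD dotDl dotDr => -> ->.
- move=> u v; rewrite (star_tensor u v) /tensor_dot -tensor_op_dot op_star.
  by rewrite dot_conj tensor_op_dot -dot_conj.
Qed.

Let iota_mul_tensor f u v :
  iota (mul f (tP u (to_conj v))) = tT (tensor_op f (j u)) (to_conj (j v)).
Proof.
apply: (Lam_inj hT hLam) => w; rewrite -/(tensor_op _) op_mul (tensor_op_tensor u v).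
by rewrite (Lam_tensor hLam) linearZ.
Qed.

Let iota_tensor_mul f u v :
  iota (mul (tP u (to_conj v)) f) = tT (j u) (to_conj (tensor_op (star f) (j v))).
Proof.
apply: (Lam_inj hT hLam) => w; rewrite -/(tensor_op _) op_mul (tensor_op_tensor u v).
by rewrite (Lam_tensor hLam) op_star'.
Qed.

Lemma tensor_dot_mul f g h :
  tensor_dot (mul f g) h = tensor_dot g (mul (star f) h).
Proof.
apply: (@proj_tensor_eq _ _ _ _ _ hP R[i]^o (fun h => tensor_dot (mul f g) h)
    (fun h => tensor_dot g (mul (star f) h))).
- exact: norm_hausdorff.
- exact: continuous_fun_comp iota_cont (@dotr_continuous _ _ _).
- exact: continuous_fun_comp (continuous_fun_comp (@mul_cont _) iota_cont) (@dotr_continuous _ _ _).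
- by rewrite /tensor_dot mul0 linear0 !dot0r.
- by move=> x y; rewrite /tensor_dot mulD !linearD !dotDr => -> ->.
- move=> u v; rewrite /tensor_dot -tensor_op_dot op_mul iota_mul_tensor.
  by rewrite -(dot_Lam hLam) op_star'.
Qed.

(** For g = u (x) v, the product g f is u (x) f* v, of norm at most |u| |v| |f|, since the
    involution preserves the Hilbert norm; [proj_norm_max] then reaches all g. *)
Lemma tensor_mul_bound g : exists2 c : R, 0 <= c &
  forall f, rnorm (iota (mul g f)) <= c * rnorm (iota f).
Proof.
have cn := proj_norm_seminorm hP jnorm_seminorm jnormc.
exists (proj_norm tP jnorm (jnorm : conj_space G -> R) g); first exact: seminorm_ge0.
move=> f; rewrite mulrC; apply: (proj_norm_max hP jnorm_seminorm jnormc (r := fun g => rnorm (iota (mul g f)))).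
- exact: rnorm_ge0.
- apply: (@seminorm_comp _ _ _ (fun g => iota (mul g f)) (@rnorm R T)).
  + move=> a x y; rewrite (_ : mul _ f = a *: mul x f + mul y f) ?linearP//.
    by have [[h _] _ _ _ _] := tensor_star_algebra; exact: h.
  + exact: continuous_fun_comp (@mul_cont_l f) iota_cont.
  + exact: rnorm_seminorm.
- move=> u v; rewrite (iota_tensor_mul f u (v : G)) (rnorm_tensor hT).
  rewrite [X in _ <= X](_ : _ = jnorm u * (rnorm (iota f) * jnorm v)); last by ring.
  rewrite ler_wpM2l ?rnorm_ge0//.
  apply: le_trans (Lam_le hT hLam _ _) _.
  rewrite ler_wpM2r ?rnorm_ge0//.
  by rewrite -(@ler_pXn2r _ 2)// ?nnegrE ?rnorm_ge0// !rnorm_sqr -![dot _ _]/(tensor_dot _ _) tensor_dot_star.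
Qed.

Lemma tensor_frechet_hilbert_algebra : frechet_space G ->
  frechet_hilbert_algebra mul star tensor_dot.
Proof.
move=> hG; have cr : continuous_seminorm (@rnorm R T \o iota).
  by apply: seminorm_comp; [exact: linearP|exact: iota_cont|exact: rnorm_seminorm].
split; first split => //.
- exact: proj_frechet.
- exact: tensor_star_algebra.
- exact: mul_cont_l.
- split.
  + exact: tensor_star_algebra.
  + split.
    * by move=> a x y z; rewrite /tensor_dot linearP dot_linearl.
    * by move=> x y; rewrite /tensor_dot dot_conj.
    * by move=> x; rewrite tensor_dotxx ler0c sqr_ge0.
    * move=> x; rewrite tensor_dotxx => /complexI/eqP; rewrite sqrf_eq0 => /eqP/rnorm0_eq0.
      by rewrite -(linear0 iota) => /iota_inj.
  + by split; [exact: tensor_dot_star|exact: tensor_dot_mul].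
  + move=> g f U /tensor_ip_nbhsP[k k0 kU]; apply/tensor_ip_nbhsP.
    have [c c0 hc] := tensor_mul_bound g.
    have c1 : 0 < c + 1 by rewrite ltr_wpDl.
    exists (k / (c + 1)); first by rewrite divr_gt0.
    move=> y; rewrite ltr_pdivlMr// => hy; apply: kU.
    rewrite -mulB; apply: le_lt_trans hy; apply: le_trans (hc _) _.
    by rewrite mulrC ler_wpM2l ?rnorm_ge0// lerDl.
  + move=> f U /tensor_ip_nbhsP[k k0 kU].
    have [_ [[s _ <-] fs]] := proj_tensor_approx hP f cr k0.
    (* u (x) v is the product of <u, u>^-1 u (x) u with u (x) v, and both vanish if u = 0; so every
       algebraic tensor is a sum of products. *)
    exists [seq (((dot (j xy.1) (j xy.1))^-1 *: tP xy.1 (to_conj xy.1)), tP xy.1 xy.2) | xy <- s].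
    apply: kU; rewrite -rnormN -linearN opprB big_map.
    rewrite (_ : \sum_(xy <- s) _ = tensor_sum tP s)//; apply: eq_bigr => -[u v] _ /=.
    apply: tensor_op_inj => w; rewrite op_mul tensor_opZ (tensor_op_tensor u u) (tensor_op_tensor u v).
    have [->|u0] := eqVneq u 0; first by rewrite linear0 !scaler0.
    rewrite dotZl scalerA [in LHS]mulrC mulfK//.
    rewrite dotxx -(rmorph0 (real_complex R)) (inj_eq (@complexI _)) sqrf_eq0.
    by apply: contra u0 => /eqP/rnorm0_eq0/eqP; rewrite -(linear0 j) (inj_eq j_inj).
- by move=> x U /tensor_ip_nbhsP[k k0 kU]; apply: filterS kU _; exact: (seminorm_nbhs x cr k0).
Qed.
End Algebra.
End TensorAlgebra.

(** * Trace-class symbols and the trace pairing *)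

Section HasSum.
Variables (R : realType) (I : choiceType) (D : set I).
Implicit Types a b : I -> R[i].

Lemma has_sum0 : has_sum D (fun=> 0 : R[i]) 0.
Proof.
move=> e e0; exists set0; first by split.
by move=> B _ _; rewrite fsbig1 ?subrr ?normr0.
Qed.

Lemma has_sumD a b s t : has_sum D a s -> has_sum D b t ->
  has_sum D (fun i => a i + b i) (s + t).
Proof.
move=> ha hb e e0; have e2 : 0 < e / 2 by rewrite divr_gt0.
have [A [fA AD] hA] := ha _ e2; have [B [fB BD] hB] := hb _ e2.
exists (A `|` B); first by split; [rewrite finite_setU|rewrite subUset].
move=> C DC; rewrite subUset => -[AC BC]; have [l [_ _ lC]] := fsets_seq DC.1.
have := hA C DC AC; have := hB C DC BC; rewrite !lC big_split/= => h1 h2.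
by rewrite opprD addrACA [e]splitr; apply: le_lt_trans (ler_normD _ _) _; exact: ltrD.
Qed.
End HasSum.

Lemma scalar_complete (R : realType) : tvs_complete R[i]^o.
Proof.
move=> F PF cF.
have ex (h : R[i] -> R) : (forall x y, h (x - y) = h x - h y) ->
    (forall x, `|h x| <= complex.Re `|x|) -> exists c : R, h @ F --> c.
  move=> hB hle; apply/cvg_ex; apply: cauchy_cvg; apply: cauchy_exP => e e0.
  have nU : nbhs (0 : R[i]^o) [set y : R[i]^o | rnorm y < e].
    by apply/nbhs_rnormP; exists e => // y; rewrite subr0.
  have [A FA hA] := cF _ nU; have [x Ax] := filter_ex FA.
  exists (h x); suff : F [set y | ball (h x) e (h y)] by [].
  apply: filterS FA => y Ay; rewrite /= -ball_normE /= -hB.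
  by apply: le_lt_trans (hle _) _; exact: hA.
have [||c hc] := ex (@complex.Re R).
- by move=> [? ?] [? ?].
- exact: abs_Re_le.
have [||c' hc'] := ex (@complex.Im R).
- by move=> [? ?] [? ?].
- by move=> x; rewrite normc_def/= -sqrtr_sqr ler_wsqrtr// lerDr sqr_ge0.
exists (c +i* c')%C => U /nbhs_rnormP[e e0 eU].
have e2 : 0 < e / 2 by rewrite divr_gt0.
have h1 : F [set y | `|c - complex.Re y| < e / 2] by exact: (proj1 (cvgrPdist_lt _ _) hc _ e2).
have h2 : F [set y | `|c' - complex.Im y| < e / 2] by exact: (proj1 (cvgrPdist_lt _ _) hc' _ e2).
apply: filterS (filterI h1 h2) => -[y y'] [/= h3 h4]; apply: eU.
rewrite [e]splitr; apply: le_lt_trans (ltrD h3 h4).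
have -> : ((y +i* y')%C - (c +i* c')%C : R[i]) = ((y - c)%:C)%C + 'i%C * ((y' - c')%:C)%C.
  by apply/eqP; rewrite eq_complex/= !mul0r !mul1r; apply/andP; split; apply/eqP; ring.
apply: le_trans (@rnormD R R[i]^o _ _) _.
rewrite /rnorm Re_normM !Re_norm_real [`|c - y|]distrC [`|c' - y'|]distrC lerD2l.
by rewrite normc_def/= expr0n/= expr1n add0r sqrtr1 mul1r.
Qed.

(** * Trace-class property and trace pairing *)

Section TensorTrace.
Variables (R : realType) (H T : hilbertType R) (tT : H -> conj_space H -> T).
Variables (hT : is_hilbert_tensor tT) (Lam : T -> bop H) (hLam : is_Lambda tT Lam).
Variables (G : tvsType R[i]) (j : {linear G -> H}) (j_cont : continuous j).
Variables (P : tvsType R[i]) (tP : G -> conj_space G -> P).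
Hypothesis hP : is_projective_tensor tP.
Variables (iota : {linear P -> T}) (iota_cont : continuous iota).
Hypothesis iota_tensor : forall u v : G,
  iota (tP u (to_conj v)) = tT (j u) (to_conj (j v)).

Let op := tensor_op Lam iota.
Let rho := proj_norm tP (jnorm j) (jnorm j : conj_space G -> R).

Let cj : continuous_seminorm (jnorm j). Proof. exact: jnorm_seminorm. Qed.
Let cjc : continuous_seminorm (jnorm j : conj_space G -> R).
Proof. exact: seminorm_conj. Qed.

Let crho : continuous_seminorm rho. 
Proof.
exact (proj_norm_seminorm hP cj cjc).
Qed.

Let rho_max (f : P -> R[i]^o) (k : R) : 0 <= k -> linear f -> continuous f ->
  (forall u v, rnorm (f (tP u v)) <= k * (rnorm (j u) * rnorm (j v))) ->
  forall z, rnorm (f z) <= k * rho z.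
Proof.
move=> k0 fl cf fk z.
apply: (proj_norm_max hP cj cjc (r := @rnorm R R[i]^o \o f) k0) => //.
by apply: seminorm_comp => //; exact: rnorm_seminorm.
Qed.

(** One sum for two uses: [B] is the identity for the trace-class property, [W] for the trace
    pairing. *)
Let partial_trace (W B : bop H) (s : seq H) (z : P) : R[i]^o :=
  \sum_(e <- s) dot (W (op z (B e))) e.

Let partial_trace_linear W B s : linear (partial_trace W B s).
Proof.
move=> a z z'; rewrite /partial_trace scaler_sumr -big_split/=; apply: eq_bigr => e _.
by rewrite /op (tensor_op_linear hLam) linearP/= dot_linearl.
Qed.

Let partial_trace_continuous W B s : continuous (partial_trace W B s).
Proof.
elim: s => [|e s IH].
  rewrite (_ : partial_trace W B [::] = cst 0); first by move=> z; exact: cvg_cst.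
  by apply/funext => z; rewrite /partial_trace big_nil.
rewrite (_ : partial_trace W B (e :: s) =
    (fun z => dot (W (op z (B e))) e + partial_trace W B s z)); last first.
  by apply/funext => z; rewrite /partial_trace big_cons.
have c1 : continuous (fun z => W (op z (B e))).
  apply: (continuous_fun_comp _ (@bop_continuous R H W)).
  exact: (tensor_op_continuous hT hLam iota_cont).
by move=> z; apply: cvgD; [exact: (continuous_fun_comp c1 (@dotl_continuous R H e))|exact: IH].
Qed.

(** On u (x) v the sum collapses to the product of the projection of W u with the adjoint of B at v;
    a projection is a contraction, whence independence of s. *)
Let partial_trace_bound (W B : bop H) (s : seq H) (w b : R) (z : P) : 0 <= w -> 0 <= b ->
  (forall x, rnorm (W x) <= w * rnorm x) -> (forall x, rnorm (adjoint B x) <= b * rnorm x) ->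
  orthonormal_seq s -> rnorm (partial_trace W B s z) <= w * b * rho z.
Proof.
move=> w0 b0 Ww Bb os; apply: rho_max.
- by rewrite mulr_ge0.
- exact: partial_trace_linear.
- exact: partial_trace_continuous.
- move=> u v; rewrite (_ : partial_trace _ _ _ _ = dot (oproj s (W (j u))) (adjoint B (j v))).
    apply: le_trans (dot_CS _ _) _; rewrite mulrACA; apply: ler_pM; rewrite ?rnorm_ge0//.
    by apply: le_trans (oproj_le _ os) _.
  rewrite dot_oproj; apply: eq_bigr => e _.
  by rewrite /op (tensor_op_tensor hLam iota_tensor u v) linearZ/= dotZl adjointP mulrC.
Qed.

Let idb : exists I : bop H, forall x, I x = x.
Proof.
by apply: (@bop_of_bounded _ _ id 1) => [a x y|x] //; rewrite mul1r.
Qed.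

Lemma tensor_trace_class z : trace_class (Lam (iota z)).
Proof.
have [E onbE] := onb_exists hLam; have [I IE] := idb.
apply: (trace_class_criterion (K := rho z) onbE) => W s W1 us sE.
have os := onb_orthonormal_seq onbE us sE.
rewrite (_ : \sum_(e <- s) _ = partial_trace W I s z); last first.
  by apply: eq_bigr => e _; rewrite IE.
apply: le_trans (ler_norm _) _; apply: le_trans (abs_Re_le _) _.
have := @partial_trace_bound W I s 1 1 z ler01 ler01; rewrite !mul1r; apply=> // x.
  by rewrite mul1r.
by rewrite mul1r (@adjointE _ _ I id)// => u v; rewrite IE.
Qed.

(* l extends u (x) v |-> <B u, v>; on elementary tensors it is the trace by Parseval,
   and the partial sums are bounded by the projective norm uniformly in the finite
   subset of the basis, so the set of z with trace l z is closed. *)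
Lemma tensor_trace (B : bop H) : exists l : P -> R[i]^o,
  [/\ linear l, continuous l, forall u v, l (tP u (to_conj v)) = dot (B (j u)) (j v) &
    forall z, trace (bop_comp (Lam (iota z)) B) = l z].
Proof.
have [b b0 Bb] := bop_bounded B; have [b' b'0 Bb'] := bop_bounded (adjoint B).
have [|r cr|l [cl lt]] := @proj_tensor_extend _ _ _ _ _ hP R[i]^o (@norm_hausdorff _ _)
    (@scalar_complete R) (fun u v => dot (B (j u)) (j v)).
- split=> [v a u u'|u a v v']; first by rewrite !linearP/= dot_linearl.
  by rewrite -[j (_ + _)]/(j (a^* *: (v : G) + (v' : G))) linearP dotDr dotZr conjCK.
(* A seminorm on the scalars is r 1 times the modulus. *)
- exists (fun u => r 1 * b * jnorm j u), (jnorm j : conj_space G -> R); split.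
  + apply: seminorm_scale; first by rewrite mulr_ge0// (seminorm_ge0 cr).
    exact: jnorm_seminorm.
  + exact/seminorm_conj/jnorm_seminorm.
  + move=> u v; rewrite -[dot _ _]mulr1 -[_ * 1]/(_ *: (1 : R[i]^o)) (seminormZ cr) mulrC -!mulrA.
    rewrite ler_wpM2l ?(seminorm_ge0 cr)// mulrA; apply: le_trans (dot_CS _ _) _.
    by apply: ler_wpM2r; [exact: rnorm_ge0|exact: Bb].
exists l; split => //; first exact: linearP.
move=> z; have [E onbE] := onb_exists hLam.
apply: (trace_unique onbE) => {onbE}E onbE; have [I IE] := idb.
have ps s z' : \sum_(e <- s) dot (bop_comp (Lam (iota z')) B e) e = partial_trace I B s z'.
  by apply: eq_bigr => e _; rewrite IE.
have lrho z' : rnorm (l z') <= b * rho z'.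
  apply: rho_max => //; first exact: linearP.
  move=> u v; rewrite lt mulrA; apply: le_trans (dot_CS _ _) _.
  by apply: ler_wpM2r; [exact: rnorm_ge0|exact: Bb].
apply: (proj_tensor_ind hP (Q := [set z | has_sum E (fun e => dot (bop_comp (Lam (iota z)) B e) e) (l z)])).
- move=> {}z clz e e0; have /complex_realP[k ke] := gtr0_real e0; rewrite {}ke ltcR in e0 *.
  (* Passing from z' to z costs at most b' rho (z' - z) in any partial sum and b rho (z' - z) in l;
     the other k/2 is the error at z'. *)
  have c0 : 0 < b' + b + 1 by rewrite ltr_wpDl// addr_ge0.
  have k2 : 0 < k / 2 by rewrite divr_gt0.
  have [z' [/= hz' zz']] := clz _ (seminorm_nbhs z crho (divr_gt0 k2 c0)).
  have k2C : 0 < ((k / 2)%:C)%C :> R[i] by rewrite ltcR.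
  have [A fA hA] := hz' _ k2C; exists A => // C fC AC.
  have [s [us sC hs]] := fsets_seq fC.1; have := hA C fC AC; rewrite !hs !ps.
  have os := onb_orthonormal_seq onbE us (fun e es => fC.2 _ ((sC e).2 es)).
  have nE (c : R[i]) : `|c| = ((rnorm (c : R[i]^o))%:C)%C by exact: (@normE R R[i]^o c).
  rewrite !nE !ltcR => h1.
  have h2 : rnorm (partial_trace I B s (z' - z)) <= b' * rho (z' - z).
    rewrite -[b']mul1r; apply: partial_trace_bound => // x.
    by rewrite IE mul1r.
  have h3 := lrho (z' - z).
  have psB : partial_trace I B s (z' - z) = partial_trace I B s z' - partial_trace I B s z.
    by rewrite addrC -scaleN1r partial_trace_linear scaleN1r addrC.
  rewrite psB in h2; rewrite linearB/= in h3.
  move: zz'; rewrite ltr_pdivlMr// => h4.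
  have h5 := rnormB (partial_trace I B s z' : R[i]^o) (partial_trace I B s z : R[i]^o).
  rewrite h5 in h2.
  have h6 := rnormD (partial_trace I B s z - partial_trace I B s z' : R[i]^o) (partial_trace I B s z' - l z').
  have h7 := rnormD (partial_trace I B s z - partial_trace I B s z' + (partial_trace I B s z' - l z') : R[i]^o) (l z' - l z).
  have e7 : partial_trace I B s z - partial_trace I B s z' + (partial_trace I B s z' - l z') + (l z' - l z) = partial_trace I B s z - l z.
    by rewrite !addrA !subrK.
  rewrite e7 in h7.
  have h8 := seminorm_ge0 crho (z' - z).
  have h9 : rho (z' - z) * (b' + b + 1) = b' * rho (z' - z) + b * rho (z' - z) + rho (z' - z) by ring.
  by rewrite h9 in h4; lra.
- rewrite /= (linear0 l) (_ : (fun e => _) = fun=> 0); first exact: has_sum0.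
  by apply/funext => e; rewrite [Lam _ _](tensor_op0 hLam iota (B e)) dot0l.
- move=> z1 z2 h1 h2 /=; rewrite (linearD l).
  rewrite (_ : (fun e => _) = fun e => dot (bop_comp (Lam (iota z1)) B e) e + dot (bop_comp (Lam (iota z2)) B e) e).
    exact: has_sumD.
  by apply/funext => e; rewrite -dotDl -[Lam (iota z1) (B e) + _](tensor_opD hLam iota z1 z2 (B e)).
- move=> u v /=; rewrite lt adjointP.
  rewrite (_ : (fun e => _) = fun e => dot e (adjoint B (j v)) * dot (j u) e); first exact: has_sum_onb.
  by apply/funext => e; rewrite iota_tensor (Lam_tensor hLam) dotZl adjointP.
Qed.

Lemma tensor_trace_inj (A B : bop H) : closure (range j) = setT ->
  (forall z, trace (bop_comp (Lam (iota z)) A) = trace (bop_comp (Lam (iota z)) B)) ->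
  A = B.
Proof.
move=> jd hAB; apply: bop_ext.
have [l [_ _ lA tA]] := tensor_trace A; have [m [_ _ mB tB]] := tensor_trace B.
have h u v : dot (A (j u)) (j v) = dot (B (j u)) (j v).
  by rewrite -lA -mB -tA -tB hAB.
have h' u w : dot (A (j u)) w = dot (B (j u)) w.
  have cl : closed [set w | dot (A (j u)) w = dot (B (j u)) w :> R[i]^o].
    apply: continuous_eq_closed; [exact: norm_hausdorff|exact: dotr_continuous|exact: dotr_continuous].
  by apply: (closed_dense jd cl) => _ [v _ <-]; exact: h.
have cl : closed [set x | A x = B x].
  by apply: continuous_eq_closed; [exact: norm_hausdorff|exact: bop_continuous|exact: bop_continuous].
by apply: (closed_dense jd cl) => _ [u _ <-] /=; exact: dotIl.
Qed.
End TensorTrace.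

(** * Transport to the symbol space *)

Section Transport.
Variables (R : realType) (U : tvsType R[i]) (V : lmodType R[i]) (f : inj_linear U V).
Variables (mul : U -> U -> U) (star : U -> U) (ip : U -> U -> R[i]).
Notation W := (im_space f).

Let inv : W -> U := @im_inv _ _ _ f.
Let elt : U -> W := @im_elt _ _ _ f.
Let invE (u : U) : inv (elt u) = u. Proof. exact: im_eltK. Qed.
Let eltE (w : W) : elt (inv w) = w. Proof. exact: im_invK. Qed.
Let inv_cont : continuous inv. Proof. exact: im_inv_continuous. Qed.
Let elt_cont : continuous elt. Proof. exact: im_elt_continuous. Qed.
Let inv_lin a x y : inv (a *: x + y) = a *: inv x + inv y. Proof. exact: im_inv_linear. Qed.
Let inv_inj : injective inv. Proof. exact: can_inj eltE. Qed.
Let invB x y : inv (x - y) = inv x - inv y. Proof. exact: raddfB. Qed.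
Let inv0 : inv 0 = 0. Proof. exact: raddf0. Qed.

Let nbhs0W A : nbhs (0 : U) A -> nbhs (0 : W) (inv @^-1` A).
Proof. by move=> nA; apply/im_nbhsP; exists A => //; rewrite -/inv inv0. Qed.

Lemma im_frechet_space : frechet_space U -> frechet_space (W : tvsType R[i]).
Proof.
move=> [hU [N [nN bN]] cU]; split.
- move=> x y xy; apply: inv_inj; apply: hU => A B nA nB.
  have [w [Aw Bw]] := xy _ _ (inv_cont nA) (inv_cont nB).
  by exists (inv w).
- exists (fun n => inv @^-1` (N n)); split=> [n|A].
    exact: nbhs0W.
  move=> /im_nbhsP[B]; rewrite -/inv inv0 => /bN[n nB] BA.
  by exists n => w /nB; exact: BA.
- move=> F PF cF; have [|u Fu] := cU (inv @ F) (fmap_proper_filter _ PF).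
    move=> A nA; have [|B FB hB] := cF (inv @^-1` A).
      exact: nbhs0W.
    exists (elt @^-1` B).
      by suff : F [set w | B (elt (inv w))] by []; apply: filterS FB => w; rewrite /= eltE.
    by move=> x y Bx By; have := hB _ _ Bx By; rewrite /= invB !invE.
  exists (elt u) => A /im_nbhsP[B]; rewrite im_eltK => nB BA.
  by apply: filterS BA _; exact: Fu.
Qed.

Let mulW : W -> W -> W := im_mul (f := f) mul.
Let starW : W -> W := im_star (f := f) star.
Let ipW (x y : W) : R[i] := ip (inv x) (inv y).

Let inv_mul x y : inv (mulW x y) = mul (inv x) (inv y). Proof. exact: invE. Qed.
Let inv_star x : inv (starW x) = star (inv x). Proof. exact: invE. Qed.

Let im_star_algebra : star_algebra mul star -> star_algebra mulW starW.
Proof.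
move=> [[ml mr] mA sl sK sM]; split.
- by split=> [y a x x'|x a y y']; apply: inv_inj; rewrite inv_lin !inv_mul inv_lin ?ml ?mr.
- by move=> x y z; apply: inv_inj; rewrite !inv_mul mA.
- by move=> a x y; apply: inv_inj; rewrite inv_lin !inv_star inv_lin sl.
- by move=> x; apply: inv_inj; rewrite !inv_star sK.
- by move=> x y; apply: inv_inj; rewrite inv_star !inv_mul !inv_star sM.
Qed.

Let im_ip_nbhs x (A : set W) : ip_nbhs ipW x A <-> ip_nbhs ip (inv x) (elt @^-1` A).
Proof.
split=> -[e e0 eA]; exists e => // y hy.
  by apply: eA; rewrite /ipW !invB !invE.
by rewrite -[y]eltE; apply: eA; rewrite -!invB.
Qed.

Lemma im_frechet_hilbert_algebra : frechet_hilbert_algebra mul star ip ->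
  frechet_hilbert_algebra mulW starW ipW.
Proof.
move=> [[fU saU cs cm cm'] [_ [ipl ipc ip0 ipd] [ips ipm] ipcont iptot] fine_].
split.
- split.
  + exact: im_frechet_space.
  + exact: im_star_algebra.
  + exact: continuous_fun_comp (continuous_fun_comp inv_cont cs) elt_cont.
  + by move=> x; exact: continuous_fun_comp (continuous_fun_comp inv_cont (cm (inv x))) elt_cont.
  + by move=> x; exact: continuous_fun_comp (continuous_fun_comp inv_cont (cm' (inv x))) elt_cont.
- split.
  + exact: im_star_algebra.
  + split => [a x y z|x y|x|x]; rewrite /ipW.
    * by rewrite inv_lin ipl.
    * exact: ipc.
    * exact: ip0.
    * by move/ipd => x0; apply: inv_inj; rewrite x0 inv0.
  + by split=> [x y|x y z]; rewrite /ipW ?inv_mul !inv_star ?inv_mul ?inv_star.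
  + move=> g h A /im_ip_nbhs; rewrite inv_mul => /ipcont hA; apply/im_ip_nbhs.
    move: hA => [e e0 hA]; exists e => // y /hA /=.
    by rewrite /mulW /im_mul -/(inv _) -/(inv _) invE.
  + move=> h A /im_ip_nbhs/iptot[s hs].
    exists [seq (elt gh.1, elt gh.2) | gh <- s].
    rewrite big_map (_ : \sum_(gh <- s) _ = elt (\sum_(gh <- s) mul gh.1 gh.2))//.
    rewrite /elt raddf_sum; apply: eq_bigr => gh _ /=.
    by rewrite /mulW /im_mul !im_eltK.
- by move=> x A /im_ip_nbhs/fine_ nA; apply/im_nbhsP; exists (elt @^-1` A) => // w; rewrite /= -/(inv _) eltE.
Qed.

Lemma im_frechet_hilbert_iso :
  frechet_hilbert_iso mul star ip mulW starW ipW elt.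
Proof.
split.
- split; first exact: im_elt_linear.
  by move=> x y; apply: inv_inj; rewrite inv_mul !invE.
- by move=> x; apply: inv_inj; rewrite inv_star !invE.
- by move=> x y; rewrite /ipW !invE.
- exact: elt_cont.
- by exists inv; split; [exact: invE|exact: eltE|exact: inv_cont].
Qed.
End Transport.

Section Density.
Variables (R : realType) (H T : hilbertType R) (tT : H -> conj_space H -> T).
Hypothesis hT : is_hilbert_tensor tT.
Variables (G : tvsType R[i]) (j : {linear G -> H}) (P : tvsType R[i]).
Variables (tP : G -> conj_space G -> P) (iota : {linear P -> T}).
Hypothesis j_dense : closure (range j) = setT.
Hypothesis iota_tensor : forall u v : G,
  iota (tP u (to_conj v)) = tT (j u) (to_conj (j v)).

(** The factors are freed one at a time, since x (x) y is continuous in each; sums follow because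
    the closure is stable under addition. *)
Lemma tensor_dense : closure (range iota) = setT.
Proof.
have [[tTl tTr] _ dT] := hT; pose M := closure (range iota).
have clM : closed M by exact: closed_closure.
have Tl v : continuous (fun u => tT u (to_conj v)).
  have l : linear (fun u => tT u (to_conj v)) by move=> a x y; exact: tTl.
  pose L : {linear H -> T} := HB.pack (fun u => tT u (to_conj v)) (GRing.isLinear.Build R[i] H T *:%R _ l).
  by apply: (@rnorm_linear_continuous _ _ _ L (rnorm v)) => u; rewrite /= (rnorm_tensor hT) mulrC.
have Tr u : continuous (fun v : conj_space H => tT u v).
  have l : linear (fun v : conj_space H => tT u v) by move=> a x y; exact: tTr.
  pose L : {linear conj_space H -> T} := HB.pack (fun v : conj_space H => tT u v) (GRing.isLinear.Build R[i] (conj_space H) T *:%R _ l).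
  by apply: (@rnorm_linear_continuous _ _ _ L (rnorm u)) => v; rewrite /= (rnorm_tensor hT u v).
have M1 u v : M (tT (j u) (to_conj (j v))).
  by rewrite -iota_tensor; apply: subset_closure; exists (tP u (to_conj v)).
have M2 u y : M (tT (j u) (to_conj y)).
  have cl : closed ((fun v : conj_space H => tT (j u) v) @^-1` M).
    by apply: closed_comp => // x _; exact: Tr.
  by apply: (closed_dense j_dense cl) => _ [v _ <-]; exact: M1.
have M3 x y : M (tT x (to_conj y)).
  have cl : closed ((fun u => tT u (to_conj y)) @^-1` M).
    by apply: closed_comp => // z _; exact: Tl.
  by apply: (closed_dense j_dense cl) => _ [u _ <-]; exact: M2.
have MD x y : M x -> M y -> M (x + y).
  move=> Mx My B nB.
  have /= [[C D] /= [nC nD] CDB] := @add_continuous T (x, y) B nB.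
  have [_ [[p _ <-] Cp]] := Mx _ nC; have [_ [[q _ <-] Dq]] := My _ nD.
  exists (iota (p + q)); split; first by exists (p + q).
  by rewrite linearD; exact: (CDB (iota p, iota q)).
apply/seteqP; split => // z _; apply: (closed_dense dT clM) => _ [s ->].
elim/big_ind : _ => //; last by move=> [u v] _; exact: M3.
by apply: subset_closure; exists 0; rewrite ?linear0.
Qed.
End Density.

Theorem theorem4p2 (R : realType) (H : hilbertType R)
  (d : measure_display) (S : measurableType d) (mu : {measure set S -> \bar R})
  (D : set S) (pi_ : S -> bop H) (hpi : SQ mu D pi_)
  (* the Frechet space G, continuously and densely embedded in H *)
  (G : tvsType R[i]) (hG : frechet_space G)
  (j : {linear G -> H}) (j_cont : continuous j) (j_inj : injective j)
  (j_dense : closure (range j) = setT)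
  (* the Hilbert tensor product of H and its conjugate, with Lambda and Phi *)
  (T : hilbertType R) (tT : H -> conj_space H -> T)
  (hT : is_hilbert_tensor tT)
  (Lam : T -> bop H) (hLam : is_Lambda tT Lam)
  (Phi : {linear T -> L2 mu}) (hPhi : is_Phi D pi_ tT Phi)
  (* the completed projective tensor product of G and its conjugate, and its
     canonical embedding *)
  (P : tvsType R[i]) (tP : G -> conj_space G -> P)
  (hP : is_projective_tensor tP)
  (iota : {linear P -> T}) (iota_cont : continuous iota)
  (iota_tensor : forall u v : G,
     iota (tP u (to_conj v)) = tT (j u) (to_conj (j v)))
  (iota_inj : injective iota)
  (* the completion X = B_oo(Sigma) of B_2(Sigma), its multiplier algebra and
     the extension of Pi to it *)
  (X : completeNormedModType R[i])
  (inX : {linear symB2 (Phi_inj hPhi) -> X})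
  (mulX : X -> X -> X) (starX : X -> X)
  (hX : normed_star_algebra mulX starX)
  (complX : is_star_completion
     (@sym_mul R H T (L2 mu) (Phi_inj hPhi) Lam)
     (@sym_star R H T (L2 mu) (Phi_inj hPhi) Lam)
     (fun f => opnorm (symPi Lam f)) inX mulX starX)
  (Pib : multiplier mulX -> bop H)
  (hPib : is_Pi_extension (symPi (Phi := Phi_inj hPhi) Lam) inX hX Pib) :
  let GS := symG (Phi_inj hPhi) iota_inj in
  let PiG (f : GS) : bop H := symPi Lam (symG_incl f) in
  let dotG (f g : GS) : R[i] := op_dot (PiG f) (PiG g) in
  let dotP (x y : P) : R[i] := dot (iota x) (iota y) in
  exists (mulP : P -> P -> P) (starP : P -> P),
    [/\ (* the *-algebra structure of P *)
        (forall u v u' v' : G,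
           mulP (tP u (to_conj v)) (tP u' (to_conj v')) =
           dot (j u') (j v) *: tP u (to_conj v')) /\
        (forall u v : G, starP (tP u (to_conj v)) = tP v (to_conj u)),
        frechet_hilbert_algebra
          (im_mul (f := symG_inj (Phi_inj hPhi) iota_inj) mulP)
          (im_star (f := symG_inj (Phi_inj hPhi) iota_inj) starP) dotG &
        [/\ (forall f : GS, symB1 Lam (symG_incl f)),
            continuous (@im_val _ _ _ _ : GS -> L2 mu) /\
            range (@im_val _ _ _ _ : symB2 (Phi_inj hPhi) -> L2 mu) `<=`
              closure (range (@im_val _ _ _ _ : GS -> L2 mu)),
            (let pairing (g : multiplier mulX) (f : GS) : R[i]^o :=
               op_dot (PiG f) (Pib g) in
             (forall g, topological_dual (pairing g)) /\ injective pairing),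
            frechet_hilbert_algebra mulP starP dotP &
            frechet_hilbert_iso mulP starP dotP
              (im_mul (f := symG_inj (Phi_inj hPhi) iota_inj) mulP)
              (im_star (f := symG_inj (Phi_inj hPhi) iota_inj) starP) dotG
              (@im_elt _ _ _ (symG_inj (Phi_inj hPhi) iota_inj))]].

Proof.
move=> GS PiG dotG dotP.
have [starP [cS St Sl opS]] := proj_star_exists hT hLam hP iota_cont iota_tensor.
have /choice[M hM] := proj_mul_exists hT hLam j_cont hP iota_cont iota_tensor iota_inj.
have cM z : continuous (M z) by case: (hM z).
have Mt u v u' v' : M (tP u (to_conj v)) (tP u' (to_conj v')) =
    dot (j u') (j v) *: tP u (to_conj v') by case: (hM (tP u (to_conj v))) => _ h _; exact: h.
have opM x y w : tensor_op Lam iota (M x y) w = tensor_op Lam iota x (tensor_op Lam iota y w).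
  by case: (hM x).
pose mulP : P -> P -> P := fun x => M x.
have PiGE (f : GS) : PiG f = Lam (iota (im_inv f)).
  by rewrite /PiG /symPi /symG_incl im_eltK.
(* The trace clause of [is_Lambda] identifies the trace form with the scalar product of tensors, so
   the algebra axioms transfer from P. *)
have dotGE : dotG = fun f g : GS => dotP (im_inv f) (im_inv g).
  apply/funext => f; apply/funext => g; rewrite /dotG /op_dot !PiGE.
  by have [_ _ _ h] := hLam; exact: h.
have fhP : frechet_hilbert_algebra mulP starP dotP.
  apply: (tensor_frechet_hilbert_algebra hT hLam j_cont hP iota_cont iota_tensor iota_inj j_inj) => //.
  by move=> z; exact: linearP.
exists mulP, starP; split.
- by split.
- by rewrite dotGE; exact: im_frechet_hilbert_algebra.
- split.
  + by move=> f; rewrite /symB1 /= -/(PiG f) PiGE; exact: (tensor_trace_class hT hLam j_cont hP iota_cont iota_tensor).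
  + have Phic : continuous Phi.
      apply: (@rnorm_linear_continuous _ _ _ Phi 1) => z.
      by rewrite mul1r /rnorm hPhi.1.
    have valE (f : GS) : im_val f = Phi (iota (im_inv f)) by rewrite -im_invE.
    split.
      rewrite (_ : @im_val _ _ _ _ = fun f : GS => Phi (iota (im_inv f))).
        exact: continuous_fun_comp (continuous_fun_comp (@im_inv_continuous _ _ _ _) iota_cont) Phic.
      by apply/funext => f; exact: valE.
    move=> _ [f _ <-]; rewrite -im_invE /= => B nB.
    have : closure (range iota) (im_inv f) by rewrite (tensor_dense hT j_dense iota_tensor).
    move=> /(_ _ (Phic _ _ nB))[_ [[z _ <-] Bz]].
    exists (Phi (iota z)); split => //; exists (im_elt _ z) => //.
  + split.
    * move=> g /=; have [l [ll cl _ tl]] := tensor_trace hT hLam j_cont hP iota_cont iota_tensor (adjoint (Pib g)).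
      rewrite (_ : (fun f : GS => _) = fun f : GS => l (im_inv f)).
        split; first by move=> a x y; rewrite linearP ll.
        exact: continuous_fun_comp (@im_inv_continuous _ _ _ _) cl.
      by apply/funext => f; rewrite /op_dot PiGE tl.
    * move=> g g' gg'; have [[Pinv PibK _] _ _ _ _] := hPib.
      apply: (can_inj PibK).
      (* The pairing determines the adjoint of [Pib g]; taking adjoints again recovers the operator,
         and [Pib] is injective. *)
      have adjK (A : bop H) : adjoint (adjoint A) = A.
        by apply: bop_ext => x; apply: dotI => y; rewrite -!adjointP adjointPr.
      rewrite -[LHS]adjK -[RHS]adjK; congr adjoint.
      apply: (tensor_trace_inj hT hLam j_cont hP iota_cont iota_tensor j_dense) => z.
      have /(congr1 (fun h => h (im_elt _ z))) := gg'.
      by rewrite /op_dot !PiGE im_eltK.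
  + exact: fhP.
  + by rewrite dotGE; exact: im_frechet_hilbert_iso.
Qed.
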